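(* Let $K$ be a field of characteristic $p\ge0$ and $n\ge1$. Then $$\mathrm{Rad}\,K\Sigma'(W_n)=\mathrm{Ker}\,\theta_n^K+\sum_{C\in\mathrm{Comp}_p(n)}Kx_C,$$ where $\mathrm{Comp}_p(n)$ is the set of signed compositions $C$ of $n$ such that $p$ divides $|\mathcal{W}(C)|$ (so it is empty if $p=0$).
   Context: $W_n$ is the group of permutations $\sigma$ of $I_n=\{\pm1,\dots,\pm n\}$ with $\sigma(-i)=-\sigma(i)$. It acts on $\mathbb{R}^n$ (canonical basis $e_1,\dots,e_n$, $e_{-i}=-e_i$) by $\sigma(e_i)=e_{\sigma(i)}$, and is the Weyl group of $\Phi_n=\{\pm 2e_i\}\cup\{\pm e_i\pm e_j : i<j\}$ with basis $\{2e_1,e_2-e_1,\dots,e_n-e_{n-1}\}$; $\Phi_n^+$ is the set of positive roots, and $\alpha>0$ means $\alpha\in\Phi_n^+$. For a root $\alpha$, $s_\alpha\in W_n$ is the reflection in $\alpha$. A signed composition of $n$ is a finite sequence $C=(c_1,\dots,c_r)$ of non-zero integers with $\sum|c_i|=n$; $\mathrm{Comp}(n)$ is the set of these. Let $I_{C,+}^{(i)}=\{k\in\mathbb{N}: |c_1|+\dots+|c_{i-1}|+1\le k\le |c_1|+\dots+|c_i|\}$, $I_C^{(i)}=I_{C,+}^{(i)}$ if $c_i<0$ and $I_C^{(i)}=I_{C,+}^{(i)}\cup -I_{C,+}^{(i)}$ if $c_i>0$, and $W_C=\{w\in W_n : w(I_C^{(i)})=I_C^{(i)}\ \forall i\}$.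 Let $\Phi_C=\{\alpha\in\Phi_n: s_\alpha\in W_C\}$, $\Phi_C^+=\Phi_C\cap\Phi_n^+$, and $\Delta_C$ the basis (set of simple roots) of $\Phi_C$ contained in $\Phi_C^+$. Let $X_C=\{w\in W_n: w(\alpha)>0\ \forall\alpha\in\Phi_C^+\}$ (representatives of $W_n/W_C$) and $x_C=\sum_{w\in X_C}w\in KW_n$. The $x_C$ are linearly independent and $K\Sigma'(W_n)=\bigoplus_{C}Kx_C$ is a unital subalgebra of $KW_n$ (Mantaci-Reutenauer algebra). $K\,\mathrm{Irr}\,W_n=K\otimes_{\mathbb{Z}}\mathbb{Z}\,\mathrm{Irr}\,W_n$, where $\mathbb{Z}\,\mathrm{Irr}\,W_n$ is the ring of virtual complex characters of $W_n$. $\theta_n^K:K\Sigma'(W_n)\to K\,\mathrm{Irr}\,W_n$ is the (surjective) algebra morphism with $\theta_n^K(x_C)=\mathrm{Ind}_{W_C}^{W_n}1$. Finally $\mathcal{W}(C)=\{w\in W_n: w(\Delta_C)=\Delta_C\}$, a group isomorphic to $N_{W_n}(W_C)/W_C$. $\mathrm{Rad}$ denotes the Jacobson radical. *)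

(* Defs.v *)
From HB Require Import structures.
From mathcomp Require Import all_boot all_order all_fingroup all_algebra.
From mathcomp Require Import all_field all_character.
From mathcomp Require Import finmap.

Set Implicit Arguments.
Unset Strict Implicit.
Unset Printing Implicit Defensive.

Import Order.TTheory GRing.Theory Num.Theory.
Local Open Scope ring_scope.

(** * Group algebras and the Jacobson radical *)

Section GroupAlgebra.

Variables (K : fieldType) (gT : finGroupType).

(* An alias of {ffun gT -> K}: the product is convolution, not pointwise. *)
Definition galg := {ffun gT -> K}.

HB.instance Definition _ := Vector.copy galg {ffun gT -> K^o}.

Implicit Types (a b c : galg) (g h : gT).

Definition gelt g : galg := [ffun h => (h == g)%:R].

Definition gmul a b : galg :=
  [ffun g => \sum_(h : gT) a h * b (h^-1 * g)%g].

Lemma gmulE a b g : gmul a b g = \sum_(h : gT) a h * b (h^-1 * g)%g.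
Proof. by rewrite ffunE. Qed.

Fact gmulA : associative gmul.
Proof.
move=> a b c; apply/ffunP=> g; rewrite !gmulE.
under eq_bigr => h _ do rewrite gmulE mulr_sumr.
under [RHS]eq_bigr => h _ do rewrite gmulE mulr_suml.
rewrite [RHS]exchange_big /=; apply: eq_bigr => h _.
rewrite [RHS](reindex_inj (mulgI h)) /=; apply: eq_bigr => k _.
by rewrite mulKg invMg mulgA mulrA.
Qed.

Fact gmul1l : left_id (gelt 1%g) gmul.
Proof.
move=> a; apply/ffunP=> g; rewrite !ffunE (bigD1 1%g) //= big1 => [|h h1].
  by rewrite ffunE eqxx mul1r invg1 mul1g addr0.
by rewrite ffunE (negbTE h1) mul0r.
Qed.

Fact gmul1r : right_id (gelt 1%g) gmul.
Proof.
move=> a; apply/ffunP=> g; rewrite !ffunE (bigD1 g) //= big1 => [|h hg].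
  by rewrite ffunE mulVg eqxx mulr1 addr0.
rewrite ffunE; case: eqP => [e|_]; last by rewrite mulr0.
by case/eqP: hg; rewrite -[RHS](mulKVg h) e mulg1.
Qed.

Fact gmulDl : left_distributive gmul +%R.
Proof.
move=> a b c; apply/ffunP=> g; rewrite !ffunE -big_split /=.
by apply: eq_bigr => h _; rewrite ffunE mulrDl.
Qed.

Fact gmulDr : right_distributive gmul +%R.
Proof.
move=> a b c; apply/ffunP=> g; rewrite !ffunE -big_split /=.
by apply: eq_bigr => h _; rewrite ffunE mulrDr.
Qed.

Fact gelt1_neq0 : gelt 1%g != 0.
Proof.
by apply/eqP=> /ffunP/(_ 1%g)/eqP; rewrite !ffunE eqxx (oner_eq0 K).
Qed.

HB.instance Definition _ := GRing.Zmodule_isNzRing.Build galg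
  gmulA gmul1l gmul1r gmulDl gmulDr gelt1_neq0.

Lemma gscaleE (k : K) a g : (k *: a) g = k * a g.
Proof. by rewrite ffunE. Qed.

Fact gscaleAl (k : K) a b : k *: (a * b) = (k *: a) * b.
Proof.
apply/ffunP=> g; rewrite gscaleE !gmulE mulr_sumr; apply: eq_bigr => h _.
by rewrite gscaleE mulrA.
Qed.

Fact gscaleAr (k : K) a b : k *: (a * b) = a * (k *: b).
Proof.
apply/ffunP=> g; rewrite gscaleE !gmulE mulr_sumr; apply: eq_bigr => h _.
by rewrite gscaleE mulrCA.
Qed.

HB.instance Definition _ := GRing.Lmodule_isLalgebra.Build K galg gscaleAl.
HB.instance Definition _ := GRing.Lalgebra_isAlgebra.Build K galg gscaleAr.
HB.instance Definition _ := Algebra_isFalgebra.Build K galg.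

Lemma gelt1 : gelt 1%g = 1. Proof. by []. Qed.

Lemma geltM g h : gelt (g * h)%g = gelt g * gelt h.
Proof.
apply/ffunP=> k; rewrite !ffunE (bigD1 g) //= big1 => [|i ig].
  by rewrite !ffunE eqxx mul1r addr0 -[(_ * k == h)%g](inj_eq (mulgI g)) mulKVg.
by rewrite ffunE (negbTE ig) mul0r.
Qed.

End GroupAlgebra.

Section Radical.

Variables (K : fieldType) (aT : falgType K).
Implicit Types A I M : {vspace aT}.

(* A stands for a unital subalgebra of aT; its left ideals, being stable under
   K.1, are automatically K-subspaces. *)
Definition left_ideal A I := (I <= A)%VS && (A * I <= I)%VS.

Definition maximal_left_ideal A M :=
  [/\ left_ideal A M, M != A
    & forall I, left_ideal A I -> (M <= I)%VS -> I = M \/ I = A].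

Definition in_jacobson_radical A (a : aT) :=
  a \in A /\ forall M, maximal_left_ideal A M -> a \in M.

End Radical.

Definition has_characteristic (K : fieldType) (p : nat) :=
  if p is 0 then [pchar K] =i pred0 else p \in [pchar K].

(** * Signed permutations *)

(* (false, k) stands for k + 1 and (true, k) for - (k + 1). *)
Definition sidx n := (bool * 'I_n)%type.

Definition sopp n (x : sidx n) : sidx n := (~~ x.1, x.2).

Definition signed n (s : {perm sidx n}) :=
  [forall x, s (sopp x) == sopp (s x)].

Record sperm n := SPerm { sperm_val :> {perm sidx n}; _ : signed sperm_val }.

HB.instance Definition _ n := [isSub for @sperm_val n].
HB.instance Definition _ n := [Finite of sperm n by <:].

Section SignedPermGroup.

Variable n : nat.
Implicit Types u v w : sperm n.

Lemma sperm_opp w x : w (sopp x) = sopp (w x).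
Proof. by apply/eqP; apply: (forallP (valP w)). Qed.

Fact sperm1_subproof : signed (1%g : {perm sidx n}).
Proof. by apply/forallP=> x; rewrite !perm1. Qed.

Fact spermM_subproof u v : signed (val v * val u)%g.
Proof. by apply/forallP=> x; rewrite !permM !sperm_opp. Qed.

Fact spermV_subproof w : signed (val w)^-1%g.
Proof.
apply/forallP=> x; apply/eqP; apply: (@perm_inj _ (val w)).
by rewrite permKV sperm_opp permKV.
Qed.

(* The group law of {perm T} is (s * t) x = t (s x); the product on W_n is
   composition, (u * v) x = u (v x), whence the swap. *)
Definition sperm1 := SPerm sperm1_subproof.
Definition spermM u v := SPerm (spermM_subproof u v).
Definition spermV w := SPerm (spermV_subproof w).

Fact spermMA : associative spermM.
Proof. by move=> u v w; apply: val_inj; rewrite /= mulgA. Qed.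

Fact spermM1 : left_id sperm1 spermM.
Proof. by move=> w; apply: val_inj; rewrite /= mulg1. Qed.

Fact spermMV : left_inverse sperm1 spermV spermM.
Proof. by move=> w; apply: val_inj; rewrite /= mulgV. Qed.

HB.instance Definition _ :=
  Finite_isGroup.Build (sperm n) spermMA spermM1 spermMV.

Lemma spermE u v x : (u * v)%g x = u (v x).
Proof. by rewrite permM. Qed.

End SignedPermGroup.

(** * The root system of type C *)

Section Roots.

Variable n : nat.
Local Notation V := 'rV[rat]_n.
Local Open Scope fset_scope.
Implicit Types (w : sperm n) (a b v : V).

Definition evec (x : sidx n) : V := (-1) ^+ x.1 *: delta_mx 0 x.2.

Definition sact w v : V := \sum_(i < n) v 0 i *: evec (w (false, i)).

Definition dotv a b : rat := \sum_(i < n) a 0 i * b 0 i.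

Definition refl a v : V := v - (2 * dotv v a / dotv a a) *: a.

Definition is_reflection a w :=
  [forall x : sidx n, sact w (evec x) == refl a (evec x)].

Definition Phi : {fset V} :=
  [fset 2 *: evec x | x : sidx n] `|`
  [fset (evec z.1 + evec z.2)%R |
     z in [set z : sidx n * sidx n | (z.1.2 < z.2.2)%N]].

(* On the free families used below, coord is the coordinate function. *)
Definition nonneg_comb m (D : m.-tuple V) v :=
  (v \in <<D>>%VS) && [forall i, coord D i v \is a Num.nat].

(* 2e_1, e_2 - e_1, ..., e_n - e_(n-1) *)
Definition simple_root (i : 'I_n) : V :=
  if val i == 0%N then 2 *: evec (false, i)
  else evec (false, i) - evec (false, ord_pred i).

Definition Phi_pos : {fset V} :=
  [fset a in Phi | nonneg_comb [tuple simple_root i | i < n] a].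

Definition is_base (P D : {fset V}) :=
  [&& D `<=` P, basis_of <<P>>%VS D &
      all (fun a => nonneg_comb (in_tuple D) a || nonneg_comb (in_tuple D) (- a))
          P].

(* The base of the root system P contained in the set of positive roots. *)
Definition base_of (P : {fset V}) : {fset V} :=
  head fset0 [seq D : {fset V} <- fpowerset (P `&` Phi_pos) | is_base P D].

End Roots.

(** * Signed compositions *)

Definition is_scomp n (C : seq int) :=
  (0 \notin C) && (\sum_(c <- C) `|c| == n)%N.

Record scomp n := SComp { scomp_val :> seq int; _ : is_scomp n scomp_val }.

HB.instance Definition _ n := [isSub for @scomp_val n].
HB.instance Definition _ n := [Countable of scomp n by <:].

Section FiniteScomp.

Variable n : nat.

Fixpoint seqs_upto (L : seq int) k : seq (seq int) :=
  if k is k'.+1 then [::] :: [seq c :: s | c <- L, s <- seqs_upto L k']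
  else [:: [::]].

Lemma mem_seqs_upto L k s :
  (size s <= k)%N -> all (mem L) s -> s \in seqs_upto L k.
Proof.
elim: k s => [|k IHk] [|c s] //= sk /andP[cL sL].
by rewrite inE; apply/allpairsP; exists (c, s); split=> //=; apply: IHk.
Qed.

Definition scomp_enum : seq (scomp n) :=
  undup (pmap insub
    (seqs_upto ([seq - i%:Z | i <- iota 1 n] ++
                [seq i%:Z | i <- iota 1 n]) n)).

Fact scomp_enumP : Finite.axiom scomp_enum.
Proof.
apply: Finite.uniq_enumP => [|C]; first exact: undup_uniq.
rewrite mem_undup mem_pmap_sub /=.
have /andP[C0 /eqP Cn] := valP C.
apply: mem_seqs_upto.
  rewrite -[X in (_ <= X)%N]Cn -sum1_size big_seq [leqRHS]big_seq.
  apply: leq_sum => c cC; rewrite absz_gt0.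
  by apply: contraNneq C0 => <-.
apply/allP=> c cC.
have cn : (`|c| <= n)%N.
  by rewrite -Cn (perm_big _ (perm_to_rem cC)) big_cons leq_addr.
have c_neq0 : (0 < `|c|)%N.
  by rewrite absz_gt0; apply: contraNneq C0 => <-.
rewrite /= mem_cat; case: (lerP 0 c) => c0; apply/orP; [right | left];
  apply/mapP; exists `|c|%N; rewrite ?mem_iota ?c_neq0 //.
  by rewrite gez0_abs.
by rewrite ltz0_abs ?opprK.
Qed.

HB.instance Definition _ := isFinite.Build (scomp n) scomp_enumP.

End FiniteScomp.

Section ScompSubgroup.

Variables (n : nat) (C : scomp n).
Implicit Types (i : 'I_(size C)) (w : sperm n).
Local Open Scope fset_scope.

Definition offset (i : nat) : nat := \sum_(c <- take i C) `|c|%N.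

(* Blocks are numbered from 0, and so are the elements k of 'I_n. *)
Definition block_pos i : {set sidx n} :=
  [set (false, k) | k : 'I_n & (offset i <= k < offset i.+1)%N].

Definition block i : {set sidx n} :=
  if C`_i < 0 then block_pos i
  else block_pos i :|: [set sopp x | x in block_pos i].

Definition WC : {set sperm n} :=
  [set w : sperm n | [forall i, [set w x | x in block i] == block i]].

Fact WC_group_set : group_set WC.
Proof.
apply/group_setP; split=> [|u v].
  rewrite inE; apply/forallP=> i; apply/eqP.
  rewrite -[RHS]imset_id; apply: eq_imset => x; exact: perm1.
rewrite !inE => /forallP uW /forallP vW; apply/forallP=> i; apply/eqP.
rewrite -[RHS](eqP (uW i)) -[in RHS](eqP (vW i)) -imset_comp.
by apply: eq_imset => x; rewrite /= permM.
Qed.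

Canonical WC_group := Group WC_group_set.

Definition PhiC : {fset 'rV[rat]_n} :=
  [fset a in Phi n | [exists w in WC, is_reflection a w]].

Definition PhiC_pos := PhiC `&` Phi_pos n.

Definition DeltaC : {fset 'rV[rat]_n} := base_of PhiC.

Definition XC : {set sperm n} :=
  [set w | [forall a : PhiC_pos, sact w (val a) \in Phi_pos n]].

Definition calW : {set sperm n} :=
  [set w | [fset sact w a | a in DeltaC] == DeltaC].

Definition xC (K : fieldType) : galg K (sperm n) := \sum_(w in XC) gelt K w.

Definition Ind1C : 'CF([set: sperm n]) := 'Ind[[set: sperm n], WC] 1.

End ScompSubgroup.

(** * The Mantaci-Reutenauer algebra and the morphism theta *)

Section MantaciReutenauer.

Variables (K : fieldType) (n : nat).
Local Notation Wn := [set: sperm n].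

Definition KSigma : {vspace galg K (sperm n)} := <<[seq xC C K | C : scomp n]>>.

(* K (x) Z Irr W_n, in its K-basis 1 (x) 'chi_i. Its product is not needed:
   the kernel of theta only depends on the K-module structure. *)
Definition KIrr := {ffun Iirr Wn -> K^o}.

(* phi |-> 1 (x) phi, for a virtual character phi: the coordinates of phi on
   irr are then integers, and Num.floor only changes their type. *)
Definition toKIrr (phi : 'CF(Wn)) : KIrr :=
  [ffun i => (Num.floor '[phi, 'chi_i])%:~R].

Definition xtuple : #|{: scomp n}|.-tuple (galg K (sperm n)) :=
  [tuple xC (enum_val i) K | i < #|{: scomp n}|].

(* The x_C being linearly independent, this is on KSigma the linear map sending
   x_C to Ind_(W_C)^(W_n) 1; outside KSigma its values are irrelevant. *)
Definition theta : 'Hom(galg K (sperm n), KIrr) :=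
  linfun (fun a => \sum_i coord xtuple i a *: toKIrr (Ind1C (enum_val i))).

Definition Ker_theta : {vspace galg K (sperm n)} := (KSigma :&: lker theta)%VS.

End MantaciReutenauer.

(* Main.v *)
Require Import Defs.
From HB Require Import structures.
From mathcomp Require Import all_boot all_order all_fingroup all_algebra.
From mathcomp Require Import all_field all_character.
From mathcomp Require Import finmap zify.

Set Implicit Arguments.
Unset Strict Implicit.
Unset Printing Implicit Defensive.

Import Order.TTheory GRing.Theory Num.Theory.
Local Open Scope ring_scope.

(** Why the theorem is true. The algebra of the x_C is, up to reversing
   products, the algebra of functions invariant under S_n on a finite monoid of
   coloured ordered set partitions of {1, ..., n}, called cells below. Two cells
   are multiplied by intersecting their blocks in lexicographic order and adding
   colours in Z/2, the order being reversed inside the blocks of colour 1. The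
   cells with singleton blocks, the chambers, are the words of the elements of
   W_n, so an invariant function a on cells acts on chambers as right
   multiplication by an element galg_of a of K W_n (galg_of_conv). The
   element x_C is the image of the sum x_lift C of the cells attached to the
   cosets of W_C (galg_of_lift): the coset w W_C is determined by the images
   under w of the blocks of C, a negative block giving a signed set, that is a
   block of negative signs followed by one of positive signs. These lifts form
   a basis of the invariant functions, by a triangularity argument (inv_span,
   comb_lift_eq0), and galg_of is injective on invariant functions
   (galg_of_inj). So the x_C are linearly independent and their span is a unital
   subalgebra.

   In the monoid the radical is visible. For a set partition of {1, ..., n} with
   a sign on each block, summing the coefficients of the cells with coarser
   blocks, twisted by the corresponding character of the group of colourings, is
   an algebra morphism to K (cell_char_conv). If all of these vanish at a, then
   multiplying twice on the right by a strictly refines blocks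
   (conv_conv_refines), since the part of a which does not refine them squares
   to zero in the group algebra of an elementary abelian 2-group: it vanishes
   by Fourier inversion if 2 is invertible in K, and otherwise an element of
   augmentation 0 squares to 0. Hence the common kernel of the morphisms is nil,
   and it is the radical (jacobson_common_kernel, KSigma_radical).

   The morphism attached to a signed partition maps x_C to the number of cosets
   of W_C fixed by an element g with one signed cycle per block
   (cell_char_lift), by a sign-reversing involution. This number is the value
   at g of the character induced from the trivial one of W_C (Ind1CE). It
   remains to compare the common kernel of these values with the right-hand
   side of the theorem. The kernel of theta is inside it because, character
   values being algebraic integers, a Smith normal form writes the values at g
   as integral combinations of the multiplicities of the irreducible characters
   (int_solution, Ker_theta_evalx). If p divides the order of N(W_C) / W_C, then
   x_C is inside it because this group acts freely on the fixed cosets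
   (calW_dvd_fixed). For the converse, evaluate at a Coxeter element of W_C: the
   value of x_D is nonzero only if W_C is conjugate to a subgroup of W_D, and it
   is the order of N(W_C) / W_C for D = C; so an element of the common kernel is
   reduced to 0, starting from the largest C in its support
   (common_kernel_rad_sum). *)

(** * Signed permutations *)

Section SignedPermutations.

Variable n : nat.
Implicit Types (x y z : sidx n) (u v w : sperm n) (s : {perm 'I_n}).

Lemma soppK : involutive (@sopp n).
Proof. by case=> b k; rewrite /sopp /= negbK. Qed.

Lemma sopp_neq x : sopp x != x.
Proof. by case: x => b k; rewrite xpair_eqE; case: b. Qed.

Lemma sperm_inj w : injective w.
Proof. exact: perm_inj. Qed.

Lemma spermVE w x : (w^-1)%g (w x) = x.
Proof. by rewrite -spermE mulVg /= perm1. Qed.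

Lemma spermEV w x : w ((w^-1)%g x) = x.
Proof. by rewrite -spermE mulgV /= perm1. Qed.

Lemma sperm1E x : (1%g : sperm n) x = x.
Proof. exact: perm1. Qed.

Lemma spermP u v : (forall k, u (false, k) = v (false, k)) -> u = v.
Proof.
move=> uv; apply: val_inj; apply/permP=> -[[] k]; last exact: uv.
by rewrite -[(true, k)]/(sopp (false, k)) !sperm_opp uv.
Qed.

Section Make.

Variables (s : {perm 'I_n}) (c : 'I_n -> bool).

Definition signed_perm_fun x : sidx n := (x.1 (+) c x.2, s x.2).

Fact signed_perm_inj : injective signed_perm_fun.
Proof.
move=> [b k] [b' k'] [] /= e /perm_inj ek; rewrite ek in e *.
by move/addIb: e => ->.
Qed.

Fact signed_perm_subproof : signed (perm signed_perm_inj).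
Proof.
by apply/forallP=> -[b k]; rewrite !permE /signed_perm_fun /sopp /= addNb.
Qed.

Definition signed_perm := SPerm signed_perm_subproof.

Lemma signed_permE x : signed_perm x = (x.1 (+) c x.2, s x.2).
Proof. by rewrite permE. Qed.

End Make.

Fact abs_perm_inj w : injective (fun k => (w (false, k)).2).
Proof.
move=> k l e; case: (eqVneq (w (false, k)).1 (w (false, l)).1) => e1.
  have /sperm_inj[//] : w (false, k) = w (false, l).
  by rewrite [LHS]surjective_pairing e1 e -surjective_pairing.
have /sperm_inj[//] : w (false, k) = w (true, l).
rewrite -[(true, l)]/(sopp (false, l)) sperm_opp /sopp -e.
by move: e1; case: (w (false, k)) => [[] k1]; case: (w (false, l)) => [[] l1].
Qed.

Definition abs_perm w : {perm 'I_n} := perm (@abs_perm_inj w).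

Lemma absp_posE w k : abs_perm w k = (w (false, k)).2.
Proof. by rewrite permE. Qed.

Lemma abspE w x : (w x).2 = abs_perm w x.2.
Proof.
rewrite absp_posE; case: x => [[] k] //=.
by rewrite -[(true, k)]/(sopp (false, k)) sperm_opp.
Qed.

Lemma sperm_sign w x : (w x).1 = x.1 (+) (w (false, x.2)).1.
Proof.
case: x => [[] k] //=.
by rewrite -[(true, k)]/(sopp (false, k)) sperm_opp.
Qed.

Lemma abspM u v k : abs_perm (u * v)%g k = abs_perm u (abs_perm v k).
Proof. by rewrite !absp_posE spermE abspE /= absp_posE. Qed.

Lemma abspVK w k : abs_perm (w^-1)%g (abs_perm w k) = k.
Proof. by rewrite -abspM mulVg absp_posE sperm1E. Qed.

Lemma abspKV w k : abs_perm w (abs_perm (w^-1)%g k) = k.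
Proof. by rewrite -abspM mulgV absp_posE sperm1E. Qed.

(** The order is that of the integers, and taking odd values keeps the spacing
   constant across 0, so that all simple roots below get height 2. *)
Definition hgt x : int := if x.1 then - (x.2.*2.+1)%:Z else (x.2.*2.+1)%:Z.

Lemma hgt_opp x : hgt (sopp x) = - hgt x.
Proof. by case: x => [[] k]; rewrite /hgt /= ?opprK. Qed.

Lemma hgt_inj : injective hgt.
Proof.
case=> [b k] [b' k']; rewrite /hgt /= => e.
have [-> ekk] : b = b' /\ (k : nat) = k'.
  by case: b b' e => [] [] e; lia.
by congr (_, _); apply: val_inj.
Qed.

(** The reflection in the root e_y - e_x. It is the transposition of |x| and |y|
   with two sign changes when x and y have opposite signs; the formula also
   covers y = - x. *)
Definition srefl x y :=
  signed_perm (tperm x.2 y.2) (fun k => ((k == x.2) || (k == y.2)) && (x.1 (+) y.1)).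

Lemma sreflE x y z : srefl x y z =
  if z == x then y else if z == y then x
  else if z == sopp x then sopp y else if z == sopp y then sopp x else z.
Proof.
rewrite signed_permE; case: x y z => [b k] [c l] [d m]; rewrite /sopp !xpair_eqE /=.
case: (eqVneq m k) => [{m}->|mk]; last first.
  case: (eqVneq m l) mk => [{m}-> lk|ml mk]; last first.
    by rewrite /= !andbF addbF tpermD 1?eq_sym.
  by rewrite tpermR /=; case: b c d => [] [] [].
by rewrite tpermL; case: (eqVneq k l) => [<-|kl]; case: b c d => [] [] [].
Qed.

Lemma sreflK x y : involutive (srefl x y).
Proof.
case: x y => [b k] [c l] [d m]; rewrite !signed_permE /= tpermK; congr (_, _).
by case: tpermP => [->|->|/eqP/negbTE mk /eqP/negbTE ml];
  rewrite ?eqxx ?orbT ?(negbTE mk) ?(negbTE ml) ?mk ?ml; case: d b c => [] [] [].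
Qed.

End SignedPermutations.

(** * Blocks, cosets and their increasing representatives *)

Section Blocks.

Variables (n : nat) (C : scomp n).
Implicit Types (x y z : sidx n) (u v w t : sperm n).

Lemma offset0 : offset C 0 = 0%N.
Proof. by rewrite /offset take0 big_nil. Qed.

Lemma offset_size : offset C (size C) = n.
Proof. by rewrite /offset take_size; case/andP: (valP C) => _ /eqP. Qed.

Lemma offsetS i : (i < size C)%N -> offset C i.+1 = (offset C i + `|((val C)`_i)%R|)%N.
Proof. by move=> iC; rewrite /offset (take_nth 0 iC) big_rcons. Qed.

Lemma scomp_neq0 i : (i < size C)%N -> (val C)`_i != 0.
Proof.
move=> iC; case/andP: (valP C) => + _; apply: contraNneq => <-.
exact: mem_nth.
Qed.

Lemma offset_ltS i : (i < size C)%N -> (offset C i < offset C i.+1)%N.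
Proof.
by move=> iC; rewrite offsetS // -[ltnLHS]addn0 ltn_add2l absz_gt0 scomp_neq0.
Qed.

Lemma leq_offset i j : (i <= j <= size C)%N -> (offset C i <= offset C j)%N.
Proof.
case/andP=> ij jC; elim: j ij jC => [|j IHj]; first by case: i.
rewrite leq_eqVlt => /predU1P[-> //|ij] jC.
by apply: leq_trans (IHj _ (ltnW jC)) (ltnW (offset_ltS jC)).
Qed.

(** Counting the ends of blocks before p, rather than searching for the block
   of p, makes monotonicity plain. *)
Definition blk (p : nat) : nat :=
  count (fun i => offset C i.+1 <= p)%N (iota 0 (size C)).

Lemma leq_blk p q : (p <= q)%N -> (blk p <= blk q)%N.
Proof. by move=> pq; apply: sub_count => i /= /leq_trans; apply. Qed.

Lemma blk_eq i p : (i < size C)%N ->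
  (offset C i <= p < offset C i.+1)%N -> blk p = i.
Proof.
move=> iC /andP[ip pi].
have -> : blk p = count (fun j => j < i)%N (iota 0 (size C)).
  apply: eq_in_count => j; rewrite mem_iota add0n /= => jC.
  apply/idP/idP => [jp|ji]; last first.
    by apply: leq_trans ip; apply: leq_offset; rewrite ji ltnW.
  rewrite ltnNge; apply/negP=> ij.
  suff : (p < p)%N by rewrite ltnn.
  by apply: leq_trans pi (leq_trans _ jp); apply: leq_offset; rewrite ltnS ij.
rewrite -(subnKC (ltnW iC)) iotaD count_cat.
rewrite (@eq_in_count _ _ predT) => [|j]; last first.
  by rewrite mem_iota add0n /= => ->.
rewrite count_predT size_iota (@eq_in_count _ _ pred0) => [|j]; last first.
  by rewrite mem_iota add0n /= => /andP[]; rewrite leqNgt => /negbTE.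
by rewrite count_pred0 addn0.
Qed.

Lemma blk_ex p : (p < n)%N ->
  exists2 i, (i < size C)%N & (offset C i <= p < offset C i.+1)%N.
Proof.
rewrite -[X in (p < X)%N]offset_size => pC.
have ex : exists i, (p < offset C i)%N by exists (size C).
case: (ex_minnP ex) => -[|i]; first by rewrite offset0.
move=> pi imin; exists i.
  by rewrite ltnNge; apply/negP=> Ci; have:= imin _ pC; rewrite leqNgt ltnS Ci.
by rewrite pi andbT leqNgt; apply/negP=> /imin; rewrite ltnn.
Qed.

Lemma blkP i p : (p < n)%N -> (i < size C)%N ->
  (blk p == i) = (offset C i <= p < offset C i.+1)%N.
Proof.
move=> pn iC; apply/eqP/idP => [<-|/(blk_eq iC) //].
by have [j jC jp] := blk_ex pn; rewrite (blk_eq jC jp).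
Qed.

Lemma blk_lt p : (p < n)%N -> (blk p < size C)%N.
Proof. by move=> pn; have [j jC jp] := blk_ex pn; rewrite (blk_eq jC jp). Qed.

Definition bneg (p : nat) : bool := (val C)`_(blk p) < 0.

(** Two signed points have the same label when they lie in the same set I_C^(i),
   or both in the opposite of the same negative one; the second kind of set gets
   the even labels, and comes just before its opposite. *)
Definition lab x : nat := ((blk x.2).*2 + ~~ (x.1 && bneg x.2))%N.

Lemma lab_half x : (lab x)./2 = blk x.2.
Proof. by rewrite /lab addnC half_bit_double. Qed.

Lemma lab_odd x : odd (lab x) = ~~ (x.1 && bneg x.2).
Proof. by rewrite /lab oddD odd_double; case: (x.1 && _). Qed.

Lemma lab_blk x y : lab x = lab y -> blk x.2 = blk y.2.
Proof. by rewrite -!lab_half => ->. Qed.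

Lemma lab_bneg x y : lab x = lab y -> bneg x.2 = bneg y.2.
Proof. by rewrite /bneg => /lab_blk ->. Qed.

Lemma lab_sign x y : lab x = lab y -> bneg x.2 -> x.1 = y.1.
Proof.
move=> e xn; have := congr1 odd e; rewrite !lab_odd -(lab_bneg e) xn !andbT.
exact: negb_inj.
Qed.

Lemma labP x y : reflect
  (blk x.2 = blk y.2 /\ (bneg x.2 -> x.1 = y.1)) (lab x == lab y).
Proof.
apply: (iffP eqP) => [e|[e es]]; first by split; [exact: lab_blk | exact: lab_sign].
rewrite /lab e; congr (_ + nat_of_bool (~~ _))%N; move: es; rewrite /bneg e.
by case: (_ < 0) => [->|]; rewrite ?andbF.
Qed.

Lemma lab_opp x y : lab x = lab y -> lab (sopp x) = lab (sopp y).
Proof.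
by move=> /eqP/labP[e es]; apply/eqP/labP; split=> //= /es ->.
Qed.

Lemma lab_eq_opp x y : (lab (sopp x) == lab (sopp y)) = (lab x == lab y).
Proof.
apply/eqP/eqP; last exact: lab_opp.
by move/lab_opp; rewrite !soppK.
Qed.

Lemma lab_oppE x : (lab (sopp x) == lab x) = ~~ bneg x.2.
Proof.
apply/labP/idP => /= [[_ h]|/negbTE ->]; last by split.
by apply/negP=> /h; case: (x.1).
Qed.

Lemma mem_block (i : 'I_(size C)) x :
  (x \in block i) = (blk x.2 == i) && ~~ (x.1 && bneg x.2).
Proof.
have inpos z : (z \in block_pos i) = (blk z.2 == i) && ~~ z.1.
  case: z => [b k]; rewrite blkP //=.
  apply/imsetP/andP => [[l]|[ki]].
    by rewrite inE => li [-> ->].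
  by case: b => // _; exists k => //; rewrite inE.
rewrite /block; case: ifP => Ci.
  rewrite inpos; case: eqP => //= e; rewrite /bneg e Ci andbT //.
have inneg : (x \in [set sopp x | x in block_pos i]) = (blk x.2 == i) && x.1.
  apply/imsetP/idP => [[z] zi ->|xi].
    by move: zi; rewrite inpos /= => /andP[-> ->].
  by exists (sopp x); rewrite ?soppK // inpos /= negbK.
rewrite !inE inpos inneg; case: eqP => //= e; rewrite /bneg e Ci andbF.
by case: x.1.
Qed.

Lemma WC_lab w : (w \in WC C) = [forall x, lab (w x) == lab x].
Proof.
rewrite inE; apply/forallP/forallP => [wC|wl i].
  have pos x : ~~ (x.1 && bneg x.2) -> lab (w x) == lab x.
    move=> xp; pose i := Ordinal (blk_lt (ltn_ord x.2)).
    have : w x \in block i.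
      by rewrite -(eqP (wC i)); apply: imset_f; rewrite mem_block eqxx.
    rewrite mem_block /= => /andP[/eqP e /negbTE e1].
    by rewrite /lab e1 (negbTE xp) e.
  move=> x; case: (boolP (x.1 && bneg x.2)) => [/andP[x1 _]|/pos //].
  by rewrite -lab_eq_opp -sperm_opp; apply: pos; rewrite /= x1.
have le : [set w x | x in block i] \subset block i.
  apply/subsetP=> _ /imsetP[x xi ->]; move: xi.
  rewrite !mem_block -!lab_half -!lab_odd.
  by rewrite (eqP (wl x)).
by rewrite eqEcard le (card_imset _ (@sperm_inj _ w)) leqnn.
Qed.

Lemma WCP w : reflect (forall x, lab (w x) = lab x) (w \in WC C).
Proof.
by rewrite WC_lab; apply: (iffP forallP) => h x; apply/eqP; [apply: h|rewrite h].
Qed.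

Lemma srefl_WC x y : lab x = lab y -> srefl x y \in WC C.
Proof.
move=> e; have e' := lab_opp e; apply/WCP=> z; rewrite sreflE.
case: (z =P x) => [->|_]; first by rewrite e.
case: (z =P y) => [->|_]; first by rewrite e.
case: (z =P sopp x) => [->|_]; first by rewrite e'.
by case: (z =P sopp y) => [->|_]; rewrite ?e'.
Qed.

(** The set X_C without roots (XC_incr): a positive block is closed under
   opposites, so being increasing on its class includes being positive on its
   positive points. *)
Definition incr_reps : {set sperm n} :=
  [set w : sperm n | [forall x, forall y,
     (lab x == lab y) && (hgt x < hgt y) ==> (hgt (w x) < hgt (w y))]].

Lemma incr_repsP w : reflect
  (forall x y, lab x = lab y -> hgt x < hgt y -> hgt (w x) < hgt (w y))
  (w \in incr_reps).
Proof.
rewrite inE; apply: (iffP forallP) => [h x y e xy|h x].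
  by have /forallP/(_ y)/implyP := h x; apply; rewrite e eqxx.
by apply/forallP=> y; apply/implyP=> /andP[/eqP]; apply: h.
Qed.

Lemma sum_delta_int (T : finType) (a : T) (f : T -> int) :
  \sum_z (z == a)%:R * f z = f a.
Proof.
rewrite (bigD1 a) //= eqxx mul1r big1 ?addr0 // => z /negbTE ->.
by rewrite mul0r.
Qed.

(** In the coset, maximise the sum of x * u(x): undoing a descent of u inside a
   class of equal labels increases this sum, by the rearrangement inequality. *)
Lemma incr_reps_ex w : exists2 t, t \in WC C & (w * t)%g \in incr_reps.
Proof.
pose F t := \sum_x hgt x * hgt ((w * t)%g x).
have w1 : (1%g : sperm n) \in WC C by apply: group1.
case: (arg_maxP F w1) => t tC tmax; exists t => //.
apply/incr_repsP=> x y xy lt_xy; rewrite ltNge le_eqVlt; apply/negP.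
case/predU1P=> [/hgt_inj/sperm_inj e|lt_u]; first by rewrite e ltxx in lt_xy.
have /tmax : (t * srefl x y)%g \in WC C by rewrite groupM // srefl_WC.
set u := (w * t)%g in lt_u *; set s := srefl x y; rewrite /F mulgA -/u.
have -> : \sum_z hgt z * hgt ((u * s)%g z) = \sum_z hgt (s z) * hgt (u z).
  rewrite (reindex_inj (@sperm_inj _ s)); apply: eq_bigr => z _.
  by rewrite spermE sreflK.
apply/negP; rewrite -ltNge -subr_gt0 -sumrB.
(* The difference is a sum over x, y, - y and - x only, these being two points
   instead of four when y = - x; c corrects for that. *)
pose d z : int := (z == x)%:R - (z == y)%:R + (z == sopp y)%:R - (z == sopp x)%:R.
have [c c0 dE] : exists2 c : int, 0 < c &
    forall z, c * (hgt (s z) - hgt z) = d z * (hgt y - hgt x).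
  have nxy : y != x by apply: contraTneq lt_xy => ->; rewrite ltxx.
  have nox := sopp_neq x; have noy := sopp_neq y.
  case: (eqVneq y (sopp x)) => [yx|yx].
    exists 2 => // z; rewrite /s sreflE /d yx soppK.
    case: (eqVneq z x) => [->|zx].
      by rewrite [x == sopp x]eq_sym (negbTE nox) hgt_opp; lia.
    by case: (eqVneq z (sopp x)) => [->|_]; rewrite ?soppK ?hgt_opp; lia.
  have yx' : sopp y != x by apply: contra yx => /eqP <-; rewrite soppK.
  have oyx : sopp y != sopp x by apply: contra nxy => /eqP/(inv_inj (@soppK n)) ->.
  exists 1 => // z; rewrite /s sreflE /d.
  case: (eqVneq z x) => [->|zx].
    rewrite [x == y]eq_sym [x == sopp y]eq_sym [x == sopp x]eq_sym.
    by rewrite (negbTE nxy) (negbTE nox) (negbTE yx'); lia.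
  case: (eqVneq z y) => [->|zy].
    by rewrite [y == sopp y]eq_sym (negbTE yx) (negbTE noy); lia.
  case: (eqVneq z (sopp x)) => [->|zox].
    by rewrite [sopp x == sopp y]eq_sym (negbTE oyx) !hgt_opp; lia.
  by case: (eqVneq z (sopp y)) => [->|_]; rewrite ?hgt_opp; lia.
rewrite -(pmulr_rgt0 _ c0) mulr_sumr.
rewrite (eq_bigr (fun z => (hgt y - hgt x) * (d z * hgt (u z)))); last first.
  by move=> z _; rewrite -mulrBl [LHS]mulrA dE mulrAC mulrC.
rewrite -mulr_sumr pmulr_rgt0 ?subr_gt0 //.
rewrite (eq_bigr (fun z => (z == x)%:R * hgt (u z) - (z == y)%:R * hgt (u z)
  + (z == sopp y)%:R * hgt (u z) - (z == sopp x)%:R * hgt (u z))); last first.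
  by move=> z _; rewrite /d !mulrBl mulrDl mulrBl.
clearbody u; rewrite !(sumrB, big_split) /= !sum_delta_int !sperm_opp !hgt_opp.
by move: lt_u; lia.
Qed.

(** Both u and u t being increasing on each class of equal labels, so is t, and an
   increasing permutation of a finite set is the identity. *)
Lemma incr_reps_uniq u t : t \in WC C -> u \in incr_reps ->
  (u * t)%g \in incr_reps -> t = 1%g.
Proof.
move=> /WCP tC /incr_repsP uX /incr_repsP utX.
have tX x y : lab x = lab y -> hgt x < hgt y -> hgt (t x) < hgt (t y).
  move=> xy lt_xy; rewrite ltNge le_eqVlt; apply/negP.
  case/predU1P=> [/hgt_inj/sperm_inj e|lt_t]; first by rewrite e ltxx in lt_xy.
  have := utX _ _ xy lt_xy; rewrite !spermE ltNge le_eqVlt => /negP[].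
  by apply/orP; right; apply: uX; rewrite // !tC xy.
have itX m x y : lab x = lab y -> hgt x < hgt y ->
    hgt (iter m t x) < hgt (iter m t y).
  move=> xy lt_xy; have : lab (iter m t x) = lab (iter m t y).
    by elim: m => //= m; rewrite !tC.
  by elim: m => //= m IHm; rewrite !tC => e; apply: tX; rewrite ?IHm.
have bound x : - (n.*2)%:Z <= hgt x <= (n.*2)%:Z.
  by rewrite /hgt; case: x => [[] l] /=; have := ltn_ord l; lia.
have nomono (f : sidx n -> sidx n) (e : int) x : `|e|%N = 1%N ->
    (forall m, 0 < e * (hgt (iter m.+1 f x) - hgt (iter m f x))) -> False.
  move=> e1 grow.
  have e2 : e = 1 \/ e = -1 by lia.
  have inc m : m%:Z <= e * (hgt (iter m f x) - hgt x).
    elim: m => [|m IHm]; first by rewrite subrr mulr0.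
    by move: (grow m) IHm; case: e2 => -> /=; lia.
  have := inc (n.*2.*2.+1); have := bound x; have := bound (iter n.*2.*2.+1 f x).
  by case: e2 => ->; lia.
apply: spermP => k; rewrite sperm1E; move: (false, k) => x.
case: (ltgtP (hgt (t x)) (hgt x)) => [lt|lt|/hgt_inj //].
  case: (@nomono t (-1) x) => // m; rewrite mulN1r opprB subr_gt0 iterSr.
  exact: itX.
case: (@nomono t 1 x) => // m; rewrite mul1r subr_gt0 iterSr.
by apply: itX; rewrite ?tC.
Qed.

Lemma incr_decomp w : exists u t,
  [/\ u \in incr_reps, t \in WC C & w = (u * t)%g].
Proof.
have [t tC wt] := incr_reps_ex w.
by exists (w * t)%g, (t^-1)%g; rewrite mulgK groupV.
Qed.

(** Sums over X_C can be replaced by sums over W_n, where changes of variable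
   are easier. *)
Lemma sum_incr_reps (R : nmodType) (f : sperm n -> R) :
  (forall u t, t \in WC C -> f (u * t)%g = f u) ->
  (\sum_(w : sperm n) f w = (\sum_(u in incr_reps) f u) *+ #|WC C|)%R.
Proof.
move=> fC; rewrite -sumrMnl.
under [RHS]eq_bigr => u _ do rewrite -sumr_const.
rewrite pair_big_dep /= (reindex_onto (fun p : sperm n * sperm n => (p.1 * p.2)%g)
  (fun w => odflt (w, 1%g) [pick p : sperm n * sperm n |
     [&& p.1 \in incr_reps, p.2 \in WC C & w == (p.1 * p.2)%g]])) /=; last first.
  move=> w _; case: pickP => [p /and3P[_ _ /eqP->] //|/=].
  have [u [t [uX tC wE]]] := incr_decomp w.
  by move/(_ (u, t)); rewrite /= uX tC wE eqxx.
apply: eq_big => [[u t]|[u t]] /=; last first.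
  case: pickP => /= [p /and3P[_ pC _] /eqP[pE]|no /eqP[_ tE]].
    by rewrite fC // -[t]/((u, t).2) -pE.
  by rewrite -tE mulg1.
case: pickP => /= [p /and3P[pX pC /eqP pE]|no].
  apply/eqP/andP => [pu|[uX tC]]; first by rewrite pu in pX pC.
  have e1 : u = (p.1 * (p.2 * t^-1))%g by rewrite mulgA -pE mulgK.
  have e2 : (p.2 * t^-1)%g = 1%g.
    apply: (incr_reps_uniq (u := p.1)); rewrite -?e1 ?groupM ?groupV //.
  have e3 : p.1 = u by rewrite e1 e2 mulg1.
  rewrite [p]surjective_pairing e3; congr (_, _).
  by move: pE; rewrite e3 => /mulgI.
have [u' [t' [uX tC wE]]] := incr_decomp (u * t)%g.
by have := no (u', t'); rewrite /= uX tC wE eqxx.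
Qed.

End Blocks.

Section ClassPairs.

Variable n : nat.
Implicit Types (C D : scomp n) (w : sperm n).

Definition lab_pairs C : {set sidx n * sidx n} := [set p | lab C p.1 == lab C p.2].

Definition lab_sub C D w := forall x y, lab C x = lab C y -> lab D (w x) = lab D (w y).

Lemma lab_sub_image C D w : lab_sub C D w ->
  [set (w p.1, w p.2) | p in lab_pairs C] \subset lab_pairs D.
Proof.
by move=> CD; apply/subsetP=> _ /imsetP[p pC ->]; move: pC; rewrite !inE => /eqP/CD/eqP.
Qed.

Lemma card_lab_image C w :
  #|[set (w p.1, w p.2) | p in lab_pairs C]| = #|lab_pairs C|.
Proof.
rewrite card_in_imset // => -[x y] [x' y'] _ _ /= [].
by move=> /(@sperm_inj _ w) -> /(@sperm_inj _ w) ->.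
Qed.

(** An inclusion of finite equivalence relations with as many pairs on both
   sides is an equality. *)
Lemma lab_sub_eq C D w : lab_sub C D w -> (#|lab_pairs D| <= #|lab_pairs C|)%N ->
  forall x y, (lab D (w x) == lab D (w y)) = (lab C x == lab C y).
Proof.
move=> CD le x y; apply/eqP/eqP => [xy|/CD //].
have /eqP/setP/(_ (w x, w y)) : [set (w p.1, w p.2) | p in lab_pairs C] == lab_pairs D.
  by rewrite eqEcard lab_sub_image //= card_lab_image.
rewrite [in RHS]inE xy eqxx => /imsetP[[x' y']] /=; rewrite inE /= => /eqP + [].
by move=> + /(@sperm_inj _ w) -> /(@sperm_inj _ w) ->.
Qed.

End ClassPairs.

(** * Bases and cones of natural combinations *)

Section NatCone.

Variable V : vectType rat.
Implicit Types (D : seq V) (v : V).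

Definition natcone D v := exists c : V -> nat, v = \sum_(d <- D) (c d)%:R *: d.

Lemma natconeD D v1 v2 : natcone D v1 -> natcone D v2 -> natcone D (v1 + v2).
Proof.
case=> c1 -> [c2 ->]; exists (fun d => c1 d + c2 d)%N.
by rewrite -big_split; apply: eq_bigr => d _; rewrite natrD scalerDl.
Qed.

Lemma natcone_mem D d : uniq D -> d \in D -> natcone D d.
Proof.
move=> Du dD; exists (fun e => nat_of_bool (e == d)).
rewrite (bigD1_seq d) //= eqxx scale1r big1 ?addr0 // => e /negbTE ->.
by rewrite scale0r.
Qed.

Lemma natcone_perm D D' v : perm_eq D D' -> natcone D v -> natcone D' v.
Proof. by move=> pD [c ->]; exists c; apply: perm_big. Qed.

End NatCone.

Section NonnegComb.

Variables (n m : nat) (D : m.-tuple 'rV[rat]_n).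
Hypothesis freeD : free D.

Lemma sum_tuple_seq (c : 'rV[rat]_n -> nat) :
  \sum_(d <- D) (c d)%:R *: d = \sum_(i < m) (c D`_i)%:R *: D`_i.
Proof. by rewrite (big_nth 0) size_tuple big_mkord. Qed.

Lemma coord_natcone (c : 'rV[rat]_n -> nat) (i : 'I_m) :
  coord D i (\sum_(d <- D) (c d)%:R *: d) = (c D`_i)%:R.
Proof. by rewrite sum_tuple_seq coord_sum_free. Qed.

(** Over a free family the coefficients are the coordinates; without mentioning
   coordinates, cones are easily seen to be closed under addition. *)
Lemma nonneg_combP v : reflect (natcone D v) (nonneg_comb D v).
Proof.
apply: (iffP andP) => [[vD /forallP cN]|[c ->]]; last first.
  split; last by apply/forallP=> i; rewrite coord_natcone natr_nat.
  by rewrite big_seq; apply: rpred_sum => d dD; rewrite rpredZ // memv_span.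
exists (fun d => nth 0%N [seq Num.truncn (coord D i v) | i <- enum 'I_m] (index d D)).
rewrite sum_tuple_seq [LHS](coord_span vD); apply: eq_bigr => i _.
rewrite index_uniq ?size_tuple ?free_uniq //.
rewrite (nth_map i) ?size_enum_ord // nth_ord_enum.
by rewrite truncnK.
Qed.

End NonnegComb.

(** Write e over D, then each element of D over E: the natural coefficients
   multiply to the identity, so that a single product is nonzero, and e itself
   is in D. *)
Lemma natcone_sub n (D E : seq 'rV[rat]_n) : free E ->
    (forall d, d \in D -> natcone E d) -> (forall e, e \in E -> natcone D e) ->
    0 \notin D ->
  {subset E <= D}.
Proof.
move=> freeE DE ED D0 e eE.
have [c eD] := ED e eE.
pose X := in_tuple E; have freeX : free X by [].
have X_nat d i : d \in D -> coord X i d \is a Num.nat.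
  by move=> /DE/(nonneg_combP freeX)/andP[_ /forallP].
pose j : 'I_(size E) := Ordinal (etrans (index_mem e E) eE).
have Xj : X`_j = e by rewrite /= nth_index.
have coord_e i : coord X i e = (i == j)%:R.
  by rewrite -{1}Xj coord_free // eq_sym.
have e0 : e != 0 := free_not0 freeE eE.
have [d dD cd] : exists2 d, d \in D & c d != 0%N.
  apply/hasP; apply: contraNT e0 => /hasPn c0; rewrite eD big_seq big1 // => d dD.
  by have /negPn/eqP -> := c0 d dD; rewrite scale0r.
have le_d i : (c d)%:R * coord X i d <= (i == j)%:R.
  rewrite -coord_e eD linear_sum (big_rem d) //= linearZ /= lerDl.
  rewrite big_seq; apply: sumr_ge0 => f /mem_rem fD.
  by rewrite linearZ mulr_ge0 ?ler0n // natr_ge0 // X_nat.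
have cd1 : 1 <= (c d)%:R :> rat by rewrite ler1n lt0n.
have d_e : d = coord X j d *: e.
  have dX : d \in <<X>>%VS by have [] := andP (introT (nonneg_combP freeX _) (DE d dD)).
  rewrite {1}(coord_span dX) (bigD1 j) //= Xj big1 ?addr0 // => i /negbTE ij.
  suff -> : coord X i d = 0 by rewrite scale0r.
  have := le_d i; rewrite ij => le0; have := natr_ge0 (X_nat d i dD) => ge0.
  apply/eqP; rewrite eq_le ge0 andbT; apply: le_trans le0.
  by rewrite ler_peMl.
have dj1 : coord X j d = 1.
  have /natrP[m jm] := X_nat d j dD; case: m jm => [jm|m jm].
    by move: dD D0; rewrite d_e jm scale0r => ->.
  have : (m.+1)%:R <= 1 :> rat.
    have := le_d j; rewrite eqxx; apply: le_trans; rewrite -jm.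
    by rewrite ler_peMl // jm ler0n.
  by rewrite lern1 jm; case: m {jm}.
by rewrite d_e dj1 scale1r in dD.
Qed.

Lemma free_lead n (v : 'I_n -> 'rV[rat]_n) (s : seq 'I_n) :
    (forall k, v k 0 k != 0) -> (forall k l : 'I_n, (k < l)%N -> v k 0 l = 0) ->
  uniq s -> free [seq v k | k <- s].
Proof.
move=> vkk vkl us; pose r := [rel k l : 'I_n | (l <= k)%N].
have rtot : total r by move=> k l; apply: leq_total.
have pr : perm_eq s (sort r s) by rewrite perm_sym perm_sort.
rewrite (perm_free (perm_map v pr)).
have : sorted r (sort r s) by apply: sort_sorted.
have : uniq (sort r s) by rewrite sort_uniq.
elim: (sort r s) => [|k t IHt] /=; first by rewrite nil_free.
move=> /andP[kt ut] rt; rewrite free_cons IHt ?(path_sorted rt) // andbT.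
apply: contraNN (vkk k) => /(coord_span (X := in_tuple _))->.
rewrite summxE big1 // => i _; rewrite mxE /= (nth_map k) ?vkl ?mulr0 //.
  have : nth k t i \in t by rewrite mem_nth // -(size_map v).
  move: rt; rewrite path_sortedE => [/andP[/allP le _] it|]; last first.
    by move=> a b c /= ba cb; apply: leq_trans cb ba.
  rewrite ltn_neqAle; have /= -> := le _ it; rewrite andbT.
  by apply: contraNneq kt => /val_inj <-.
by rewrite -(size_map v).
Qed.

(** * Roots and reflections *)

Section RootVectors.

Variable n : nat.
Implicit Types (x y z : sidx n) (w : sperm n) (v : 'rV[rat]_n).

Lemma evecE x k : evec x 0 k = (-1) ^+ x.1 * (x.2 == k)%:R.
Proof. by rewrite !mxE eqxx /= eq_sym. Qed.

Lemma evec_opp x : evec (sopp x) = - evec x.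
Proof. by case: x => [[] k]; rewrite /evec /= !(scaleNr, scale1r) ?opprK. Qed.

Lemma evec_inj : injective (@evec n).
Proof.
move=> [b k] [c l] /matrixP/(_ 0 k); rewrite !evecE /= eqxx mulr1.
case: (eqVneq l k) => [->|_]; last first.
  by move/eqP; rewrite mulr0 signr_eq0.
by rewrite mulr1 => /signr_inj ->.
Qed.

Fact sact_is_linear w : linear (sact w).
Proof.
move=> a u v; rewrite /sact scaler_sumr -big_split; apply: eq_bigr => i _.
by rewrite !mxE scalerDl scalerA.
Qed.

HB.instance Definition _ w :=
  GRing.isLinear.Build rat 'rV[rat]_n 'rV[rat]_n *:%R (sact w) (@sact_is_linear w).

Lemma sactZ w a v : sact w (a *: v) = a *: sact w v.
Proof. exact: linearZ. Qed.

Lemma sact_evec w x : sact w (evec x) = evec (w x).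
Proof.
have pos k : sact w (evec (false, k)) = evec (w (false, k)).
  rewrite /sact (bigD1 k) //= evecE eqxx mulr1 expr0 scale1r big1 ?addr0 //.
  by move=> i ik; rewrite evecE /= eq_sym (negbTE ik) mulr0 scale0r.
case: x => [[] k] //; rewrite -[(true, k)]/(sopp (false, k)).
by rewrite sperm_opp !evec_opp linearN /= pos.
Qed.

Lemma sactK w v : sact (w^-1)%g (sact w v) = v.
Proof.
have basis (a : 'rV[rat]_n) : a = \sum_(k < n) a 0 k *: evec (false, k).
  apply/rowP=> k; rewrite summxE (bigD1 k) //= mxE evecE eqxx mul1r mulr1.
  by rewrite big1 ?addr0 // => i ik; rewrite mxE evecE (negbTE ik) !mulr0.
rewrite [in RHS](basis v) {2}/sact linear_sum; apply: eq_bigr => k _.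
by rewrite /= sactZ sact_evec spermVE.
Qed.

Lemma sact_inj w : injective (sact w).
Proof. exact: can_inj (sactK w). Qed.

(** All roots have this form for distinct x and y, the long root 2 e_y being the
   case x = - y; then positivity and membership in Phi_C become conditions
   comparing x and y. *)
Definition rho x y : 'rV[rat]_n := evec y - evec x.

Lemma sact_rho w x y : sact w (rho x y) = rho (w x) (w y).
Proof. by rewrite /rho linearB /= !sact_evec. Qed.

Lemma rhoN x y : - rho x y = rho y x.
Proof. by rewrite opprB. Qed.

Lemma rho_opp x y : rho (sopp y) (sopp x) = rho x y.
Proof. by rewrite /rho !evec_opp opprK addrC. Qed.

Lemma rho_trans y x z : rho x z = rho x y + rho y z.
Proof. by rewrite /rho [RHS]addrC subrKA. Qed.

Lemma PhiP v : reflect (exists x y, x != y /\ v = rho x y) (v \in Phi n).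
Proof.
apply: (iffP idP).
  rewrite inE => /orP[/imfsetP[x _ ->]|/imfsetP[[x y] /= + ->]].
    exists (sopp x), x; split; first exact: sopp_neq.
    by rewrite /rho evec_opp opprK -mulr2n scaler_nat.
  rewrite inE /= => xy; exists (sopp x), y.
  rewrite /rho evec_opp opprK addrC; split=> //.
  by apply: contraTneq xy => <-; rewrite ltnn.
case=> [x [y [xy ->]]]; rewrite inE.
case: (ltngtP x.2 y.2) => [lt|lt|e]; last first.
- apply/orP; left; apply/imfsetP; exists y => //=.
  have -> : x = sopp y.
    case: x y e xy => [b k] [c l] /= /val_inj -> /eqP xy; rewrite /sopp /=.
    by case: b c xy => [] [].
  by rewrite /rho evec_opp opprK -mulr2n scaler_nat.
- apply/orP; right; apply/imfsetP; exists (y, sopp x); rewrite /= ?inE //.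
  by rewrite evec_opp.
apply/orP; right; apply/imfsetP; exists (sopp x, y); rewrite /= ?inE //.
by rewrite evec_opp addrC.
Qed.

Lemma rho_Phi x y : x != y -> rho x y \in Phi n.
Proof. by move=> xy; apply/PhiP; exists x, y. Qed.

Lemma dotv_evec x y :
  dotv (evec x) (evec y) = (x == y)%:R - (x == sopp y)%:R.
Proof.
rewrite /dotv (bigD1 x.2) //= big1 ?addr0 => [|k /negbTE kx]; last first.
  by rewrite evecE eq_sym kx mulr0 mul0r.
rewrite !evecE eqxx mulr1; case: x y => [b k] [c l]; rewrite /sopp !xpair_eqE /=.
by rewrite [l == k]eq_sym; case: (k == l); case: b c => [] []; rewrite /= ?mulr0 ?subrr //;
  rewrite ?expr1 ?expr0 ?mulN1r ?mul1r ?mulr1 ?opprK ?subr0 ?sub0r.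
Qed.

Lemma dotvBr v x y : dotv v (rho x y) = dotv v (evec y) - dotv v (evec x).
Proof.
by rewrite /dotv -sumrB; apply: eq_bigr => k _; rewrite !mxE -mulrBr.
Qed.

Lemma dotvC u v : dotv u v = dotv v u.
Proof. by apply: eq_bigr => k _; rewrite mulrC. Qed.

Lemma refl_rho x y z : x != y -> refl (rho x y) (evec z) = evec (srefl x y z).
Proof.
move=> xy; have nox := sopp_neq x; have noy := sopp_neq y.
have oxx : (x == sopp x) = false by rewrite eq_sym; apply/negbTE.
have oyy : (y == sopp y) = false by rewrite eq_sym; apply/negbTE.
have ooE a b : (sopp a == sopp b) = (a == b) := inj_eq (inv_inj (@soppK n)) a b.
have [yox|yox] := eqVneq y (sopp x).
  have e2 : rho x y = 2 *: evec y.
    by rewrite /rho yox !evec_opp -opprD -mulr2n -scaler_nat scalerN.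
  have dotZ v c a : dotv v (c *: a) = c * dotv v a.
    by rewrite /dotv mulr_sumr; apply: eq_bigr => k _; rewrite mxE mulrCA.
  have norm : dotv (2 *: evec y) (2 *: evec y) = 2 * 2.
    rewrite (dotZ (2 *: evec y) 2 (evec y)) dotvC (dotZ (evec y) 2 (evec y)).
    by rewrite dotv_evec eqxx oyy subr0 mulr1.
  rewrite /refl e2 norm (dotZ (evec z) 2 (evec y)) dotv_evec scalerA.
  have -> : 2 * (2 * ((z == y)%:R - (z == sopp y)%:R)) / (2 * 2) * 2
      = 2 * ((z == y)%:R - (z == sopp y)%:R) :> rat.
    by case: (_ == _) (_ == _) => [] [].
  rewrite sreflE yox !soppK.
  have [->|zx] := eqVneq z x.
    by rewrite oxx evec_opp sub0r mulrN1 scaleNr opprK scaler_nat mulr2n addrC subrK.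
  have [->|zox] := eqVneq z (sopp x).
    by rewrite subr0 mulr1 evec_opp scaler_nat mulr2n addrC opprD !opprK addrK.
  by rewrite subrr mulr0 scale0r subr0.
have xoy : (x == sopp y) = false.
  by apply: contraNF yox => /eqP ->; rewrite soppK.
have yx : (y == x) = false by rewrite eq_sym; apply/negbTE.
have nyox : (y == sopp x) = false by apply/negbTE.
have norm : dotv (rho x y) (rho x y) = 2.
  rewrite dotvBr ![dotv (rho x y) _]dotvC !dotvBr !dotv_evec !eqxx oxx oyy xoy yx.
  by rewrite (negbTE xy) nyox.
rewrite /refl norm mulrAC divff // mul1r dotvBr !dotv_evec sreflE /rho.
have [->|zx] := eqVneq z x.
  rewrite (negbTE xy) xoy oxx !subr0 sub0r scaleN1r opprK.
  by rewrite addrC subrK.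
have [->|zy] := eqVneq z y.
  by rewrite oyy nyox !subr0 scale1r opprB addrC subrK.
have [->|zox] := eqVneq z (sopp x).
  rewrite ooE (negbTE xy) subr0 !sub0r opprK scale1r !evec_opp.
  by rewrite opprB addKr.
have [->|_] := eqVneq z (sopp y).
  by rewrite !sub0r ?oppr0 ?addr0 -[1 *+ true]/(1 : rat) scaleN1r opprK !evec_opp addKr.
by rewrite subrr scale0r subr0.
Qed.

Lemma is_reflection_rho x y w :
  x != y -> is_reflection (rho x y) w = (w == srefl x y).
Proof.
move=> xy; apply/forallP/eqP => [h|-> z]; last first.
  by rewrite sact_evec refl_rho.
apply: spermP => k; apply: evec_inj.
by have /eqP := h (false, k); rewrite sact_evec refl_rho.
Qed.

Definition height v : rat := \sum_(k < n) v 0 k * (k.*2.+1)%:R.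

Fact height_is_linear : linear_for *%R height.
Proof.
move=> a u v; rewrite /height mulr_sumr -big_split; apply: eq_bigr => k _.
by rewrite !mxE mulrDl mulrA.
Qed.

HB.instance Definition _ :=
  GRing.isLinear.Build rat 'rV[rat]_n rat *%R height height_is_linear.

Lemma height_evec x : height (evec x) = (hgt x)%:~R.
Proof.
rewrite /height (bigD1 x.2) //= evecE eqxx mulr1 big1 ?addr0; last first.
  by move=> k /negbTE ik; rewrite evecE eq_sym ik mulr0 mul0r.
by case: x => [[] k]; rewrite /hgt /= ?expr1 ?mulN1r ?mul1r ?intrN.
Qed.

Lemma height_rho x y : height (rho x y) = (hgt y - hgt x)%:~R.
Proof. by rewrite /rho linearB /= !height_evec intrB. Qed.

End RootVectors.

(** * Simple roots of a system given by blocks *)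

Section BaseRoots.

Variables (n : nat) (bl : nat -> nat) (ng : 'I_n -> bool).
Hypothesis bl_le : forall p q, (p <= q)%N -> (bl p <= bl q)%N.
Hypothesis ng_bl : forall k l : 'I_n, bl k = bl l -> ng k = ng l.
Implicit Types (x y z : sidx n) (k l : 'I_n).

(** The blocks are given by a monotone function bl and the signs ng, so that the
   results apply both to Phi_C and, with a single positive block, to Phi. *)
Definition eqv x y := (bl x.2 == bl y.2) && (ng x.2 ==> (x.1 == y.1)).

Lemma eqv_sym x y : eqv x y = eqv y x.
Proof.
rewrite /eqv eq_sym; case: eqP => //= /ng_bl ->.
by rewrite [x.1 == _]eq_sym.
Qed.

Lemma eqv_trans y x z : eqv x y -> eqv y z -> eqv x z.
Proof.
case/andP=> /eqP b1 /implyP i1 /andP[/eqP b2 /implyP i2].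
rewrite /eqv b1 b2 eqxx /=; apply/implyP => nx.
by rewrite (eqP (i1 nx)) i2 // -(ng_bl b1).
Qed.

Definition consec x y := [/\ eqv x y, hgt x < hgt y &
  forall z, eqv x z -> ~~ (hgt x < hgt z < hgt y)].

(** Going from x to y inside a class by consecutive steps: the additive
   decomposition of a positive root into simple ones. *)
Lemma consec_ind (P : sidx n -> sidx n -> Prop) :
    (forall x y, consec x y -> P x y) ->
    (forall y x z, eqv x y -> eqv y z -> hgt x < hgt y -> hgt y < hgt z ->
       P x y -> P y z -> P x z) ->
  forall x y, eqv x y -> hgt x < hgt y -> P x y.
Proof.
move=> Pc Pt x y; move: {2}`|hgt y - hgt x|%N (leqnn `|hgt y - hgt x|%N) => m.
elim: m x y => [|m IHm] x y le_m xy lt_xy; first by lia.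
case: (pickP (fun z => eqv x z && (hgt x < hgt z < hgt y))) => [z|no]; last first.
  by apply: Pc; split=> // z xz; have := no z; rewrite /= xz /= => ->.
case/andP=> xz /andP[lt1 lt2]; have zy : eqv z y.
  by apply: eqv_trans xy; rewrite eqv_sym.
by apply: (Pt z) => //; apply: IHm => //; lia.
Qed.

Definition first k := (k == 0%N :> nat) || (bl k.-1 != bl k).

(** Two consecutive points in a class differ by one of these vectors: either they
   are opposite, and k is the least element of a positive block, or k is not
   the least element of its block. *)
Definition baseroot k : 'rV[rat]_n :=
  if first k then 2 *: evec (false, k)
  else evec (false, k) - evec (false, ord_pred k).

Definition base := [seq baseroot k | k <- enum 'I_n & ~~ (first k && ng k)].

Lemma val_ord_pred k : k != 0%N :> nat -> ord_pred k = k.-1 :> nat.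
Proof.
move=> k0 /=; have := ltn_ord k; case: (nat_of_ord k) k0 => // m _ mn.
by rewrite addSn /= modnDr modn_small // ltnW.
Qed.

Lemma ord_pred_lt k : k != 0%N :> nat -> (ord_pred k < k)%N.
Proof. by move=> k0; rewrite val_ord_pred //; lia. Qed.

Lemma base_free : free base.
Proof.
apply: free_lead; last by rewrite filter_uniq // enum_uniq.
  move=> k; rewrite /baseroot; case: ifP => [_|].
    by rewrite mxE evecE eqxx.
  move/norP=> [/ord_pred_lt/gtn_eqF lt _].
  rewrite mxE [X in _ + X]mxE !evecE eqxx.
  have -> : ((false, ord_pred k).2 == k) = false by rewrite -val_eqE eq_sym.
  by rewrite mulr0 subr0.
move=> k l kl; rewrite /baseroot; case: ifP => [_|].
  by rewrite mxE evecE -[_ == l]val_eqE ltn_eqF // !mulr0.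
move/norP=> [/ord_pred_lt lt _].
rewrite mxE [X in _ + X]mxE !evecE.
have -> : ((false, k).2 == l) = false by rewrite -val_eqE ltn_eqF.
have -> : ((false, ord_pred k).2 == l) = false.
  by rewrite -val_eqE ltn_eqF //; apply: ltn_trans kl.
by rewrite !mulr0 subr0.
Qed.

Lemma first_rho k : first k -> baseroot k = rho (true, k) (false, k).
Proof.
move=> fk; rewrite /baseroot fk /rho -[(true, k)]/(sopp (false, k)) evec_opp.
by rewrite opprK -mulr2n scaler_nat.
Qed.

Lemma nfirst_rho k : ~~ first k -> baseroot k = rho (false, ord_pred k) (false, k).
Proof. by move=> /negbTE fk; rewrite /baseroot fk. Qed.

Lemma mem_base d :
  reflect (exists2 k, ~~ (first k && ng k) & d = baseroot k) (d \in base).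
Proof.
apply: (iffP mapP) => [[k]|[k kb ->]].
  by rewrite mem_filter => /andP[kb _] ->; exists k.
by exists k; rewrite // mem_filter kb mem_enum.
Qed.

Lemma bl_between (k l m : nat) : bl k = bl l -> (k <= m <= l)%N -> bl m = bl l.
Proof.
move=> kl /andP[/bl_le km /bl_le ml].
by apply/eqP; rewrite eqn_leq ml -kl km.
Qed.

Lemma consec_pos k l : consec (false, k) (false, l) -> rho (false, k) (false, l) \in base.
Proof.
case=> /andP[/eqP /= kl /implyP /= _]; rewrite /hgt /= => lt_kl no.
have l0 : l != 0%N :> nat by lia.
have := val_ord_pred l0; move epE: (ord_pred l) => ep predE.
have bl_pred : bl l.-1 = bl l by apply: (@bl_between k l) => //; lia.
have kE : k = ep.
  apply: val_inj; have := no (false, ep); rewrite /eqv /hgt /= predE.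
  by rewrite bl_pred kl eqxx implybT => /(_ isT); lia.
have fl : ~~ first l by rewrite /first (negbTE l0) bl_pred eqxx.
by apply/mem_base; exists l; rewrite ?(negbTE fl) // nfirst_rho // epE -kE.
Qed.

Lemma eqv_opp x y : eqv (sopp x) (sopp y) = eqv x y.
Proof. by rewrite /eqv /= (inj_eq negb_inj). Qed.

Lemma consec_base x y : consec x y -> rho x y \in base.
Proof.
case: x y => [b k] [c l]; case: b; case: c => // xy.
- rewrite -rho_opp; apply: consec_pos.
  case: xy => xy lt_xy no; split.
  + by rewrite -[(false, l)]/(sopp (true, l)) -[(false, k)]/(sopp (true, k)) eqv_opp eqv_sym.
  + by move: lt_xy; rewrite /hgt /=; lia.
  move=> z; rewrite -eqv_opp => lz; have := no (sopp z); rewrite hgt_opp.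
  rewrite (eqv_trans xy lz) => /(_ isT); rewrite /hgt /=; lia.
- case: xy => /andP[/= /eqP kl /implyP nk] lt_xy no.
  have {}nk : ng k = false by apply/negP=> /nk.
  have ekl : k = l.
    apply: val_inj; case: (ltngtP k l) => // lt.
      have := no (false, k); rewrite /eqv /hgt /= eqxx nk => /(_ isT); lia.
    have := no (true, l); rewrite /eqv /hgt /= kl eqxx nk => /(_ isT); lia.
  rewrite -ekl in kl no *; have fk : first k.
    apply/norP => -[k0 /negPn/eqP bk].
    have := val_ord_pred k0; move: (ord_pred k) => ep predE.
    have := no (false, ep); rewrite /eqv /hgt /= nk implyFb predE.
    by rewrite bk eqxx => /(_ isT); lia.
  by apply/mem_base; exists k; rewrite ?nk ?andbF // first_rho.
- by case: xy => _; rewrite /hgt /=; lia.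
- exact: consec_pos.
Qed.

Lemma base_consec d : d \in base -> exists x y, consec x y /\ d = rho x y.
Proof.
case/mem_base=> k kb ->; case: (boolP (first k)) kb => [fk|fk] /= nk.
  exists (true, k), (false, k); rewrite first_rho //; split=> //; split.
  - by rewrite /eqv /= eqxx (negbTE nk).
  - by rewrite /hgt /=; lia.
  move=> z /andP[/eqP /= kz _]; apply/negP=> lt_z.
  have lt_zk : (z.2 < k)%N by move: lt_z; rewrite /hgt /=; case: z.1; lia.
  move: fk; rewrite /first; case/orP => [/eqP k0|/eqP[]]; first by rewrite k0 in lt_zk.
  by apply: (@bl_between z.2 k); [rewrite kz | lia].
move: (fk) => /norP[k0 /negPn/eqP bk].
exists (false, ord_pred k), (false, k); rewrite nfirst_rho //; split=> //.
have := val_ord_pred k0; move: (ord_pred k) => ep predE.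
split.
- by rewrite /eqv /= predE bk eqxx implybT.
- by rewrite /hgt /= predE; lia.
by move=> z _; rewrite /hgt /= predE; case: z.1; lia.
Qed.

Lemma base_natcone x y : eqv x y -> hgt x < hgt y -> natcone base (rho x y).
Proof.
move: x y; apply: consec_ind => [x y xy|y x z _ _ _ _ xy yz].
  by apply: natcone_mem; rewrite ?consec_base ?free_uniq ?base_free.
by rewrite (rho_trans y); apply: natconeD.
Qed.

End BaseRoots.

(** * Root-theoretic definitions in terms of labels *)

Lemma natcone_span n (D : seq 'rV[rat]_n) v : natcone D v -> v \in <<D>>%VS.
Proof.
by case=> c ->; rewrite big_seq; apply: rpred_sum => d dD; rewrite rpredZ // memv_span.
Qed.

Section PositiveRoots.

Variable n : nat.
Implicit Types (x y z : sidx n).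

Lemma simple_rootsE :
  [tuple simple_root i | i < n] = base (fun=> 0%N) (fun=> false) :> seq 'rV[rat]_n.
Proof.
rewrite /base (eq_filter (a2 := predT)) => [|k]; last by rewrite andbF.
rewrite filter_predT; apply: eq_map => k.
by rewrite /simple_root /baseroot /first eqxx orbF.
Qed.

Lemma natcone_height (D : seq 'rV[rat]_n) v :
  (forall d, d \in D -> 0 <= height d) -> natcone D v -> 0 <= height v.
Proof.
move=> D0 [c ->]; rewrite linear_sum big_seq; apply: sumr_ge0 => d /D0 d0.
by rewrite linearZ mulr_ge0 ?ler0n.
Qed.

Lemma Phi_posE v : (v \in Phi_pos n) =
  (v \in Phi n) && nonneg_comb [tuple simple_root i | i < n] v.
Proof. by rewrite !inE. Qed.

(** The height is positive on simple roots, hence on their natural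
   combinations. *)
Lemma Phi_pos_rho x y : x != y -> (rho x y \in Phi_pos n) = (hgt x < hgt y).
Proof.
move=> xy; rewrite Phi_posE rho_Phi //=.
have freeS : free [tuple simple_root i | i < n].
  by rewrite simple_rootsE base_free.
apply/(nonneg_combP freeS)/idP => [|lt]; rewrite simple_rootsE; last first.
  by apply: base_natcone; rewrite ?/eqv ?eqxx.
move/natcone_height => h; have {h} : 0 <= height (rho x y).
  apply: h => d /(base_consec (fun _ _ _ => leqnn 0)) [a [b [[_ lt _] ->]]].
  by rewrite height_rho ler0z subr_ge0 ltW.
rewrite height_rho ler0z subr_ge0 le_eqVlt => /predU1P[/hgt_inj e|//].
by rewrite e eqxx in xy.
Qed.

Lemma Phi_pos_height v : v \in Phi_pos n -> 0 < height v.
Proof.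
move=> vP; have : v \in Phi n by move: vP; rewrite Phi_posE => /andP[].
case/PhiP=> x [y [xy ve]]; move: vP; rewrite ve Phi_pos_rho // height_rho.
by rewrite ltr0z subr_gt0.
Qed.

End PositiveRoots.

Section SubsystemRoots.

Variables (n : nat) (C : scomp n).
Implicit Types (x y z : sidx n) (u w : sperm n) (v d : 'rV[rat]_n).

Lemma PhiCE v : (v \in PhiC C) =
  (v \in Phi n) && [exists w in WC C, is_reflection v w].
Proof. by rewrite !inE. Qed.

Lemma PhiC_rho x y : x != y -> (rho x y \in PhiC C) = (lab C x == lab C y).
Proof.
move=> xy; rewrite PhiCE rho_Phi //=; apply/existsP/eqP => [[w]|xyC].
  case/andP=> /WCP wC; rewrite is_reflection_rho // => /eqP wE.
  by rewrite -[LHS]wC wE sreflE eqxx.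
by exists (srefl x y); rewrite srefl_WC // is_reflection_rho //= eqxx.
Qed.

Lemma PhiC_Phi v : v \in PhiC C -> v \in Phi n.
Proof. by rewrite PhiCE => /andP[]. Qed.

Local Notation eqvC := (eqv (blk C) (fun k : 'I_n => bneg C k)).

Lemma eqv_lab x y : eqvC x y = (lab C x == lab C y).
Proof.
apply/andP/labP => [[/eqP e /implyP s]|[e s]].
  by split=> // /s/eqP.
by split; [apply/eqP | apply/implyP => /s ->].
Qed.

Lemma XC_incr : XC C = incr_reps C.
Proof.
apply/setP=> w; rewrite inE; apply/forallP/incr_repsP => [h x y xy lt_xy|h [v /= vP]].
  have nxy : x != y by apply: contraTneq lt_xy => ->; rewrite ltxx.
  have vP : rho x y \in PhiC_pos C.
    by rewrite inE PhiC_rho // xy eqxx Phi_pos_rho.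
  have := h (Sub (rho x y) vP); rewrite /= sact_rho Phi_pos_rho //.
  by rewrite (inj_eq (@sperm_inj _ w)).
move: (vP); rewrite inE => /andP[vC vpos]; have /PhiP[x [y [xy ve]]] := PhiC_Phi vC.
move: vC vpos; rewrite ve PhiC_rho // sact_rho !Phi_pos_rho //; last first.
  by rewrite (inj_eq (@sperm_inj _ w)).
by move=> /eqP; apply: h.
Qed.

Definition baseC := base (blk C) (fun k : 'I_n => bneg C k).

Fact bneg_blk (k l : 'I_n) : blk C k = blk C l -> bneg C k = bneg C l.
Proof. by rewrite /bneg => ->. Qed.

Let blkC_le p q : (p <= q)%N -> (blk C p <= blk C q)%N := @leq_blk n C p q.

Lemma baseC_free : free baseC. Proof. exact: base_free. Qed.

Lemma baseC_pos d : d \in baseC -> d \in PhiC C /\ d \in Phi_pos n.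
Proof.
case/(base_consec blkC_le)=> x [y [[xy lt _] ->]].
have nxy : x != y by apply: contraTneq lt => ->; rewrite ltxx.
by rewrite PhiC_rho // Phi_pos_rho // -eqv_lab.
Qed.

Lemma baseC_natcone d : d \in PhiC C -> d \in Phi_pos n -> natcone baseC d.
Proof.
move=> dC; have /PhiP[x [y [xy de]]] := PhiC_Phi dC; move: dC; rewrite de.
rewrite PhiC_rho // Phi_pos_rho // -eqv_lab.
apply: base_natcone; [exact: blkC_le | exact: bneg_blk].
Qed.

(** Any base made of positive roots and the explicit one lie in each other's
   cones, so they coincide by natcone_sub. *)
Lemma DeltaC_base : DeltaC C = [fset d in baseC]%fset.
Proof.
pose E := [fset d in baseC]%fset.
have memE d : (d \in E) = (d \in baseC) by rewrite inE.
have permE : perm_eq E baseC.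
  by apply: uniq_perm; rewrite ?fset_uniq ?free_uniq ?baseC_free.
pose P := (PhiC C `&` Phi_pos n)%fset.
pose s := [seq D : {fset 'rV[rat]_n} <- fpowerset P | is_base (PhiC C) D].
have natE d : d \in PhiC C -> natcone E d \/ natcone E (- d).
  move=> dC; have /PhiP[x [y [xy de]]] := PhiC_Phi dC.
  have pE : perm_eq baseC E by rewrite perm_sym.
  case: (ltgtP (hgt x) (hgt y)) => [lt|gt|/hgt_inj e]; last by rewrite e eqxx in xy.
    left; apply: (natcone_perm pE); apply: baseC_natcone => //.
    by rewrite de Phi_pos_rho.
  have yx : y != x by rewrite eq_sym.
  right; rewrite de rhoN; apply: (natcone_perm pE); apply: baseC_natcone.
    by rewrite PhiC_rho // eq_sym; move: dC; rewrite de PhiC_rho.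
  by rewrite Phi_pos_rho.
have freeE : free E by rewrite (perm_free permE) baseC_free.
have sE D : D \in s -> D = E.
  rewrite mem_filter fpowersetE => /andP[/and3P[_ /andP[_ freeD] /allP Dcone] DP].
  have {}DP d : d \in D -> d \in PhiC C /\ d \in Phi_pos n.
    by move=> /(fsubsetP DP); rewrite inE => /andP[].
  have Dnat d : d \in E -> natcone D d.
    rewrite memE => /baseC_pos[dC dpos]; have := Dcone d dC.
    case/orP=> /(nonneg_combP (D := in_tuple D) freeD) // dD.
    have := Phi_pos_height dpos; rewrite ltNge => /negP[].
    rewrite -oppr_ge0 -linearN; apply: natcone_height dD => f /DP[_ /Phi_pos_height].
    exact: ltW.
  have Enat d : d \in D -> natcone E d.
    move=> /DP[dC dpos]; apply: (natcone_perm (D := baseC)); first by rewrite perm_sym.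
    exact: baseC_natcone.
  have D0 : 0 \notin D by apply/negP=> /(free_not0 freeD); rewrite eqxx.
  have E0 : 0 \notin E by apply/negP=> /(free_not0 freeE); rewrite eqxx.
  apply/fsetP=> d; apply/idP/idP; last exact: (natcone_sub freeE Enat Dnat D0).
  exact: (natcone_sub freeD Dnat Enat E0).
have Es : E \in s.
  rewrite mem_filter fpowersetE; apply/andP; split; last first.
    by apply/fsubsetP=> d; rewrite memE inE => /baseC_pos[-> ->].
  apply/and3P; split.
  - by apply/fsubsetP=> d; rewrite memE => /baseC_pos[].
  - rewrite /basis_of freeE andbT eqEsubv; apply/andP; split; apply/span_subvP => d.
      by rewrite memE => /baseC_pos[dC _]; apply: memv_span.
    by case/natE=> /natcone_span; rewrite ?rpredN.
  apply/allP=> d /natE[] dE; apply/orP; [left | right];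
    exact/(nonneg_combP (D := in_tuple E) freeE).
rewrite /DeltaC /base_of -/P -/s; case: s sE Es => // D s sE _.
by apply: sE; rewrite mem_head.
Qed.

Lemma mem_DeltaC d : (d \in DeltaC C) = (d \in baseC).
Proof. by rewrite DeltaC_base inE. Qed.

Lemma consec_Delta x y : consec (blk C) (fun k : 'I_n => bneg C k) x y ->
  rho x y \in DeltaC C.
Proof.
by move=> xy; rewrite mem_DeltaC; apply: consec_base xy; [exact: blkC_le | exact: bneg_blk].
Qed.

(** This is the normaliser of W_C, whose orbits on signed points are the classes
   of equal labels. *)
Definition lab_norm : {set sperm n} := [set w : sperm n |
  [forall x, forall y, (lab C (w x) == lab C (w y)) == (lab C x == lab C y)]].

Lemma lab_normP w : reflect
  (forall x y, (lab C (w x) == lab C (w y)) = (lab C x == lab C y))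
  (w \in lab_norm).
Proof.
rewrite inE; apply: (iffP forallP) => [h x y|h x].
  by have /forallP/(_ y)/eqP := h x.
by apply/forallP=> y; apply/eqP.
Qed.

(** The group W(C) consists of the representatives in X_C of N(W_C) / W_C. The
   base is recovered from the order inside the classes, as the set of roots
   e_y - e_x for x and y consecutive. *)
Lemma calW_incr w : (w \in calW C) = (w \in lab_norm) && (w \in incr_reps C).
Proof.
rewrite inE; apply/eqP/andP => [wD|[/lab_normP wN /incr_repsP wX]].
  have step x y : eqvC x y -> hgt x < hgt y ->
      lab C (w x) = lab C (w y) /\ hgt (w x) < hgt (w y).
    move: x y; apply: consec_ind => [k l|x y xy|y x z _ _ _ _ [-> lt1] [-> lt2]].
    - exact: bneg_blk.
    - have [_ lt _] := xy.
      have nxy : w x != w y.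
        by rewrite (inj_eq (@sperm_inj _ w)); apply: contraTneq lt => ->; rewrite ltxx.
      have : rho (w x) (w y) \in DeltaC C.
        by rewrite -sact_rho -wD in_imfset // consec_Delta.
      by rewrite mem_DeltaC => /baseC_pos[]; rewrite PhiC_rho // Phi_pos_rho // => /eqP.
    - by split=> //; apply: lt_trans lt2.
  have wX : w \in incr_reps C.
    apply/incr_repsP=> x y xy lt_xy; by have [] := step x y; rewrite ?eqv_lab ?xy.
  split=> //; apply/lab_normP; apply: lab_sub_eq => // x y xy.
  case: (ltgtP (hgt x) (hgt y)) => [lt|gt|/hgt_inj -> //].
      by have [] := step x y; rewrite ?eqv_lab ?xy.
  by have [] := step y x; rewrite ?eqv_lab ?xy.
apply/eqP; rewrite eqEfcard; apply/andP; split; last first.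
  by rewrite card_imfset //; apply: sact_inj.
apply/fsubsetP=> _ /imfsetP[d /= + ->]; rewrite mem_DeltaC.
case/(base_consec blkC_le)=> x [y [[xy lt no] ->]].
have lab_xy : lab C x = lab C y by apply/eqP; rewrite -eqv_lab.
rewrite sact_rho; apply: consec_Delta; split.
- by rewrite eqv_lab wN lab_xy.
- exact: wX.
move=> z; rewrite -[z](spermEV w) eqv_lab wN -eqv_lab => xz.
have lab_xz : lab C x = lab C (w^-1%g z) by apply/eqP; rewrite -eqv_lab.
have := no _ xz; apply: contra => /andP[lt1 lt2]; apply/andP; split.
  rewrite ltNge le_eqVlt; apply/negP=> /predU1P[/hgt_inj e|]; first by rewrite e ltxx in lt1.
  by move/(wX _ _ (esym lab_xz)); rewrite ltNge (ltW lt1).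
rewrite ltNge le_eqVlt; apply/negP=> /predU1P[/hgt_inj e|]; first by rewrite e ltxx in lt2.
by move/(wX y _ (etrans (esym lab_xy) lab_xz)); rewrite ltNge (ltW lt2).
Qed.

End SubsystemRoots.

(** * The monoid of cells *)

Section Cells.

Variable n : nat.
Implicit Types (k l j : 'I_n) (w u v : sperm n) (s : {perm 'I_n}).

Definition precell := ({ffun 'I_n * 'I_n -> bool} * {ffun 'I_n -> bool})%type.

Definition is_cell (r : rel 'I_n) (c : pred 'I_n) :=
  [/\ total r, transitive r & forall k l, r k l -> r l k -> c k = c l].

Definition is_cellb (m : precell) :=
  [&& [forall k, forall l, m.1 (k, l) || m.1 (l, k)],
      [forall k, forall l, forall j, m.1 (k, l) ==> m.1 (l, j) ==> m.1 (k, j)]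
    & [forall k, forall l, m.1 (k, l) ==> m.1 (l, k) ==> (m.2 k == m.2 l)]].

Lemma is_cellbP (m : precell) : reflect (is_cell (fun k l => m.1 (k, l)) m.2) (is_cellb m).
Proof.
apply: (iffP and3P) => [[tot tr co]|[tot tr co]]; split.
- by move=> k l; move/forallP/(_ k)/forallP/(_ l): tot.
- move=> l k j; move/forallP/(_ k)/forallP/(_ l)/forallP/(_ j): tr.
  by move=> /implyP h /h/implyP.
- move=> k l; move/forallP/(_ k)/forallP/(_ l): co.
  by move=> /implyP h /h/implyP h' /h'/eqP.
- by apply/forallP=> k; apply/forallP=> l; apply: tot.
- apply/forallP=> k; apply/forallP=> l; apply/forallP=> j.
  by apply/implyP=> kl; apply/implyP; apply: tr.
- apply/forallP=> k; apply/forallP=> l.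
  by apply/implyP=> kl; apply/implyP=> lk; apply/eqP; apply: co.
Qed.

(** A coloured ordered set partition: an ordered set partition is a total
   preorder, whose classes are the blocks, and each block carries a colour. *)
Record cell := Cell { cell_val : precell; _ : is_cellb cell_val }.

HB.instance Definition _ := [isSub for cell_val].
HB.instance Definition _ := [Finite of cell by <:].

Implicit Types (m x y z : cell).

Definition cle m k l : bool := (cell_val m).1 (k, l).
Definition ccol m k : bool := (cell_val m).2 k.

Lemma cellP m : is_cell (cle m) (ccol m).
Proof. exact/is_cellbP/(valP m). Qed.

Lemma cle_total m : total (cle m). Proof. by case: (cellP m). Qed.

Lemma cle_trans m : transitive (cle m). Proof. by case: (cellP m). Qed.

Lemma cle_refl m k : cle m k k. Proof. by have := cle_total m k k; rewrite orbb. Qed.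

Lemma ccolE m k l : cle m k l -> cle m l k -> ccol m k = ccol m l.
Proof. by case: (cellP m) => _ _; apply. Qed.

Lemma eq_cell x y : (forall k l, cle x k l = cle y k l) ->
  (forall k, ccol x k = ccol y k) -> x = y.
Proof.
move=> e1 e2; apply: val_inj; rewrite /= [LHS]surjective_pairing [RHS]surjective_pairing.
by congr (_, _); apply/ffunP; [case=> k l; apply: e1 | apply: e2].
Qed.

Section MakeCell.

Variables (r : rel 'I_n) (c : pred 'I_n).
Hypothesis rc : is_cell r c.

Fact mkcell_subproof : is_cellb ([ffun p => r p.1 p.2], [ffun k => c k]).
Proof.
case: rc => tot tr co; apply/is_cellbP; split=> [k l|l k j|k l] /=; rewrite !ffunE /=.
- exact: tot.
- exact: tr.
- exact: co.
Qed.

Definition mkcell := Cell mkcell_subproof.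

Lemma cle_mk k l : cle mkcell k l = r k l. Proof. by rewrite /cle /= ffunE. Qed.
Lemma ccol_mk k : ccol mkcell k = c k. Proof. by rewrite /ccol /= ffunE. Qed.

End MakeCell.

Definition mul_le x y k l :=
  cle x k l && (cle x l k ==> if ccol x k then cle y l k else cle y k l).

Fact mul_cell x y : is_cell (mul_le x y) (fun k => ccol x k (+) ccol y k).
Proof.
split=> [k l|l k j|k l]; rewrite /mul_le.
- have := cle_total x k l; have := cle_total y k l; have := @ccolE x k l.
  case: (cle x k l); case: (cle x l k) => //= /(_ isT isT) <-.
  by case: ccol; rewrite // orbC.
- case/andP=> xkl h1 /andP[xlj h2]; rewrite (cle_trans xkl xlj) /=.
  apply/implyP=> xjk; have xjl := cle_trans xjk xkl; have xlk := cle_trans xlj xjk.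
  move: h1 h2; rewrite xjl xlk /= (ccolE xkl xlk).
  by case: ccol => [a b|a b]; [apply: cle_trans b a | apply: cle_trans a b].
case/andP=> xkl + /andP[xlk]; rewrite xkl xlk /= (ccolE xkl xlk).
by case: ccol => a b; congr (_ (+) _); apply: ccolE.
Qed.

(** The lexicographic product of ordered set partitions, twisted by the action
   of colours: multiplying by -1 the signed points of a block of x reverses
   their order. Thanks to this twist the lifts of the x_C are plain sums of
   cells. *)
Definition cmul x y := mkcell (mul_cell x y).

Lemma cle_mul x y k l : cle (cmul x y) k l =
  cle x k l && (cle x l k ==> if ccol x k then cle y l k else cle y k l).
Proof. exact: cle_mk. Qed.

Lemma ccol_mul x y k : ccol (cmul x y) k = ccol x k (+) ccol y k.
Proof. exact: ccol_mk. Qed.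

Lemma cmulA : associative cmul.
Proof.
move=> x y z; apply: eq_cell => [k l|k]; last by rewrite !ccol_mul addbA.
rewrite !(cle_mul, ccol_mul); have := @ccolE x k l; have := @ccolE y k l.
case: (cle x k l) => //=; case: (cle x l k) => //= cy /(_ isT isT) <-.
case: (ccol x k) => /=; case: (cle y k l) cy => //=; case: (cle y l k) => //=.
  by move=> /(_ isT isT) <-; case: (ccol y k).
Qed.

Fact cell_one_subproof : is_cell (fun _ _ => true) (fun=> false). Proof. by []. Qed.

Definition cell_one := mkcell cell_one_subproof.

Lemma cmul1m x : cmul cell_one x = x.
Proof.
by apply: eq_cell => [k l|k]; rewrite ?cle_mul ?ccol_mul ?cle_mk !ccol_mk.
Qed.

Fact pull_cell s m : is_cell (fun k l => cle m (s k) (s l)) (fun k => ccol m (s k)).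
Proof.
split=> [k l|l k j|k l]; [exact: cle_total|exact: cle_trans|exact: ccolE].
Qed.

Definition pull s m := mkcell (pull_cell s m).

Lemma cle_pull s m k l : cle (pull s m) k l = cle m (s k) (s l).
Proof. exact: cle_mk. Qed.

Lemma ccol_pull s m k : ccol (pull s m) k = ccol m (s k).
Proof. exact: ccol_mk. Qed.

Lemma pullM s x y : pull s (cmul x y) = cmul (pull s x) (pull s y).
Proof.
by apply: eq_cell => [k l|k];
  rewrite !(cle_pull, cle_mul, ccol_pull, ccol_mul).
Qed.

Lemma pull_comp s t m : pull s (pull t m) = pull (s * t)%g m.
Proof.
by apply: eq_cell => [k l|k]; rewrite !(cle_pull, ccol_pull) !permM.
Qed.

Lemma pull1 m : pull 1%g m = m.
Proof. by apply: eq_cell => [k l|k]; rewrite !(cle_pull, ccol_pull) !perm1. Qed.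

Lemma pull_inj s : injective (pull s).
Proof.
by apply: (can_inj (g := pull s^-1%g)) => m; rewrite pull_comp mulVg pull1.
Qed.

Lemma cell_one_pull s : pull s cell_one = cell_one.
Proof.
by apply: eq_cell => [k l|k]; rewrite ?cle_pull ?ccol_pull ?cle_mk ?ccol_mk.
Qed.

Fact label_cell (h : 'I_n -> nat) :
  is_cell (fun k l => (h k <= h l)%N) (fun k => ~~ odd (h k)).
Proof.
split=> [k l|l k j|k l]; [exact: leq_total|exact: leq_trans|].
by move=> kl lk; rewrite (@anti_leq (h k) (h l)) // kl.
Qed.

(** Labels encode both the order and, by their parity, the colour. *)
Definition label h := mkcell (label_cell h).

Lemma cle_label h k l : cle (label h) k l = (h k <= h l)%N.
Proof. exact: cle_mk. Qed.

Lemma ccol_label h k : ccol (label h) k = ~~ odd (h k).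
Proof. exact: ccol_mk. Qed.

(** The cell with singleton blocks read off from the word w(1), ..., w(n). *)
Definition chamber w := label (fun k =>
  (abs_perm (w^-1)%g k).*2 + ~~ ((w^-1)%g (false, k)).1)%N.

Lemma cle_chamber w k l :
  cle (chamber w) k l = (abs_perm (w^-1)%g k <= abs_perm (w^-1)%g l)%N.
Proof.
rewrite cle_label; case: (ltngtP (abs_perm (w^-1)%g k) (abs_perm (w^-1)%g l)) => [lt|gt|e].
- by case: (~~ _); case: (~~ _); lia.
- by case: (~~ _); case: (~~ _); lia.
by have /val_inj/perm_inj -> := e; rewrite leqnn.
Qed.

Lemma ccol_chamber w k : ccol (chamber w) k = ((w^-1)%g (false, k)).1.
Proof. by rewrite ccol_label oddD odd_double oddb negbK. Qed.

(** For a chamber this is the position of k, counted from 0. *)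
Definition rank m k := #|[set l | ~~ cle m k l]|.

Lemma rank_lt m k : (rank m k < n)%N.
Proof.
rewrite -[X in (_ < X)%N]card_ord -cardsT; apply: proper_card.
by apply/properP; split; [exact: subsetT | exists k; rewrite ?inE ?cle_refl].
Qed.

Lemma leq_rank m k l : (rank m k <= rank m l)%N = cle m k l.
Proof.
apply/idP/idP => [|kl]; last first.
  apply: subset_leq_card; apply/subsetP=> j; rewrite !inE.
  by apply: contra; apply: cle_trans kl.
apply: contraTT => kl; rewrite -ltnNge; apply: proper_card; apply/properP; split.
  apply/subsetP=> j; rewrite !inE; apply: contra => kj; apply: cle_trans kj.
  by have := cle_total m k l; rewrite (negbTE kl).
by exists l; rewrite ?inE ?kl // cle_refl.
Qed.

Lemma card_ltn_ord N : (N <= n)%N -> #|[set l : 'I_n | (l < N)%N]| = N.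
Proof.
move=> Nn; transitivity (\sum_(l < n | (l < N)%N) 1)%N; first by rewrite sum1dep_card.
have -> : (\sum_(l < n | (l < N)%N) 1 = \sum_(0 <= l < n | (l < N)%N) 1)%N.
  by rewrite big_mkord.
rewrite -(@big_nat_widen _ _ _ 0 N n xpredT) //.
by rewrite sum_nat_const_nat subn0 muln1.
Qed.

Lemma card_ord_lt (s : {perm 'I_n}) k : #|[set l | (s l < s k)%N]| = s k.
Proof.
have -> : [set l | (s l < s k)%N] = s @^-1: [set l : 'I_n | (l < s k)%N].
  by apply/setP=> l; rewrite !inE.
by rewrite (card_preimset _ (@perm_inj _ s)) card_ltn_ord // ltnW.
Qed.

Lemma rank_chamber w k : rank (chamber w) k = abs_perm (w^-1)%g k.
Proof.
rewrite -[RHS]card_ord_lt; apply: eq_card => l; rewrite !inE cle_chamber.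
by rewrite -ltnNge.
Qed.

Lemma chamber_inj : injective chamber.
Proof.
move=> u w uw; apply: invg_inj; apply: spermP => k.
have e1 : ((u^-1)%g (false, k)).1 = ((w^-1)%g (false, k)).1.
  by rewrite -!ccol_chamber uw.
have e2 : ((u^-1)%g (false, k)).2 = ((w^-1)%g (false, k)).2.
  by rewrite -!absp_posE; apply: val_inj; rewrite -[LHS]rank_chamber -[RHS]rank_chamber uw.
by rewrite [LHS]surjective_pairing e1 e2 -surjective_pairing.
Qed.

Lemma chamber_ex m : (forall k l, cle m k l -> cle m l k -> k = l) ->
  exists w, chamber w = m.
Proof.
move=> anti; pose pos k := Ordinal (rank_lt m k).
have pos_inj : injective pos.
  by move=> k l [e]; apply: anti; rewrite -leq_rank e.
pose v := signed_perm (perm pos_inj) (ccol m).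
exists (v^-1)%g; apply: eq_cell => [k l|k]; last first.
  by rewrite ccol_chamber invgK signed_permE.
by rewrite cle_chamber invgK !absp_posE !signed_permE /= !permE /= leq_rank.
Qed.

Lemma mul_chamber m w : exists v, chamber v = cmul m (chamber w).
Proof.
apply: chamber_ex => k l; rewrite !cle_mul => /andP[kl +] /andP[lk].
rewrite kl lk /= (ccolE kl lk) !cle_chamber; case: ccol => a b;
  by apply: (@perm_inj _ (abs_perm (w^-1)%g)); apply: val_inj; apply/eqP; rewrite eqn_leq a b.
Qed.

(** W_n acts on chambers on the other side of cells, except that a cell names
   points by their absolute values, hence the relabelling. *)
Lemma mul_chamber_shift m w v :
  (cmul m (chamber w) == chamber (w * v)%g) =
  (cmul (pull (abs_perm w) m) (chamber 1%g) == chamber v).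
Proof.
have shift k l : cle (chamber (w * v)%g) (abs_perm w k) (abs_perm w l) = cle (chamber v) k l.
  by rewrite !cle_chamber invMg !abspM !abspVK.
have shift1 k l : cle (chamber w) (abs_perm w k) (abs_perm w l) = cle (chamber 1%g) k l.
  by rewrite !cle_chamber !abspVK invg1 !absp_posE !sperm1E.
have colw k : ccol (chamber w) (abs_perm w k) = (w (false, k)).1.
  rewrite ccol_chamber absp_posE.
  have := sperm_sign (w^-1)%g (w (false, k)); rewrite spermVE.
  rewrite -[(false, k).1]/false; set b := ((w^-1)%g (false, (w (false, k)).2)).1.
  by case: (w (false, k)).1 b => [] [].
have colwv k : ccol (chamber (w * v)%g) (abs_perm w k) =
    (w (false, k)).1 (+) ccol (chamber v) k.
  rewrite !ccol_chamber invMg spermE sperm_sign.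
  by rewrite -[((w^-1)%g _).1]ccol_chamber colw -absp_posE abspVK.
have col1 k : ccol (chamber 1%g) k = false.
  by rewrite ccol_chamber invg1 sperm1E.
apply/eqP/eqP => e; apply: eq_cell => [k l|k].
- rewrite -shift -e !cle_mul !cle_pull !ccol_pull !shift1.
  by [].
- have := congr1 (fun z => ccol z (abs_perm w k)) e.
  by rewrite ccol_mul colw colwv addbC ccol_mul ccol_pull col1 addbF => /addbI.
- rewrite -[k](abspKV w) -[l](abspKV w) shift -e !cle_mul !cle_pull !ccol_pull.
  by rewrite !shift1.
rewrite -[k](abspKV w) colwv -e !ccol_mul ccol_pull col1 addbF colw.
by rewrite addbC.
Qed.

End Cells.

(** * Functions on cells and the group algebra *)

Section CellFunctions.

Variables (K : fieldType) (n : nat).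
Implicit Types (k l : 'I_n) (u v w : sperm n) (s : {perm 'I_n}) (m x y z : cell n).
Implicit Types (a b : cell n -> K).

(** Invariance under S_n, which permutes the points underlying cells. *)
Definition relabel_inv a := forall s m, a (pull s m) = a m.

Definition conv a b m : K := \sum_x \sum_y a x * b y * (cmul x y == m)%:R.

Lemma conv_inv a b : relabel_inv a -> relabel_inv b -> relabel_inv (conv a b).
Proof.
move=> ia ib s m; rewrite /conv (reindex_inj (@pull_inj n s)); apply: eq_bigr => x _.
rewrite (reindex_inj (@pull_inj n s)); apply: eq_bigr => y _.
by rewrite ia ib -pullM (inj_eq (@pull_inj n s)).
Qed.

Lemma sum_conv a b (f : cell n -> K) :
  \sum_m conv a b m * f m = \sum_x \sum_y a x * b y * f (cmul x y).
Proof.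
under eq_bigr => m _ do rewrite mulr_suml.
rewrite exchange_big; apply: eq_bigr => x _.
under eq_bigr => m _ do rewrite mulr_suml.
rewrite exchange_big; apply: eq_bigr => y _.
rewrite (bigD1 (cmul x y)) //= eqxx mulr1 big1 ?addr0 // => m.
by rewrite eq_sym => /negbTE ->; rewrite mulr0 mul0r.
Qed.

(** Left multiplication by an invariant a on the chambers, identified with W_n,
   is right multiplication by this element, which is read off at the chamber of
   the identity. *)
Definition galg_of a : galg K (sperm n) :=
  [ffun v => \sum_m a m * (cmul m (chamber 1%g) == chamber v)%:R].

Lemma galg_of_shift a w v : relabel_inv a ->
  \sum_m a m * (cmul m (chamber w) == chamber v)%:R = galg_of a (w^-1 * v)%g.
Proof.
move=> ia; rewrite ffunE [RHS](reindex_inj (@pull_inj n (abs_perm w))).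
by apply: eq_bigr => m _; rewrite ia -mul_chamber_shift mulKVg.
Qed.

(** The right factor acts first on chambers, whence the exchange. *)
Lemma galg_of_conv a b : relabel_inv a -> galg_of (conv a b) = galg_of b * galg_of a.
Proof.
move=> ia; apply/ffunP=> v; rewrite gmulE.
under [RHS]eq_bigr => w _ do rewrite -galg_of_shift // ffunE mulr_suml.
rewrite [RHS]exchange_big ffunE sum_conv [LHS]exchange_big; apply: eq_bigr => y _ /=.
have [w yw] := mul_chamber y 1%g.
rewrite (bigD1 w) //= -yw eqxx mulr1 [X in _ + X]big1 ?addr0 => [|u uw]; last first.
  by rewrite (inj_eq (@chamber_inj n)) eq_sym (negbTE uw) mulr0 mul0r.
rewrite mulr_sumr; apply: eq_bigr => x _.
by rewrite -cmulA yw mulrAC mulrA mulrC mulrA.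
Qed.

Lemma galg_of_lin (I : finType) (c : I -> K) (f : I -> cell n -> K) :
  galg_of (fun m => \sum_i c i * f i m) = \sum_i c i *: galg_of (f i).
Proof.
apply/ffunP=> v; rewrite ffunE sum_ffunE.
under eq_bigr => m _ do rewrite mulr_suml.
rewrite exchange_big; apply: eq_bigr => i _.
rewrite gscaleE ffunE mulr_sumr; apply: eq_bigr => m _.
by rewrite mulrA.
Qed.

Definition delta_one : cell n -> K := fun m => (m == cell_one n)%:R.

Lemma delta_one_inv : relabel_inv delta_one.
Proof. by move=> s m; rewrite /delta_one -[in LHS](cell_one_pull s) (inj_eq (@pull_inj n s)). Qed.

Lemma galg_of_one : galg_of delta_one = 1.
Proof.
apply/ffunP=> v; rewrite -gelt1 !ffunE (bigD1 (cell_one n)) //= big1 ?addr0; last first.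
  by move=> m /negbTE me; rewrite /delta_one me mul0r.
by rewrite /delta_one eqxx mul1r cmul1m (inj_eq (@chamber_inj n)) eq_sym.
Qed.

Definition npairs m := #|[set p : 'I_n * 'I_n | cle m p.1 p.2]|.
Definition ncols m := #|[set k | ccol m k]|.

(** Among the points of colour false, w lists the blocks of m in the opposite
   order, and among those of colour true in the same order. A cell with the
   colours of m that merges two of its blocks would list their points as w does
   for colour false, and in reverse for colour true: in both cases against the
   order of m. *)
Lemma leading_chamber m : exists w, forall x,
  cmul x (chamber w) = cmul m (chamber w) ->
  (forall k l, cle x k l -> cle m k l) /\ (forall k, ccol x k = ccol m k).
Proof.
pose r k l := if ccol m k == ccol m l then
                if ccol m k then cle m k l else cle m l k else ccol m l.
have rc : is_cell r (fun=> false).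
  split=> // [k l|l k j]; rewrite /r.
    case: (ccol m k); case: (ccol m l) => //=; [exact: cle_total|exact: cle_total].
  case: (ccol m k); case: (ccol m l); case: (ccol m j) => //=.
    exact: cle_trans.
  by move=> a b; apply: cle_trans b a.
have [w wE] := mul_chamber (mkcell rc) 1%g; exists w => x xm.
have col k : ccol x k = ccol m k.
  by have := congr1 (fun z => ccol z k) xm; rewrite !ccol_mul => /addIb.
split=> // k l xkl; apply: contraT => mkl.
have mlk : cle m l k by have := cle_total m k l; rewrite (negbTE mkl).
have := congr1 (fun z => cle z k l) xm; rewrite !cle_mul (negbTE mkl) xkl /=.
case: (boolP (cle x l k)) => //= xlk; rewrite !wE !cle_mul !cle_mk /r.
by rewrite -!col (ccolE xkl xlk) eqxx; case: ccol; rewrite (negbTE mkl) mlk.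
Qed.

Lemma npairs_le x m : (forall k l, cle x k l -> cle m k l) -> (npairs x <= npairs m)%N.
Proof.
by move=> xm; apply: subset_leq_card; apply/subsetP=> p; rewrite !inE; apply: xm.
Qed.

Lemma ncols_le x m : (forall k, ccol x k -> ccol m k) -> (ncols x <= ncols m)%N.
Proof.
by move=> xm; apply: subset_leq_card; apply/subsetP=> p; rewrite !inE; apply: xm.
Qed.

Lemma cell_sub_eq x m :
    (forall k l, cle x k l -> cle m k l) -> (forall k, ccol x k -> ccol m k) ->
  (npairs m + ncols m <= npairs x + ncols x)%N -> x = m.
Proof.
move=> xm xmc le; have le1 := npairs_le xm; have le2 := ncols_le xmc.
have le3 : (npairs m <= npairs x)%N by lia.
have le4 : (ncols m <= ncols x)%N by lia.
have e1 : [set p : 'I_n * 'I_n | cle x p.1 p.2] = [set p | cle m p.1 p.2].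
  apply/eqP; rewrite eqEcard; apply/andP; split; last exact: le3.
  by apply/subsetP=> p; rewrite !inE; apply: xm.
have e2 : [set k | ccol x k] = [set k | ccol m k].
  apply/eqP; rewrite eqEcard; apply/andP; split; last exact: le4.
  by apply/subsetP=> k; rewrite !inE; apply: xmc.
apply: eq_cell => [k l|k]; first by have /setP/(_ (k, l)) := e1; rewrite !inE.
by have /setP/(_ k) := e2; rewrite !inE.
Qed.

(** At a finest cell m of the support of a, evaluate at the chamber given by
   leading_chamber: m is the only cell of the support that contributes. *)
Lemma galg_of_inj a : relabel_inv a -> galg_of a = 0 -> forall m, a m = 0.
Proof.
move=> ia Pa0 m0; apply/eqP; apply: contraT => am0.
case: (@arg_minnP _ m0 (fun m => a m != 0) npairs am0) => m am mmin.
have [w wm] := leading_chamber m; have [v vE] := mul_chamber m w.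
have := galg_of_shift w v ia; rewrite Pa0 ffunE vE (bigD1 m) //= eqxx mulr1.
rewrite big1 ?addr0 => [/eqP|x xm]; first by rewrite (negbTE am).
case: eqP => [/wm[le col]|_]; last by rewrite mulr0.
rewrite mulr1; apply: contraTeq xm => /mmin le_x; apply/negPn/eqP.
apply: cell_sub_eq => // [k|]; first by rewrite col.
by rewrite leq_add // ncols_le // => k; rewrite col.
Qed.

End CellFunctions.

(** * Cells attached to the cosets of W_C *)

Section Faces.

Variables (n : nat).
Implicit Types (C D : scomp n) (x y : sidx n) (k l : 'I_n) (u v w t : sperm n).
Implicit Types (s : {perm 'I_n}) (m : cell n).

(** The ordered set partition of {1, ..., n} into the images by w of the blocks
   of D, where the image of a negative block is cut into its negative and its
   positive points. *)
Definition face D w := label (fun k => lab D ((w^-1)%g (false, k))).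

Lemma cle_face D w k l : cle (face D w) k l =
  (lab D ((w^-1)%g (false, k)) <= lab D ((w^-1)%g (false, l)))%N.
Proof. exact: cle_label. Qed.

Lemma ccol_face D w k : ccol (face D w) k =
  ((w^-1)%g (false, k)).1 && bneg D (abs_perm (w^-1)%g k).
Proof. by rewrite ccol_label lab_odd negbK absp_posE. Qed.

Lemma face_coset D w t : t \in WC D -> face D (w * t)%g = face D w.
Proof.
rewrite -groupV => /WCP tD; apply: eq_cell => [k l|k].
  by rewrite !cle_face invMg !spermE !tD.
by rewrite !ccol_label invMg spermE tD.
Qed.

(** Inside a class of equal labels, w is increasing; on the part of colour true,
   where w takes negative values, absolute values decrease, which is the reason
   for the reversal in the product of cells. *)
Lemma face_chamber D w : w \in incr_reps D ->
  cmul (face D w) (chamber 1%g) = chamber w.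
Proof.
move=> /incr_repsP wX.
have w_lt x y : lab D x = lab D y -> (hgt x < hgt y) = (hgt (w x) < hgt (w y)).
  move=> xy; apply/idP/idP; first exact: wX.
  rewrite !ltNge !le_eqVlt; apply: contra => /predU1P[/hgt_inj ->|yx].
    by rewrite eqxx.
  by rewrite (wX _ _ (esym xy) yx) orbT.
pose p k := (w^-1)%g (false, k).
have wp k : w (p k) = (false, k) by rewrite /p spermEV.
have p_sym k : ~~ bneg D (p k).2 -> (p k).1 = false.
  move=> nk; have := w_lt (p k) (sopp (p k)).
  have -> : lab D (p k) = lab D (sopp (p k)) by apply/eqP; rewrite eq_sym lab_oppE.
  rewrite sperm_opp wp !hgt_opp; move/(_ erefl).
  by case: (p k) => [[] j] //=; rewrite /hgt /=; lia.
have colE k : ccol (face D w) k = (p k).1.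
  rewrite ccol_face absp_posE -/(p k); case: (boolP (bneg D _)) => [|/p_sym ->].
    by rewrite andbT.
  by [].
have same k l : lab D (p k) = lab D (p l) ->
    ((p k).2 <= (p l).2)%N = if (p k).1 then (l <= k)%N else (k <= l)%N.
  move=> kl; have := w_lt _ _ kl; have := w_lt _ _ (esym kl); rewrite !wp.
  have : (p k).1 = (p l).1.
    case: (boolP (bneg D (p k).2)) => [|nk]; first exact: lab_sign.
    by rewrite !p_sym // -(lab_bneg kl).
  rewrite /hgt; case: (p k) => b i; case: (p l) => c j /= <-.
  by case: b => /=; lia.
have diff k l : (lab D (p k) < lab D (p l))%N -> ((p k).2 < (p l).2)%N.
  move=> lt; rewrite ltnNge; apply/negP=> le.
  have /(leq_blk D) le_blk := le.
  have eb : blk D (p k).2 = blk D (p l).2.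
    move: lt le_blk; rewrite /lab; case: (~~ _); case: (~~ _) => /=;
      by move: (blk D _) (blk D _) => i j; lia.
  have eng : bneg D (p k).2 = bneg D (p l).2 by rewrite /bneg eb.
  move: lt; rewrite /lab eb -eng ltn_add2l.
  case: (boolP ((p k).1 && bneg D (p k).2)) => [/andP[k1 nk]|_]; last by case: ((p l).1 && _).
  rewrite nk andbT; case E: (p l).1 => //= _.
  have : lab D (sopp (p k)) = lab D (p l).
    by apply/eqP/labP; rewrite /= k1 E.
  move/w_lt; rewrite sperm_opp !wp !hgt_opp.
  move: k1 E le; rewrite /hgt; case: (p k) => b i; case: (p l) => c j /= -> -> /=.
  lia.
apply: eq_cell => [k l|k]; last first.
  by rewrite ccol_mul colE !ccol_chamber invg1 sperm1E addbF.
rewrite cle_mul cle_chamber !cle_face colE !cle_chamber invg1 !absp_posE !sperm1E.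
rewrite -/(p k) -/(p l) /=.
case: (ltngtP (lab D (p k)) (lab D (p l))) => [/diff/ltnW -> //|/diff|/same ->] /=.
  by rewrite ltnNge => /negbTE.
by [].
Qed.

Lemma face_inj D : {in incr_reps D &, injective (face D)}.
Proof.
move=> u w uX wX e; apply: chamber_inj.
by rewrite -(face_chamber uX) e face_chamber.
Qed.

Definition faces D : {set cell n} := [set face D w | w : sperm n].

Lemma facesE D : faces D = [set face D w | w in incr_reps D].
Proof.
apply/setP=> m; apply/imsetP/imsetP => [[w _ ->]|[w _ ->]]; last by exists w.
by have [u [t [uX tD ->]]] := incr_decomp D w; exists u; rewrite // face_coset.
Qed.

Lemma pull_face D s w : pull s (face D w) = face D ((signed_perm s (fun=> false))^-1 * w)%g.
Proof.
have e k : ((signed_perm s (fun=> false))^-1 * w)^-1%g (false, k) = (w^-1)%g (false, s k).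
  by rewrite invMg invgK spermE signed_permE.
apply: eq_cell => [k l|k]; first by rewrite cle_pull !cle_face !e.
by rewrite ccol_pull !ccol_label e.
Qed.

Lemma faces_pull D s m : (pull s m \in faces D) = (m \in faces D).
Proof.
apply/imsetP/imsetP => -[w _ e].
  exists ((signed_perm s^-1 (fun=> false))^-1 * w)%g => //.
  by rewrite -pull_face -e pull_comp mulVg pull1.
by exists ((signed_perm s (fun=> false))^-1 * w)%g; rewrite // e pull_face.
Qed.

(** The blocks of D, coloured by their signs: these cells represent the orbits of
   S_n on cells (shape_pull, std_cell_inj). *)
Definition std_cell D := face D (signed_perm 1%g (fun k => bneg D k)).

Lemma std_label D k : lab D (((signed_perm 1%g (fun k => bneg D k))^-1)%g (false, k)) =
  ((blk D k).*2 + ~~ bneg D k)%N.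
Proof.
have -> : ((signed_perm 1%g (fun k => bneg D k))^-1)%g (false, k) = (bneg D k, k).
  by apply: (@sperm_inj _ (signed_perm 1%g (fun k => bneg D k)));
    rewrite spermEV signed_permE /= perm1 addbb.
by rewrite /lab /= andbb.
Qed.

Lemma cle_std_cell D k l : cle (std_cell D) k l = (blk D k <= blk D l)%N.
Proof.
rewrite cle_face !std_label.
case: (ltngtP (blk D k) (blk D l)) => [lt|gt|e]; last by rewrite /bneg e leqnn.
  by case: (~~ _); case: (~~ _); lia.
by case: (~~ _); case: (~~ _); lia.
Qed.

Lemma ccol_std_cell D k : ccol (std_cell D) k = bneg D k.
Proof. by rewrite ccol_label std_label oddD odd_double oddb negbK. Qed.

Lemma std_cell_faces D : std_cell D \in faces D. Proof. exact: imset_f. Qed.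

(** Among the faces of D this measure is largest exactly on the orbit of
   std_cell D. *)
Definition cmeas m := (npairs m + ncols m)%N.

Lemma cmeas_pull s m : cmeas (pull s m) = cmeas m.
Proof.
congr (_ + _)%N.
  rewrite -[RHS](card_preimset _ (f := fun p : 'I_n * 'I_n => (s p.1, s p.2))).
    by apply: eq_card => p; rewrite !inE cle_pull.
  by move=> [a b] [c d] /= [/perm_inj -> /perm_inj ->].
rewrite -[RHS](card_preimset _ (@perm_inj _ s)).
by apply: eq_card => k; rewrite !inE ccol_pull.
Qed.

Lemma face_sub_std D w : let s := abs_perm (w^-1)%g in
  (forall k l, cle (face D w) k l -> cle (pull s (std_cell D)) k l) /\
  (forall k, ccol (face D w) k -> ccol (pull s (std_cell D)) k).
Proof.
split=> [k l|k]; last by rewrite ccol_face ccol_pull ccol_std_cell => /andP[].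
by rewrite cle_face cle_pull cle_std_cell !absp_posE => /half_leq; rewrite !lab_half.
Qed.

Lemma faces_meas D m : m \in faces D -> (cmeas m <= cmeas (std_cell D))%N.
Proof.
case/imsetP=> w _ ->; have [le1 le2] := face_sub_std D w.
by rewrite -(cmeas_pull (abs_perm (w^-1)%g) (std_cell D)) leq_add ?npairs_le ?ncols_le.
Qed.

Lemma faces_meas_eq D m : m \in faces D -> cmeas m = cmeas (std_cell D) ->
  exists s, m = pull s (std_cell D).
Proof.
case/imsetP=> w _ -> e; have [le1 le2] := face_sub_std D w.
by exists (abs_perm (w^-1)%g); apply: cell_sub_eq => //; rewrite -/(cmeas _) cmeas_pull -e.
Qed.

End Faces.

(** * The signed composition of a cell *)

Section Shapes.

Variable n : nat.
Implicit Types (C D : scomp n) (k l : 'I_n) (s : {perm 'I_n}) (m : cell n).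

Definition upto m k := #|[set l | cle m l k]|.

(** The end of the block of k, counting points in the order of m, together with
   its colour: the sorted list of these numbers depends only on the orbit of m
   and determines a signed composition. *)
Definition key m k := ((upto m k).*2 + ccol m k)%N.

Definition keys m := [seq j <- iota 0 n.*2.+2 | [exists k, key m k == j]].

Lemma upto_pull s m k : upto (pull s m) k = upto m (s k).
Proof.
rewrite /upto -[RHS](card_preimset _ (@perm_inj _ s)).
by apply: eq_card => l; rewrite !inE cle_pull.
Qed.

Lemma leq_upto m k l : (upto m k <= upto m l)%N = cle m k l.
Proof.
apply/idP/idP => [|kl]; last first.
  by apply: subset_leq_card; apply/subsetP=> j; rewrite !inE => /cle_trans; apply.
apply: contraTT => kl; rewrite -ltnNge; apply: proper_card; apply/properP; split.
  apply/subsetP=> j; rewrite !inE => /cle_trans; apply.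
  by have := cle_total m k l; rewrite (negbTE kl).
by exists k; rewrite ?inE ?kl // cle_refl.
Qed.

Lemma upto_gt0 m k : (0 < upto m k)%N.
Proof. by apply/card_gt0P; exists k; rewrite inE cle_refl. Qed.

Lemma upto_le m k : (upto m k <= n)%N.
Proof. by rewrite -[X in (_ <= X)%N]card_ord max_card. Qed.

Lemma key_half m k : (key m k)./2 = upto m k.
Proof. by rewrite /key addnC half_bit_double. Qed.

Lemma key_odd m k : odd (key m k) = ccol m k.
Proof. by rewrite /key oddD odd_double oddb. Qed.

Lemma leq_key m k l : (key m k <= key m l)%N = cle m k l.
Proof.
apply/idP/idP => [/half_leq|kl]; first by rewrite !key_half leq_upto.
have := leq_upto m k l; have := leq_upto m l k; rewrite kl /key.
case: (boolP (cle m l k)) => [lk|lk]; last by case: ccol; case: ccol; lia.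
by rewrite (ccolE kl lk); lia.
Qed.

Lemma mem_keys m j : reflect (exists k, key m k = j) (j \in keys m).
Proof.
rewrite mem_filter mem_iota /=; apply: (iffP andP) => [[/existsP[k /eqP kj] _]|[k kj]].
  by exists k.
split; first by apply/existsP; exists k; apply/eqP.
by rewrite -kj /key; have := upto_le m k; case: ccol; lia.
Qed.

Lemma keys_sorted m : sorted ltn (keys m).
Proof. by apply: sorted_filter; [exact: ltn_trans | exact: iota_ltn_sorted]. Qed.

Lemma keys_pull s m : keys (pull s m) = keys m.
Proof.
apply: (irr_sorted_eq ltn_trans ltnn); rewrite ?keys_sorted // => j.
apply/mem_keys/mem_keys => -[k <-].
  by exists (s k); rewrite /key upto_pull ccol_pull.
by exists ((s^-1)%g k); rewrite /key upto_pull ccol_pull permKV.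
Qed.

(** The signed composition with block ends j./2 and signs given by the parity,
   for the entries j of L. *)
Definition comp_of (L : seq nat) : seq int :=
  pairmap (fun i j : nat => (-1) ^+ odd j * (j./2 - i./2)%N%:Z) 0%N L.

Lemma comp_of_nth L i : (i < size L)%N -> (comp_of L)`_i =
  (-1) ^+ odd (nth 0%N L i) * ((nth 0%N L i)./2 - (nth 0%N (0%N :: L) i)./2)%N%:Z.
Proof. by move=> iL; rewrite (nth_pairmap 0%N). Qed.

Lemma abs_comp_of L i : (i < size L)%N -> `|((comp_of L)`_i)%R|%N =
  ((nth 0%N L i)./2 - (nth 0%N (0%N :: L) i)./2)%N.
Proof. by move=> iL; rewrite comp_of_nth // abszMsign. Qed.

Lemma sum_comp_of L i : (i <= size L)%N -> sorted leq L ->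
  (\sum_(c <- take i (comp_of L)) `|c| = (nth 0 (0 :: L) i)./2)%N.
Proof.
move=> + sL; elim: i => [|i IHi] iL; first by rewrite take0 big_nil.
rewrite (take_nth 0) ?size_pairmap // big_rcons IHi 1?ltnW // abs_comp_of //=.
rewrite subnKC //; apply: half_leq.
case: i iL {IHi} => //= i iL.
by apply: (sorted_leq_nth leq_trans leqnn) => //; rewrite inE // ltnW.
Qed.

Lemma keys_nth_lt m i j : (i < j < size (keys m))%N ->
  (nth 0 (keys m) i < nth 0 (keys m) j)%N.
Proof.
move=> /andP[ij jm]; apply: (sorted_ltn_nth ltn_trans 0%N (keys_sorted m)) => //.
by rewrite inE (ltn_trans ij).
Qed.

Lemma keys_index_lt m k l : (key m k < key m l)%N ->
  (index (key m k) (keys m) < index (key m l) (keys m))%N.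
Proof.
have kL j : key m j \in keys m by apply/mem_keys; exists j.
apply: contraTT; rewrite -!leqNgt leq_eqVlt => /predU1P[e|lt].
  by rewrite -(nth_index 0%N (kL l)) e nth_index.
have := @keys_nth_lt m (index (key m l) (keys m)) (index (key m k) (keys m)).
by rewrite lt index_mem kL !nth_index // => /(_ isT)/ltnW.
Qed.

Lemma keys_lt m i : (i < size (keys m))%N ->
  ((nth 0 (0 :: keys m) i)./2 < (nth 0 (keys m) i)./2)%N.
Proof.
move=> im; have /mem_keys[k kE] := mem_nth 0%N im; rewrite -kE key_half.
case: i im kE => [|i] im kE /=; first by rewrite upto_gt0.
have /mem_keys[l lE] := mem_nth 0%N (ltnW im).
by rewrite -lE key_half ltnNge leq_upto -leq_key lE -ltnNge kE keys_nth_lt // ltnSn.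
Qed.

Lemma keys_sorted_leq m : sorted leq (keys m).
Proof. by apply: sub_sorted (keys_sorted m) => a b; apply: ltnW. Qed.

Lemma keys_last m : (nth 0 (0 :: keys m) (size (keys m)))./2 = n.
Proof.
case: (posnP n) => n0.
  have : all (fun j => j./2 <= n)%N (0%N :: keys m).
    by apply/allP=> j; rewrite inE => /predU1P[->//|/mem_keys[k <-]]; rewrite key_half upto_le.
  move/(all_nthP 0%N)/(_ (size (keys m))); rewrite /= leqnn n0 leqn0 => /(_ isT).
  by move/eqP.
pose k0 := [arg max_(k > Ordinal n0) upto m k].
have k0P k : (upto m k <= upto m k0)%N.
  by rewrite /k0; case: arg_maxnP => // i _ h; apply: h.
have up_k0 : upto m k0 = n.
  rewrite -[RHS]card_ord; apply: eq_card => k.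
  by rewrite inE -leq_upto k0P.
have k0L : key m k0 \in keys m by apply/mem_keys; exists k0.
have sz : (0 < size (keys m))%N by case: keys k0L.
rewrite -(prednK sz) /=.
have lt : ((size (keys m)).-1 < size (keys m))%N by rewrite ltn_predL.
have /mem_keys[l lE] := mem_nth 0%N lt; rewrite -lE key_half.
apply/eqP; rewrite eqn_leq upto_le -{1}up_k0 leq_upto -leq_key lE.
rewrite -{1}(nth_index 0%N k0L).
apply: (sorted_leq_nth leq_trans leqnn _ (keys_sorted_leq m)); rewrite ?inE ?index_mem //.
by rewrite -ltnS prednK // index_mem.
Qed.

Fact comp_of_keys m : is_scomp n (comp_of (keys m)).
Proof.
apply/andP; split; last first.
  rewrite -{1}[comp_of _]take_size sum_comp_of ?size_pairmap ?keys_sorted_leq //.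
  by rewrite keys_last.
apply/negP=> /(nthP 0)[i]; rewrite size_pairmap => im /(congr1 absz).
by rewrite abs_comp_of // => /eqP; rewrite subn_eq0 leqNgt keys_lt.
Qed.

Definition cell_shape m : scomp n := SComp (comp_of_keys m).

Lemma size_cell_shape m : size (cell_shape m) = size (keys m).
Proof. exact: size_pairmap. Qed.

Lemma offset_shape m i : (i <= size (keys m))%N ->
  offset (cell_shape m) i = (nth 0 (0 :: keys m) i)./2.
Proof. by move=> im; rewrite /offset sum_comp_of // keys_sorted_leq. Qed.

(** In any chamber refining m, a point comes after all points of the earlier
   blocks of m, and their number is the offset of its block in the shape. *)
Lemma blk_shape m v k : chamber v = cmul m (chamber 1%g) ->
  blk (cell_shape m) (abs_perm (v^-1)%g k) = index (key m k) (keys m).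
Proof.
move=> vE; have kL : key m k \in keys m by apply/mem_keys; exists k.
have im : (index (key m k) (keys m) < size (keys m))%N by rewrite index_mem.
have pos l : cle m k l -> (abs_perm (v^-1)%g k < upto m l)%N.
  move=> kl; rewrite -rank_chamber vE; apply: proper_card; apply/properP; split.
    apply/subsetP=> j; rewrite !inE => kj; apply: cle_trans kl.
    have := cle_total (cmul m (chamber 1%g)) k j; rewrite (negbTE kj) /= cle_mul.
    by case/andP.
  by exists k; rewrite !inE ?cle_refl.
have pos' l : ~~ cle m k l -> (upto m l <= abs_perm (v^-1)%g k)%N.
  move=> kl; rewrite -rank_chamber vE; apply: subset_leq_card.
  apply/subsetP=> j; rewrite !inE => jl; rewrite cle_mul.
  by apply: contra kl => /andP[kj _]; apply: cle_trans jl.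
apply: blk_eq; first by rewrite size_cell_shape.
rewrite !offset_shape ?(ltnW im) //= nth_index // key_half pos ?cle_refl // andbT.
case E: (index _ _) im => [|i] //= im.
have /mem_keys[l lE] := mem_nth 0%N (ltnW im).
have kE := nth_index 0%N kL; rewrite E in kE.
rewrite -lE key_half pos' // -leq_key lE -ltnNge -kE.
by rewrite keys_nth_lt // ltnSn.
Qed.

Lemma shape_pull m : exists s, m = pull s (std_cell (cell_shape m)).
Proof.
have [v vE] := mul_chamber m 1%g; exists (abs_perm (v^-1)%g).
have kL k : key m k \in keys m by apply/mem_keys; exists k.
apply: eq_cell => [k l|k].
  rewrite cle_pull cle_std_cell !(blk_shape _ vE) -leq_key.
  case: (ltngtP (key m k) (key m l)) => [/keys_index_lt/ltnW -> //|/keys_index_lt|->].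
    by rewrite ltnNge => /negbTE ->.
  by rewrite leqnn.
rewrite ccol_pull ccol_std_cell /bneg (blk_shape _ vE) comp_of_nth ?index_mem //.
rewrite nth_index // key_odd key_half; have lt := keys_lt (etrans (index_mem _ _) (kL k)).
move: lt; rewrite nth_index // key_half => lt.
by case: ccol; rewrite ?expr1 ?expr0 ?mulN1r ?mul1r; lia.
Qed.

Lemma cell_shape_std_cell C : cell_shape (std_cell C) = C.
Proof.
have blk_leq l i : (i < size C)%N -> (blk C (l : 'I_n) <= i)%N = (l < offset C i.+1)%N.
  move=> iC; have [j jC lj] := blk_ex C (ltn_ord l); rewrite (blk_eq jC lj).
  case/andP: lj => jl lj; apply/idP/idP => [ji|].
    by apply: leq_trans lj _; apply: leq_offset; rewrite ltnS ji.
  apply: contraTT; rewrite -ltnNge -leqNgt => ij.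
  by apply: leq_trans jl; apply: leq_offset; rewrite ij ltnW.
have offn i : (i < size C)%N -> (offset C i.+1 <= n)%N.
  by move=> iC; rewrite -[X in (_ <= X)%N](offset_size C) leq_offset // iC leqnn.
have up k : upto (std_cell C) k = offset C (blk C k).+1.
  have kC := blk_lt C (ltn_ord k).
  rewrite -[RHS](@card_ltn_ord n) ?offn //; apply: eq_card => l.
  by rewrite !inE cle_std_cell blk_leq.
pose f i := ((offset C i.+1).*2 + ((val C)`_i < 0)%R)%N.
have keyE k : key (std_cell C) k = f (blk C k) by rewrite /key up ccol_std_cell.
have f_lt i j : (i < size C)%N -> (j < size C)%N -> (i < j)%N -> (f i < f j)%N.
  move=> iC jC ij; have lt1 := offset_ltS jC.
  have le : (offset C i.+1 <= offset C j)%N by apply: leq_offset; rewrite ij ltnW.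
  by rewrite /f; case: (_ < _)%R; case: (_ < _)%R; lia.
have keysE : keys (std_cell C) = [seq f i | i <- iota 0 (size C)].
  apply: (irr_sorted_eq ltn_trans ltnn); first exact: keys_sorted.
    apply: (@homo_sorted_in _ _ (fun i => i < size C)%N) (iota_ltn_sorted _ _).
      by move=> i j iC jC; apply: f_lt.
    by apply/allP=> i; rewrite mem_iota.
  move=> j; apply/mem_keys/mapP => [[k <-]|[i]].
    by exists (blk C k); rewrite ?keyE // mem_iota blk_lt.
  rewrite mem_iota add0n /= => iC ->.
  have kn : (offset C i < n)%N by apply: leq_trans (offn i iC); apply: offset_ltS.
  exists (Ordinal kn); rewrite keyE (@blk_eq _ _ i) //=.
  by rewrite leqnn offset_ltS.
apply: val_inj; rewrite /= keysE; apply: (@eq_from_nth _ 0).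
  by rewrite size_pairmap size_map size_iota.
rewrite size_pairmap size_map size_iota => i iC.
have nthf j : (j < size C)%N -> nth 0%N [seq f i | i <- iota 0 (size C)] j = f j.
  by move=> jC; rewrite (nth_map 0%N) ?size_iota // nth_iota.
have f_half j : (f j)./2 = offset C j.+1 by rewrite /f addnC half_bit_double.
rewrite comp_of_nth ?size_map ?size_iota // nthf // f_half.
have -> : (nth 0 (0 :: [seq f i | i <- iota 0 (size C)]) i)./2 = offset C i.
  by case: i iC => [|i] iC /=; rewrite ?offset0 // nthf 1?ltnW // f_half.
rewrite offsetS // addKn /f oddD odd_double oddb /=.
by case: ltrP => [lt0|ge0]; rewrite ?expr1 ?expr0 ?mulN1r ?mul1r; lia.
Qed.

Lemma std_cell_inj C D s : std_cell C = pull s (std_cell D) -> C = D.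
Proof.
move=> e; rewrite -(cell_shape_std_cell C) -(cell_shape_std_cell D) e.
by apply: val_inj; rewrite /= keys_pull.
Qed.

End Shapes.

(** * The lift of the Mantaci-Reutenauer algebra to cells *)

Section Lift.

Variables (K : fieldType) (n : nat).
Implicit Types (C D : scomp n) (u v w : sperm n) (m : cell n) (a b : cell n -> K).

Definition x_lift C : cell n -> K := fun m => (m \in faces C)%:R.

Definition comb_lift (c : scomp n -> K) : cell n -> K := fun m => \sum_C c C * x_lift C m.

Definition comb_x (c : scomp n -> K) : galg K (sperm n) := \sum_C c C *: xC C K.

Lemma x_lift_inv C : relabel_inv (x_lift C).
Proof. by move=> s m; rewrite /x_lift faces_pull. Qed.

Lemma comb_lift_inv c : relabel_inv (comb_lift c).
Proof. by move=> s m; apply: eq_bigr => C _; rewrite x_lift_inv. Qed.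

Lemma sum_x_lift C (f : cell n -> K) :
  \sum_m x_lift C m * f m = \sum_(u in incr_reps C) f (face C u).
Proof.
transitivity (\sum_(m in faces C) f m).
  rewrite [RHS]big_mkcond; apply: eq_bigr => m _; rewrite /x_lift.
  by case: ifP => _; rewrite ?mul1r ?mul0r.
by rewrite facesE big_imset //; apply: face_inj.
Qed.

Lemma galg_of_lift C : galg_of (x_lift C) = xC C K.
Proof.
apply/ffunP=> v; rewrite ffunE sum_x_lift /xC XC_incr sum_ffunE; apply: eq_bigr => u uX.
by rewrite face_chamber // (inj_eq (@chamber_inj n)) ffunE eq_sym.
Qed.

Lemma eq_galg_of a b : a =1 b -> galg_of a = galg_of b.
Proof. by move=> ab; apply/ffunP=> v; rewrite !ffunE; apply: eq_bigr => m _; rewrite ab. Qed.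

Lemma galg_of_comb_lift c : galg_of (comb_lift c) = comb_x c.
Proof. by rewrite galg_of_lin; apply: eq_bigr => C _; rewrite galg_of_lift. Qed.

Lemma x_lift_std C s m : m = pull s (std_cell C) -> x_lift C m = 1.
Proof. by move=> ->; rewrite /x_lift faces_pull std_cell_faces. Qed.

Lemma x_lift_triangular C D m s : m = pull s (std_cell C) -> x_lift D m != 0 ->
  (cmeas (std_cell D) <= cmeas m)%N -> D = C.
Proof.
move=> mC; rewrite /x_lift; case: (boolP (m \in faces D)) => [mD _ le|_]; last by rewrite eqxx.
have [t mE] : exists t, m = pull t (std_cell D).
  by apply: (faces_meas_eq mD); apply/eqP; rewrite eqn_leq le faces_meas.
apply: (@std_cell_inj _ _ _ (t^-1 * s)%g); rewrite -pull_comp -mC mE.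
by rewrite pull_comp mulVg pull1.
Qed.

(** Triangularity: x_lift C is 1 on the orbit of std_cell C, and otherwise it is
   supported on cells of smaller measure. *)
Lemma inv_span a : relabel_inv a -> exists c, a =1 comb_lift c.
Proof.
move=> ia; have : forall m, a m != 0 -> (cmeas m < (n * n + n).+1)%N.
  move=> m _; rewrite ltnS; apply: leq_add.
    have -> : (n * n)%N = #|{: 'I_n * 'I_n}| by rewrite card_prod card_ord.
    exact: max_card.
  by rewrite -[X in (_ <= X)%N]card_ord; apply: max_card.
elim: (n * n + n).+1 a ia => [|N IHN] a ia aN.
  exists (fun=> 0) => m; rewrite /comb_lift big1 => [|C _]; last by rewrite mul0r.
  by apply/eqP; apply: contraT => /aN.
pose c C := if cmeas (std_cell C) == N then a (std_cell C) else 0.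
pose b m := a m - comb_lift c m.
have ib : relabel_inv b by move=> s m; rewrite /b ia comb_lift_inv.
have [m bm|d bd] := IHN b ib; last first.
  exists (fun C => c C + d C) => m.
  rewrite /comb_lift -[LHS](subrK (comb_lift c m)) -/(b m) bd addrC -big_split.
  by apply: eq_bigr => C _; rewrite mulrDl.
have [s mE] := shape_pull m; set C := cell_shape m in mE.
rewrite ltn_neqAle; apply/andP; split.
  apply: contraNneq bm => mN; rewrite /b /comb_lift (bigD1 C) //= (x_lift_std mE) mulr1.
  rewrite big1 ?addr0 => [|D DC].
    by rewrite /c -(cmeas_pull s) -mE mN eqxx subr_eq0 mE ia.
  rewrite /c; case: eqP => [DN|_]; last by rewrite mul0r.
  apply/eqP; rewrite mulf_eq0; apply/orP; right; apply: contraR DC => XD.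
  by apply/eqP; apply: (x_lift_triangular mE XD); rewrite DN mN.
rewrite leqNgt; apply: contra bm => Nm; rewrite /b /comb_lift big1 ?subr0.
  by apply: contraT => /aN; rewrite ltnS leqNgt Nm.
move=> D _; rewrite /c; case: eqP => [DN|_]; last by rewrite mul0r.
rewrite /x_lift; case: (boolP (m \in faces D)) => [/faces_meas|_]; last by rewrite mulr0.
by rewrite DN leqNgt Nm.
Qed.

Lemma comb_lift_eq0 c : comb_lift c =1 (fun=> 0) -> forall C, c C = 0.
Proof.
move=> c0 C0; apply/eqP; apply: contraT => cC0.
case: (@arg_maxnP _ C0 (fun C => c C != 0) (fun C => cmeas (std_cell C)) cC0) => C cC Cmax.
have := c0 (std_cell C); rewrite /comb_lift (bigD1 C) //= (@x_lift_std _ 1%g) ?pull1 // mulr1.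
rewrite big1 ?addr0 => [/eqP|D DC]; first by rewrite (negbTE cC).
apply/eqP; rewrite mulf_eq0; apply: contraR DC; rewrite negb_or => /andP[cD XD].
by apply/eqP; apply: (@x_lift_triangular _ _ (std_cell C) 1%g _ XD); rewrite ?pull1 //; apply: Cmax.
Qed.

Lemma comb_x_eq0 c : comb_x c = 0 -> forall C, c C = 0.
Proof.
rewrite -galg_of_comb_lift => /(galg_of_inj (comb_lift_inv c)); exact: comb_lift_eq0.
Qed.

Lemma comb_xE (c : scomp n -> K) :
  comb_x c = \sum_(i < #|{: scomp n}|) c (enum_val i) *: (xtuple K n)`_i.
Proof.
rewrite /comb_x (reindex _ (onW_bij _ (enum_val_bij _))) /=; apply: eq_bigr => i _.
by rewrite -[X in X`__]/(tval (mktuple _)) nth_mktuple.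
Qed.

Lemma xtuple_free : free (xtuple K n).
Proof.
apply/freeP=> k k0 i; have := comb_x_eq0 (c := fun C => k (enum_rank C)).
move/(_ _ (enum_val i)); rewrite enum_valK; apply.
by rewrite comb_xE -[RHS]k0; apply: eq_bigr => j _; rewrite enum_valK.
Qed.

Definition xcoord (a : galg K (sperm n)) C : K := coord (xtuple K n) (enum_rank C) a.

Lemma xcoord_comb_x c C : xcoord (comb_x c) C = c C.
Proof. by rewrite /xcoord comb_xE coord_sum_free ?xtuple_free // enum_rankK. Qed.

Lemma xtuple_nth C : tnth (xtuple K n) (enum_rank C) = xC C K.
Proof. by rewrite tnth_mktuple enum_rankK. Qed.

Lemma KSigmaE : KSigma K n = <<xtuple K n>>%VS.
Proof.
apply: eq_span => a; apply/idP/idP.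
  by move=> /mapP[C _ ->]; rewrite -xtuple_nth mem_tnth.
by case/tnthP=> i ->; rewrite tnth_mktuple; apply: map_f; rewrite mem_enum.
Qed.

Lemma comb_x_KSigma c : comb_x c \in KSigma K n.
Proof.
rewrite KSigmaE comb_xE; apply: rpred_sum => i _; rewrite rpredZ // memv_span //.
by rewrite mem_nth // size_tuple.
Qed.

Lemma KSigma_comb_x (a : galg K (sperm n)) : a \in KSigma K n -> a = comb_x (xcoord a).
Proof.
rewrite KSigmaE => aK; rewrite comb_xE [LHS](coord_span aK).
by apply: eq_bigr => i _; rewrite /xcoord enum_valK.
Qed.

Lemma xC_KSigma C : xC C K \in KSigma K n.
Proof. by rewrite memv_span //; apply/mapP; exists C; rewrite ?mem_enum. Qed.

Lemma KSigmaP (a : galg K (sperm n)) :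
  reflect (exists2 b, relabel_inv b & galg_of b = a) (a \in KSigma K n).
Proof.
apply: (iffP idP) => [/KSigma_comb_x ->|[b /inv_span[c bc] <-]].
  by exists (comb_lift (xcoord a)); [exact: comb_lift_inv | exact: galg_of_comb_lift].
by rewrite (eq_galg_of bc) galg_of_comb_lift comb_x_KSigma.
Qed.

Lemma KSigma1 : 1 \in KSigma K n.
Proof. by apply/KSigmaP; exists (@delta_one K n); [exact: delta_one_inv | exact: galg_of_one]. Qed.

Lemma KSigmaM (a b : galg K (sperm n)) :
  a \in KSigma K n -> b \in KSigma K n -> a * b \in KSigma K n.
Proof.
move=> /KSigmaP[a' ia <-] /KSigmaP[b' ib <-]; rewrite -galg_of_conv //.
by apply/KSigmaP; exists (conv b' a'); first exact: conv_inv.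
Qed.

End Lift.

(** * Fixed cosets and morphisms to the base field *)

Section FixedCosets.

Variable n : nat.
Implicit Types (D : scomp n) (u v w g : sperm n).

(** The number of cosets u W_D fixed by g, each counted through its
   representative in X_D. *)
Definition fixed_cosets D g := #|[set u in incr_reps D | (u^-1 * (g * u))%g \in WC D]|.

Lemma conj_WC D g u : reflect (forall x, lab D ((u^-1)%g (g x)) = lab D ((u^-1)%g x))
  ((u^-1 * (g * u))%g \in WC D).
Proof.
apply: (iffP (WCP _ _)) => [h x|h x]; last by rewrite !spermE h spermVE.
by have := h ((u^-1)%g x); rewrite !spermE spermEV.
Qed.

Lemma conj_WC_coset D g u t : t \in WC D ->
  (((u * t)^-1 * (g * (u * t)))%g \in WC D) = ((u^-1 * (g * u))%g \in WC D).
Proof.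
move=> tD; rewrite invMg !mulgA -(mulgA _ u t) -!mulgA.
by rewrite groupMl ?groupV // !mulgA groupMr.
Qed.

Lemma sum_conj_WC D g :
  (#|[set w | (w^-1 * (g * w))%g \in WC D]| = fixed_cosets D g * #|WC D|)%N.
Proof.
pose f u := (if (u^-1 * (g * u))%g \in WC D then 1 else 0)%N.
have fC u t : t \in WC D -> f (u * t)%g = f u.
  by move=> tD; rewrite /f conj_WC_coset.
rewrite -sum1dep_card big_mkcond (sum_incr_reps (f := f) fC).
by rewrite /fixed_cosets -sum1dep_card big_mkcondr -mulr_natr natn.
Qed.

End FixedCosets.

Section CycleType.

Variables (n : nat) (rp : 'I_n -> 'I_n) (F : {set 'I_n}).
Hypothesis rpK : forall k, rp (rp k) = rp k.
Hypothesis rpF : forall k, k \in F -> rp k = k.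
Implicit Types (k l : 'I_n) (D : scomp n) (u v w : sperm n) (x y : sidx n).

Definition cyc_class k := [seq l <- enum 'I_n | rp l == rp k].

Lemma cyc_class_uniq k : uniq (cyc_class k).
Proof. by rewrite filter_uniq // enum_uniq. Qed.

Lemma mem_cyc_class k l : (l \in cyc_class k) = (rp l == rp k).
Proof. by rewrite mem_filter mem_enum andbT. Qed.

Lemma eq_cyc_class k l : rp k = rp l -> cyc_class k = cyc_class l.
Proof. by move=> e; apply: eq_filter => j; rewrite e. Qed.

Definition cyc_next k := next (cyc_class k) k.

Lemma rp_next k : rp (cyc_next k) = rp k.
Proof. by apply/eqP; rewrite -mem_cyc_class mem_next mem_cyc_class. Qed.

Lemma cyc_next_inj : injective cyc_next.
Proof.
move=> k l e; have ecl : cyc_class k = cyc_class l.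
  by apply: eq_cyc_class; rewrite -rp_next e rp_next.
rewrite -(prev_next (cyc_class_uniq k) k) -[RHS](prev_next (cyc_class_uniq l) l).
by rewrite -/(cyc_next k) -/(cyc_next l) e ecl.
Qed.

Definition cyc_perm := perm cyc_next_inj.

Lemma iter_cyc j k : iter j cyc_perm k = iter j (next (cyc_class k)) k.
Proof.
have rpj i : rp (iter i cyc_perm k) = rp k.
  by elim: i => //= i IHi; rewrite permE rp_next.
elim: j => //= j IHj; rewrite permE /cyc_next (eq_cyc_class (rpj j)).
by rewrite IHj.
Qed.

Lemma cyc_trans k l : rp k = rp l -> exists j, l = iter j cyc_perm k.
Proof.
move=> kl; have cy := cycle_next (cyc_class_uniq k).
have kk : k \in cyc_class k by rewrite mem_cyc_class.
have : fconnect (next (cyc_class k)) k l.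
  by rewrite (fconnect_cycle cy kk) mem_cyc_class kl.
by move=> /iter_findex <-; exists (findex (next (cyc_class k)) k l); rewrite iter_cyc.
Qed.

(** A product of disjoint signed cycles, one on each class of rp, with a sign
   change at the points of F: the cycles through F are the negative ones. *)
Definition gcyc := signed_perm cyc_perm (mem F).

Definition orbit_rel x y := (rp x.2 == rp y.2) && ((x.1 == y.1) || (rp x.2 \in F)).

(** Going around a cycle through F changes the sign exactly once. *)
Lemma gcycP (h : sidx n -> nat) :
  (forall x, h (gcyc x) = h x) <-> (forall x y, orbit_rel x y -> h x = h y).
Proof.
split=> [hg|hr [b k]]; last first.
  apply: hr; rewrite signed_permE /orbit_rel /= permE rp_next eqxx /=.
  case: (boolP (k \in F)) => kF; last by rewrite addbF eqxx.
  by rewrite (rpF kF) kF orbT.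
have hj j x : h (iter j gcyc x) = h x by elim: j => //= j IHj; rewrite hg.
have g2 j x : (iter j gcyc x).2 = iter j cyc_perm x.2.
  by elim: j => //= j IHj; rewrite signed_permE /= IHj.
have rpj j k : rp (iter j cyc_perm k) = rp k.
  by elim: j => //= j IHj; rewrite permE rp_next.
have inF k : k \in F -> forall b, h (b, k) = h (~~ b, k).
  move=> kF b; have ex : exists j, (0 < j)%N && (iter j cyc_perm k == k).
    exists (fingraph.order cyc_perm k).
    by rewrite fingraph.order_gt0 iter_order ?eqxx //; apply: perm_inj.
  case: (ex_minnP ex) => s /andP[s0 /eqP sk] smin.
  have step j : (0 < j <= s)%N -> iter j gcyc (b, k) = (~~ b, iter j cyc_perm k).
    elim: j => // j IHj /andP[_ js]; case: (posnP j) => [->|j0].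
      by rewrite /= signed_permE /= kF addbT.
    rewrite iterS IHj ?j0 1?ltnW // signed_permE /=.
    case: (boolP (_ \in F)) => [jF|]; last by rewrite addbF.
    have := smin j; rewrite j0 -{2}(rpF kF) -(rpj j k) (rpF jF) eqxx /= => /(_ isT).
    by rewrite leqNgt js.
  by rewrite -(hj s) step ?s0 ?leqnn // sk.
case=> b k [c l]; rewrite /orbit_rel /= => /andP[/eqP kl].
case: (boolP (rp k \in F)) => [kF _|kF].
  suff all_eq d j : rp j = rp k -> h (d, j) = h (false, rp k) by rewrite all_eq // [RHS]all_eq.
  move=> jk; have [i iE] := cyc_trans (etrans jk (esym (rpK k))).
  have := hj i (d, j); rewrite [iter i gcyc _]surjective_pairing g2 -iE => <-.
  by case: (_.1) => //; rewrite inF.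
rewrite orbF => /eqP <-; have [j lE] := cyc_trans kl.
rewrite lE; have := hj j (b, k); rewrite [iter j gcyc _]surjective_pairing g2 /= => <-.
congr (h (_, _)); elim: j {lE} => //= j IHj; rewrite signed_permE /= IHj g2 /=.
case: (boolP (_ \in F)) => [jF|_]; last by rewrite addbF.
by case/negP: kF; rewrite -(rpj j) (rpF jF).
Qed.

Definition coarse (m : cell n) := [forall k, cle m k (rp k) && cle m (rp k) k].

Lemma coarse_mul (x y : cell n) : coarse (cmul x y) = coarse x && coarse y.
Proof.
apply/forallP/andP => [h|[/forallP hx /forallP hy] k].
  have hx k : cle x k (rp k) && cle x (rp k) k.
    by have := h k; rewrite !cle_mul => /andP[/andP[-> _] /andP[-> _]].
  split; apply/forallP => // k; have := h k; have /andP[a b] := hx k.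
  by rewrite !cle_mul a b /= (ccolE a b); case: ccol => // /andP[-> ->].
have /andP[a b] := hx k; have /andP[c d] := hy k.
by rewrite !cle_mul a b c d /= !if_same.
Qed.

Section Functional.

Variable K : fieldType.
Implicit Types (a b : cell n -> K).

Definition sgnF (R : pzRingType) (m : cell n) : R := \prod_(k in F) (-1) ^+ ccol m k.

(** The character of the group of colourings attached to the signs F, applied to
   the cells whose blocks are unions of classes of rp. *)
Definition cell_char a : K := \sum_m a m * ((coarse m)%:R * sgnF K m).

Lemma cell_char_conv a b : cell_char (conv a b) = cell_char a * cell_char b.
Proof.
rewrite /cell_char sum_conv mulr_suml; apply: eq_bigr => x _.
rewrite mulr_sumr; apply: eq_bigr => y _.
have -> : sgnF K (cmul x y) = sgnF K x * sgnF K y.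
  by rewrite /sgnF -big_split; apply: eq_bigr => k _; rewrite ccol_mul signr_addb.
rewrite coarse_mul -mulnb natrM [RHS]mulrACA; congr (_ * _).
by rewrite [RHS]mulrACA.
Qed.

Lemma cell_char_one : cell_char (@delta_one K n) = 1.
Proof.
rewrite /cell_char (bigD1 (cell_one n)) //= big1 ?addr0 => [|m /negbTE me]; last first.
  by rewrite /delta_one me mul0r.
rewrite /delta_one eqxx mul1r /sgnF big1 => [|k _]; last by rewrite ccol_mk.
have -> : coarse (cell_one n) by apply/forallP=> k; rewrite !cle_mk.
by rewrite mulr1.
Qed.

End Functional.

End CycleType.

(** * The values of the morphisms are numbers of fixed cosets *)

Section ChiFaces.

Variables (n : nat) (rp : 'I_n -> 'I_n) (F : {set 'I_n}) (D : scomp n).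
Hypothesis rpK : forall k, rp (rp k) = rp k.
Hypothesis rpF : forall k, k \in F -> rp k = k.
Implicit Types (k l : 'I_n) (u v w : sperm n) (x y : sidx n).

Local Notation coarse := (coarse rp).
Local Notation sgnF := (sgnF F).
Local Notation gcyc := (gcyc rp F).

Let clab w x := lab D ((w^-1)%g x).

Lemma clab_opp w x y : clab w x = clab w y -> clab w (sopp x) = clab w (sopp y).
Proof. by rewrite /clab !sperm_opp; apply: lab_opp. Qed.

Lemma clab_odd w x : clab w (sopp x) != clab w x -> odd (clab w (sopp x)) = ~~ odd (clab w x).
Proof.
rewrite /clab sperm_opp lab_oppE negbK => nx; rewrite !lab_odd /= nx !andbT.
by case: (_.1).
Qed.

Lemma coarse_face w : coarse (face D w) = [forall k, clab w (false, k) == clab w (false, rp k)].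
Proof. by apply: eq_forallb => k; rewrite !cle_face -eqn_leq. Qed.

Lemma coarse_clab w b k : coarse (face D w) -> clab w (b, k) = clab w (b, rp k).
Proof.
rewrite coarse_face => /forallP/(_ k)/eqP e; case: b => //.
by rewrite -[(true, k)]/(sopp (false, k)) (clab_opp e).
Qed.

Definition weight w : int := (coarse (face D w))%:R * sgnF int (face D w).

Definition flip_class k := signed_perm (1%g : {perm 'I_n}) (fun l => rp l == k).

Lemma flip_classE k x : flip_class k x = (x.1 (+) (rp x.2 == k), x.2).
Proof. by rewrite signed_permE perm1. Qed.

Lemma flip_classK k : (flip_class k * flip_class k = 1)%g.
Proof.
by apply: spermP => l; rewrite spermE !flip_classE sperm1E /= addbb.
Qed.

Lemma clab_flip k w x : clab (flip_class k * w)%g x = clab w (flip_class k x).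
Proof.
have fV : ((flip_class k)^-1 = flip_class k)%g.
  by apply: (mulgI (flip_class k)); rewrite mulgV flip_classK.
by rewrite /clab invMg fV spermE.
Qed.

(** The cycle through k lies in the image under w of a negative block. *)
Definition split w k := (k \in F) && (clab w (true, k) != clab w (false, k)).

Lemma split_flip k w : split (flip_class k * w)%g =1 split w.
Proof.
move=> l; rewrite /split !clab_flip !flip_classE /=; case: (rp l == k) => //=.
by rewrite eq_sym.
Qed.

Definition unsplit_involution w :=
  if [pick k | split w k] is Some k then (flip_class k * w)%g else w.

Lemma unsplit_involutionK : involutive unsplit_involution.
Proof.
move=> w; rewrite {2}/unsplit_involution; case E: [pick k | split w k] => [k|].
  by rewrite /unsplit_involution (eq_pick (split_flip k w)) E mulgA flip_classK mul1g.
by rewrite /unsplit_involution E.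
Qed.

Lemma weight_flip w k : split w k -> weight (flip_class k * w)%g = - weight w.
Proof.
case/andP=> kF hk; rewrite /weight.
have -> : coarse (face D (flip_class k * w)%g) = coarse (face D w).
  rewrite !coarse_face; apply: eq_forallb => l; rewrite !clab_flip !flip_classE /= rpK.
  case: (rp l == k) => //=; rewrite -[(true, l)]/(sopp (false, l)).
  rewrite -[(true, rp l)]/(sopp (false, rp l)).
  by apply/eqP/eqP => [/clab_opp|/clab_opp //]; rewrite !soppK.
rewrite -mulrN; congr (_ * _); rewrite /sgnF (bigD1 k) //= [in RHS](bigD1 k) //=.
rewrite -mulNr; congr (_ * _).
  rewrite !ccol_label -!/(clab _ _) clab_flip flip_classE /= (rpF kF) eqxx.
  by rewrite (clab_odd hk) negbK; case: odd; rewrite ?expr1 ?expr0 ?opprK.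
apply: eq_bigr => l /andP[lF lk].
by rewrite !ccol_label -!/(clab _ _) clab_flip flip_classE /= (rpF lF) (negbTE lk).
Qed.

(** Changing the signs on one split cycle through F preserves the blocks up to
   swapping the two halves of a negative block, and reverses the weight. *)
Lemma sum_weight_split : \sum_(w | [exists k, split w k]) weight w = 0.
Proof.
set S := \sum_(w | _) _; suff : S = - S by lia.
rewrite {1}/S (reindex_inj (inv_inj unsplit_involutionK)) -sumrN.
apply: eq_big => [w|w]; rewrite /unsplit_involution; case: pickP => [k kw|no] //.
  by apply: eq_existsb => l; rewrite split_flip.
  by move=> _; rewrite weight_flip.
by move=> /existsP[k]; rewrite no.
Qed.

Lemma conj_gcycP w : ((w^-1 * (gcyc * w))%g \in WC D) =
  coarse (face D w) && ~~ [exists k, split w k].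
Proof.
apply/conj_WC/andP => [/(gcycP rpK rpF) hc|[co ns]]; last first.
  apply/(gcycP rpK rpF) => -[b k] [c l]; rewrite /orbit_rel /= => /andP[/eqP kl].
  rewrite -/(clab w (b, k)) -/(clab w (c, l)) (coarse_clab b k co) (coarse_clab c l co) kl.
  case/orP => [/eqP -> //|lF].
  have : ~~ split w (rp l) by apply: contra ns => sl; apply/existsP; exists (rp l).
  by rewrite /split lF /= negbK => /eqP; case: b; case: c.
split.
  rewrite coarse_face; apply/forallP=> k; apply/eqP; apply: (hc (false, k) (false, rp k)).
  by rewrite /orbit_rel /= rpK !eqxx.
apply/existsP => -[k /andP[kF /eqP[]]]; apply: (hc (true, k) (false, k)).
by rewrite /orbit_rel /= eqxx (rpF kF) kF.
Qed.

Lemma sum_weight : \sum_w weight w = (fixed_cosets D gcyc * #|WC D|)%:R.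
Proof.
rewrite (bigID (fun w => [exists k, split w k])) /= sum_weight_split add0r.
rewrite -sum_conj_WC -sum1dep_card natr_sum [RHS]big_mkcond [LHS]big_mkcond /=.
apply: eq_bigr => w _; rewrite conj_gcycP andbC.
case: (boolP [exists k, split w k]) => //= ns; rewrite /weight.
case: (boolP (coarse _)) => [co|_]; last by rewrite mul0r.
rewrite mul1r /sgnF big1 // => k kF; rewrite ccol_label.
have : ~~ split w k by apply: contra ns => sk; apply/existsP; exists k.
rewrite /split kF /= negbK -[(true, k)]/(sopp (false, k)) /clab sperm_opp lab_oppE.
by move=> /negbTE nk; rewrite lab_odd nk andbF.
Qed.

Variable K : fieldType.

Lemma cell_char_lift : cell_char rp F (x_lift K D) = (fixed_cosets D gcyc)%:R.
Proof.
have wC u t : t \in WC D -> weight (u * t)%g = weight u.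
  by move=> tD; rewrite /weight face_coset.
have := sum_weight; rewrite (sum_incr_reps (C := D) (f := weight) wC) natrM.
rewrite -[LHS]mulr_natr => /mulIf eqw.
have {eqw} : \sum_(u in incr_reps D) weight u = (fixed_cosets D gcyc)%:R.
  by apply: eqw; rewrite pnatr_eq0 -lt0n; apply: cardG_gt0.
move/(congr1 (fun z : int => z%:~R : K)); rewrite rmorph_nat => <-.
rewrite /cell_char sum_x_lift rmorph_sum; apply: eq_bigr => u _ /=.
rewrite /weight rmorphM rmorph_nat; congr (_ * _).
by rewrite /sgnF rmorph_prod; apply: eq_bigr => k _; rewrite rmorph_sign.
Qed.

End ChiFaces.

(** * Nilpotency of the common kernel *)

Section Nilpotency.

Variables (K : fieldType) (n : nat).
Implicit Types (k l : 'I_n) (x y z m : cell n) (a b : cell n -> K).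

Lemma sum_sym_char2 (T : finType) (P : rel T) (f : T -> T -> K) : 2%:R = 0 :> K ->
    symmetric P -> irreflexive P -> (forall s t, f s t = f t s) ->
  \sum_s \sum_(t | P s t) f s t = 0.
Proof.
move=> two0 symP irrP symf; rewrite pair_big_dep /=.
rewrite (bigID (fun p : T * T => (enum_rank p.1 < enum_rank p.2)%N)) /=.
set S := \sum_(p | _) _.
suff -> : \sum_(p | P p.1 p.2 &&
    ~~ (enum_rank p.1 < enum_rank p.2)%N) f p.1 p.2 = S.
  by rewrite -mulr2n -mulr_natl two0 mul0r.
have swK : involutive (fun p : T * T => (p.2, p.1)) by case.
rewrite (reindex_inj (inv_inj swK)) /S /=; apply: eq_big => [[x y]|[x y] _] /=; last exact: symf.
rewrite symP; case: (boolP (P x y)) => //= xy; rewrite -leqNgt leq_eqVlt.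
case: eqP => //= /val_inj/enum_rank_inj e.
by rewrite e irrP in xy.
Qed.

Lemma prod_1D (T : finType) (R : {set T}) (e : T -> K) :
  \prod_(k in R) (1 + e k) = \sum_(F : {set T} | F \subset R) \prod_(k in F) e k.
Proof.
transitivity (\prod_k ((if k \in R then e k else 0) + 1)).
  by rewrite big_mkcond; apply: eq_bigr => k _; case: ifP; rewrite ?add0r // addrC.
rewrite bigA_distr [RHS]big_mkcond; apply: eq_bigr => F _.
rewrite -big_mkcond; case: ifP => [/subsetP FR|/negbT/subsetPn[k kF kR]].
  by apply: eq_bigr => k /FR ->.
by rewrite (bigD1 k) //= (negbTE kR) mul0r.
Qed.

Section TopPart.

Variables (rp : 'I_n -> 'I_n) (a : cell n -> K).
Hypothesis rpK : forall k, rp (rp k) = rp k.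
Hypothesis cell_char0 : forall F : {set 'I_n},
  (forall k, k \in F -> rp k = k) -> cell_char rp F a = 0.

Definition coldiff (d : 'I_n -> bool) x y := [forall k, (ccol x k (+) ccol y k) == d k].

Lemma ccol_rp x k : coarse rp x -> ccol x (rp k) = ccol x k.
Proof. by move/forallP/(_ k)/andP=> [kr rk]; apply: ccolE. Qed.

(** Fourier inversion on the group of colourings of the classes of rp. *)
Lemma top_part_odd (d : 'I_n -> bool) x : 2%:R != 0 :> K ->
    (forall k, d (rp k) = d k) -> coarse rp x ->
  \sum_(y | coarse rp y && coldiff d x y) a y = 0.
Proof.
move=> two0 drp xco; pose R := [set k | rp k == k].
pose e y k : bool := ccol x k (+) ccol y k (+) d k.
have prodE y : coarse rp y ->
    \prod_(k in R) (1 + (-1) ^+ e y k) = (coldiff d x y)%:R * 2%:R ^+ #|R| :> K.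
  move=> yco; case: (boolP (coldiff d x y)) => [/forallP xy|].
    rewrite mul1r -prodr_const; apply: eq_bigr => k _.
    by rewrite /e (eqP (xy k)) addbb.
  rewrite negb_forall => /existsP[k kd]; rewrite mul0r.
  rewrite (bigD1 (rp k)) /=; last by rewrite inE rpK.
  rewrite /e !ccol_rp // drp; move: kd; rewrite -addbN addbC => kd.
  by have -> : ccol x k (+) ccol y k (+) d k = true;
    [move: kd; case: ccol; case: ccol; case: (d k) | rewrite expr1 subrr mul0r].
apply/eqP; rewrite -(inj_eq (mulIf (expf_neq0 #|R| two0))) mul0r; apply/eqP.
transitivity (\sum_(y | coarse rp y) a y * \prod_(k in R) (1 + (-1) ^+ e y k)).
  rewrite mulr_suml [LHS]big_mkcondr; apply: eq_bigr => y yco.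
  by rewrite prodE //; case: ifP; rewrite ?mul1r ?mul0r ?mulr0.
under eq_bigr => y _ do rewrite prod_1D mulr_sumr.
rewrite exchange_big big1 //= => F FR.
transitivity (\prod_(k in F) (-1) ^+ (ccol x k (+) d k) * cell_char rp F a); last first.
  by rewrite cell_char0 ?mulr0 // => k /(subsetP FR); rewrite inE => /eqP.
rewrite /cell_char mulr_sumr [LHS]big_mkcond; apply: eq_bigr => y _.
case: (coarse rp y); last by rewrite mul0r !mulr0.
rewrite mul1r mulrCA; congr (_ * _); rewrite /sgnF -big_split.
by apply: eq_bigr => k _; rewrite /= -signr_addb /e addbAC.
Qed.

(** Pairs (x, y) and (y, x) cancel. If d is nonzero then x = y does not occur; for
   d = 0, the sum over all pairs is the square of the trivial character of a. *)
Lemma top_part_char2 (d : 'I_n -> bool) : 2%:R = 0 :> K ->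
  \sum_(x | coarse rp x) \sum_(y | coarse rp y && coldiff d x y) a x * a y = 0.
Proof.
move=> two0; have diff0 (P : rel (cell n)) : symmetric P -> irreflexive P ->
    \sum_(x | coarse rp x) \sum_(y | coarse rp y && P x y) a x * a y = 0.
  move=> symP irrP.
  rewrite -[RHS](@sum_sym_char2 _ (fun x y => [&& coarse rp x, coarse rp y & P x y])
    (fun x y => a x * a y)) //.
  - rewrite big_mkcond; apply: eq_bigr => x _.
    by case: (coarse rp x) => //=; rewrite big1.
  - by move=> x y; rewrite symP andbCA.
  - by move=> x; rewrite irrP !andbF.
  - by move=> x y; rewrite mulrC.
have symd c x y : coldiff c x y = coldiff c y x.
  by apply: eq_forallb => k; rewrite addbC.
case: (pickP d) => [k dk|d0].
  apply: diff0 => [x y|x]; first exact: symd.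
  by apply/negP=> /forallP/(_ k); rewrite addbb dk.
have sum0 : \sum_(x | coarse rp x) a x = 0.
  rewrite -[RHS](cell_char0 (F := set0)) => [|k]; last by rewrite inE.
  rewrite /cell_char big_mkcond; apply: eq_bigr => x _; rewrite /sgnF big_set0 mulr1.
  by case: coarse; rewrite ?mulr1 ?mulr0.
have total : \sum_(x | coarse rp x) \sum_(y | coarse rp y) a x * a y = 0.
  by rewrite -big_distrlr /= sum0 mul0r.
rewrite -[RHS]total -[LHS]addr0.
rewrite -[X in _ + X](diff0 (fun x y => ~~ coldiff d x y)) -?big_split.
- by apply: eq_bigr => x _; rewrite [RHS](bigID (coldiff d x)).
- by move=> x y; rewrite symd.
- by move=> x; apply/negbF/forallP=> k; rewrite addbb d0.
Qed.

(** In the group algebra of the colourings of the classes of rp, all characters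
   vanish on the sum of the terms of a at the coarse cells, and so its square is
   zero. *)
Lemma top_part_square (d : 'I_n -> bool) : (forall k, d (rp k) = d k) ->
  \sum_(x | coarse rp x) \sum_(y | coarse rp y && coldiff d x y) a x * a y = 0.
Proof.
move=> drp; case: (eqVneq (2%:R : K) 0) => [|two0]; first exact: top_part_char2.
by apply: big1 => x xco; rewrite -mulr_sumr top_part_odd ?mulr0.
Qed.

End TopPart.

Section Refinement.

Variable a : cell n -> K.
Hypothesis cell_char0 : forall (rp : 'I_n -> 'I_n) (F : {set 'I_n}),
  (forall k, rp (rp k) = rp k) -> (forall k, k \in F -> rp k = k) -> cell_char rp F a = 0.

Definition block_rep z k := odflt k [pick l | cle z k l && cle z l k].

Lemma block_repP z k : cle z k (block_rep z k) && cle z (block_rep z k) k.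
Proof.
by rewrite /block_rep; case: pickP => [l //|/(_ k)]; rewrite cle_refl.
Qed.

Lemma block_rep_eq z k l : cle z k l -> cle z l k -> block_rep z k = block_rep z l.
Proof.
move=> kl lk; have same : (fun j => cle z k j && cle z j k) =1
    (fun j => cle z l j && cle z j l).
  move=> j; apply/andP/andP => -[u v]; split.
  - exact: cle_trans lk u.
  - exact: cle_trans v kl.
  - exact: cle_trans kl u.
  - exact: cle_trans v lk.
rewrite /block_rep (eq_pick same).
by case: pickP => // /(_ l); rewrite cle_refl.
Qed.

Lemma block_repK z k : block_rep z (block_rep z k) = block_rep z k.
Proof. by have /andP[kr rk] := block_repP z k; apply: block_rep_eq. Qed.

Lemma coarse_stable z x k l : coarse (block_rep z) x ->
  cle z k l -> cle z l k -> cle x k l.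
Proof.
move=> /forallP xco kl lk; have /andP[kr _] := xco k; have /andP[_ rl] := xco l.
by apply: cle_trans kr _; rewrite (block_rep_eq kl lk).
Qed.

Lemma cle_mul_coarse z x k l : coarse (block_rep z) x ->
  cle (cmul z x) k l = cle z k l.
Proof.
move=> xco; rewrite cle_mul; case: (boolP (cle z k l)) => //= kl.
by apply/implyP=> lk; rewrite !(coarse_stable xco) // if_same.
Qed.

Lemma eq_coarse (rp : 'I_n -> 'I_n) x y : cle x =2 cle y -> coarse rp x = coarse rp y.
Proof. by move=> e; apply: eq_forallb => k; rewrite !e. Qed.

(** The part of a that preserves the blocks of a cell z contributes, in two
   multiplications, the square of a sum of colourings, and this vanishes. *)
Lemma conv_conv_refines b N : (forall m, b m != 0 -> (npairs m <= N)%N) ->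
  forall m, conv (conv b a) a m != 0 -> (npairs m < N)%N.
Proof.
move=> bN m; apply: contraR; rewrite -leqNgt => Nm.
rewrite [conv _ _ _](_ : _ = \sum_z b z *
  \sum_x \sum_y a x * a y * (cmul (cmul z x) y == m)%:R); last first.
  transitivity (\sum_x conv b a x * \sum_y a y * (cmul x y == m)%:R).
    by apply: eq_bigr => x _; rewrite mulr_sumr; apply: eq_bigr => y _; rewrite mulrA.
  rewrite sum_conv; apply: eq_bigr => z _; rewrite mulr_sumr; apply: eq_bigr => x _.
  rewrite -mulrA; congr (_ * _); rewrite mulr_sumr.
  by apply: eq_bigr => y _; rewrite mulrA.
rewrite big1 // => z _; case: (eqVneq (b z) 0) => [->|/bN zN]; first by rewrite mul0r.
suff -> : \sum_x \sum_y a x * a y * (cmul (cmul z x) y == m)%:R = 0 by rewrite mulr0.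
have sub_mul x y k l : cle (cmul x y) k l -> cle x k l by rewrite cle_mul => /andP[].
case: (boolP [forall k, forall l, cle z k l == cle m k l]) => [/forallP zm|zm]; last first.
  rewrite big1 // => x _; rewrite big1 // => y _.
  case: eqP => [e|_]; last by rewrite mulr0.
  case/negP: zm; have mz k l : cle m k l -> cle z k l.
    by rewrite -e => /sub_mul/sub_mul.
  have pe : [set p : 'I_n * 'I_n | cle m p.1 p.2] = [set p | cle z p.1 p.2].
    apply/eqP; rewrite eqEcard; apply/andP; split; last exact: leq_trans zN Nm.
    by apply/subsetP=> p; rewrite !inE; apply: mz.
  apply/forallP=> k; apply/forallP=> l; have /setP/(_ (k, l)) := pe.
  by rewrite !inE => ->.
have {}zm k l : cle z k l = cle m k l by have /forallP/(_ l)/eqP := zm k.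
pose rp := block_rep z; have rpK : forall k, rp (rp k) = rp k := block_repK z.
have zco : coarse rp z by apply/forallP=> k; apply: block_repP.
have mco : coarse rp m by rewrite -(eq_coarse rp (x := z)).
pose d k := ccol z k (+) ccol m k.
have drp k : d (rp k) = d k by rewrite /d !(ccol_rp _ zco, ccol_rp _ mco).
have aF (F : {set 'I_n}) : (forall k, k \in F -> rp k = k) -> cell_char rp F a = 0.
  exact: cell_char0.
rewrite -[RHS](top_part_square rpK aF drp) [RHS]big_mkcond; apply: eq_bigr => x _.
case: (boolP (coarse rp x)) => [xco|xco]; last first.
  rewrite big1 // => y _; case: eqP => [e|_]; last by rewrite mulr0.
  by move: mco xco; rewrite -e !coarse_mul => /andP[/andP[_ ->]].
rewrite [RHS]big_mkcond; apply: eq_bigr => y _.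
have -> : (cmul (cmul z x) y == m) = coarse rp y && coldiff d x y.
  apply/eqP/andP => [e|[yco /forallP dxy]].
    split; first by move: mco; rewrite -e !coarse_mul => /andP[].
    apply/forallP=> k; rewrite /d -e !ccol_mul.
    by rewrite -addbA addbA addbb.
  apply: eq_cell => [k l|k].
    rewrite -cmulA cle_mul_coarse ?zm //.
    by rewrite coarse_mul xco.
  by rewrite !ccol_mul -addbA (eqP (dxy k)) /d addbA addbb.
by case: (_ && _); rewrite ?mulr1 ?mulr0.
Qed.

Definition conv_pow j := iter j (fun b => conv b a) (@delta_one K n).

Lemma conv_pow_eq0 : exists j, forall m, conv_pow j m = 0.
Proof.
have step j m : conv_pow j.*2 m != 0 -> (npairs m + j <= n * n)%N.
  elim: j m => [|j IHj] m.
    have -> : (n * n)%N = #|{: 'I_n * 'I_n}| by rewrite card_prod card_ord.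
    by rewrite addn0 => _; apply: max_card.
  move/(conv_conv_refines (N := n * n - j)); rewrite -/(conv_pow _) => h.
  have : (npairs m < n * n - j)%N by apply: h => x /IHj; lia.
  by lia.
exists (n * n).+1.*2 => m; apply/eqP; apply: contraT => /step.
by rewrite addnS ltnNge leq_addl.
Qed.

Lemma galg_of_nilpotent : relabel_inv a -> exists j, galg_of a ^+ j = 0.
Proof.
move=> ia; have [j j0] := conv_pow_eq0; exists j.
have inv i : relabel_inv (conv_pow i).
  by elim: i => [|i IHi]; [exact: delta_one_inv | exact: conv_inv].
suff -> : galg_of a ^+ j = galg_of (conv_pow j).
  by apply/ffunP=> v; rewrite !ffunE big1 // => m _; rewrite j0 mul0r.
elim: j {j0} => [|j IHj]; first by rewrite galg_of_one.
by rewrite exprS IHj /= galg_of_conv.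
Qed.

End Refinement.

End Nilpotency.

(** * The radical as a common kernel, and normalisers *)

Section Radical.

Variables (K : fieldType) (aT : falgType K) (A : {vspace aT}).
Variables (I : Type) (f : I -> 'Hom(aT, K^o)).
Hypothesis A1 : 1 \in A.
Hypothesis AM : forall a b, a \in A -> b \in A -> a * b \in A.
Hypothesis f1 : forall i, f i 1 = 1.
Hypothesis fM : forall i a b, a \in A -> b \in A -> f i (a * b) = f i a * f i b :> K.
Hypothesis fnil : forall a, a \in A -> (forall i, f i a = 0) -> exists j, a ^+ j = 0.

Lemma left_ideal_mul (J : {vspace aT}) a b :
  left_ideal A J -> a \in A -> b \in J -> a * b \in J.
Proof. by case/andP=> _ AJ aA bJ; apply: (subvP AJ); apply: memv_mul. Qed.

Lemma left_ideal_full (J : {vspace aT}) : left_ideal A J -> 1 \in J -> J = A.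
Proof.
move=> AJ J1; apply/eqP; rewrite eqEsubv; have /andP[-> _] := AJ.
by apply/subvP=> a aA; rewrite -[a]mulr1 left_ideal_mul.
Qed.

Lemma kernel_maximal i : maximal_left_ideal A (A :&: lker (f i))%VS.
Proof.
have memM a : (a \in (A :&: lker (f i))%VS) = (a \in A) && (f i a == 0).
  by rewrite memv_cap memv_ker.
have idM : left_ideal A (A :&: lker (f i))%VS.
  rewrite /left_ideal capvSl; apply/prodvP=> a b aA; rewrite !memM => /andP[bA /eqP b0].
  by rewrite AM // fM // b0 mulr0 eqxx.
split=> // [|J AJ MJ].
  apply/eqP=> MA; have := memM 1; rewrite MA A1 f1.
  by rewrite (negbTE (oner_neq0 K)).
have [JM|/subvPn[x xJ xM]] := boolP (J <= A :&: lker (f i))%VS.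
  by left; apply/eqP; rewrite eqEsubv JM.
right; apply: left_ideal_full => //.
have xA : x \in A by case/andP: AJ => /subvP/(_ x xJ).
have fx : f i x != 0 by move: xM; rewrite memM xA.
rewrite -[1](subrK ((f i x)^-1 *: x)) rpredD ?rpredZ //.
apply: (subvP MJ); rewrite memM rpredB ?rpredZ //=.
by rewrite linearB linearZ /= f1 [_ *: _]mulVf // subrr.
Qed.

(** The kernel of each morphism is a maximal left ideal. Conversely an element a
   of the common kernel lies in every maximal left ideal M: otherwise
   1 = m + b a with m in M and b a nilpotent, so that m is invertible. *)
Lemma jacobson_common_kernel a :
  in_jacobson_radical A a <-> a \in A /\ forall i, f i a = 0.
Proof.
split=> [[aA rad]|[aA a0]].
  split=> // i; have := rad _ (kernel_maximal i).
  by rewrite memv_cap memv_ker => /andP[_ /eqP].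
split=> // M [idM MA Mmax]; apply: contraT => aM.
pose J := (M + amulr a @: A)%VS.
have idJ : left_ideal A J.
  apply/andP; split.
    rewrite subv_add; have /andP[-> _] := idM.
    by apply/subvP=> _ /memv_imgP[b bA ->]; rewrite lfunE /= AM.
  apply/prodvP=> c j cA /memv_addP[m mM [_ /memv_imgP[b bA ->] ->]].
  rewrite lfunE /= mulrDr mulrA; apply: memv_add; first exact: left_ideal_mul.
  by apply/memv_imgP; exists (c * b); rewrite ?AM // lfunE.
have [JM|JA] := Mmax J idJ (addvSl _ _).
  case/negP: aM; rewrite -JM; apply: (subvP (addvSr _ _)).
  by apply/memv_imgP; exists 1; rewrite // lfunE /= mul1r.
have : 1 \in J by rewrite JA.
case/memv_addP=> m mM [_ /memv_imgP[b bA ->]]; rewrite lfunE /= => e.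
have baA : b * a \in A by apply: AM.
have [j j0] : exists j, (b * a) ^+ j = 0.
  by apply: fnil => // i; rewrite fM // a0 mulr0.
have XA i : (b * a) ^+ i \in A by elim: i => // i IHi; rewrite exprS AM.
(* x ^+ i = x ^+ i * (1 - x) + x ^+ i.+1 brings 1 down to M. *)
suff : (b * a) ^+ 0 \in M by move/(left_ideal_full idM)/eqP; rewrite (negbTE MA).
have := mem0v M; rewrite -{1}j0; elim: j {j0} => // i IHi XM; apply: IHi.
rewrite -[_ ^+ i]mulr1 e mulrDr -exprSr.
by apply: rpredD => //; apply: left_ideal_mul.
Qed.

End Radical.

Section NormaliserCounting.

Variable n : nat.
Implicit Types (C D : scomp n) (g u v w t : sperm n).

(** Both sides count cosets of W_D fixed by g. *)
Lemma Ind1CE D g : Ind1C D g = (fixed_cosets D g)%:R.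
Proof.
rewrite /Ind1C cfIndE ?subsetT //.
apply: (mulfI (x := #|WC D|%:R)); first by rewrite pnatr_eq0 -lt0n cardG_gt0.
rewrite mulrA mulfV ?pnatr_eq0 -?lt0n ?cardG_gt0 // mul1r -natrM mulnC -sum_conj_WC.
rewrite -sum1dep_card natr_sum [RHS]big_mkcond; apply: eq_big => [y|y _]; first by rewrite inE.
by rewrite cfun1E /conjg; case: ifP.
Qed.

Fact lab_norm_group C : group_set (lab_norm C).
Proof.
apply/group_setP; split; first by apply/lab_normP=> x y; rewrite !sperm1E.
move=> u v /lab_normP uN /lab_normP vN; apply/lab_normP=> x y.
by rewrite !spermE uN vN.
Qed.

Canonical lab_norm_groupType C := Group (lab_norm_group C).

Lemma card_lab_norm C : #|lab_norm C| = (#|calW C| * #|WC C|)%N.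
Proof.
pose f u := (if u \in lab_norm C then 1 else 0)%N.
have fC u t : t \in WC C -> f (u * t)%g = f u.
  move=> /WCP tC; congr (if _ then _ else _); apply/lab_normP/lab_normP => h x y.
    by rewrite -[x](spermEV t) -[y](spermEV t) -![u _]spermE h !tC.
  by rewrite !spermE h !tC.
rewrite -sum1_card big_mkcond (sum_incr_reps (f := f) fC) -mulr_natr natn.
congr (_ * _)%N; rewrite -sum1_card big_mkcond [RHS]big_mkcond.
by apply: eq_bigr => u _; rewrite calW_incr /f; do 2!case: (_ \in _).
Qed.

Lemma norm_conj_WC D g u t : t \in lab_norm D ->
  (((u * t)^-1 * (g * (u * t)))%g \in WC D) = ((u^-1 * (g * u))%g \in WC D).
Proof.
move=> tN; have /lab_normP tVN : (t^-1)%g \in lab_norm D by rewrite groupV.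
apply/conj_WC/conj_WC => h x; apply/eqP; have := h x.
  by rewrite invMg !spermE => /eqP; rewrite tVN.
by move/eqP=> e; rewrite invMg !spermE tVN.
Qed.

Lemma dvdn_lcoset_union (gT : finGroupType) (H : {group gT}) (S : {set gT}) :
  (forall x h, h \in H -> (x * h \in S)%g = (x \in S)) -> (#|H| %| #|S|)%N.
Proof.
move=> SH; have aS : [acts H, on S | 'R].
  by apply/subsetP=> h hH; rewrite !inE; apply/subsetP=> x; rewrite !inE SH.
rewrite -(acts_sum_card_orbit aS); apply: dvdn_sum => _ /imsetP[x xS ->].
by rewrite orbitR card_lcoset.
Qed.

(** N_W(W_C) / W_C acts freely on the cosets of W_C fixed by g. *)
Lemma calW_dvd_fixed C g : (#|calW C| %| fixed_cosets C g)%N.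
Proof.
rewrite -(@dvdn_pmul2r #|WC C|) ?cardG_gt0 // -card_lab_norm -sum_conj_WC.
by apply: dvdn_lcoset_union => u t tN; rewrite [LHS]in_set [RHS]in_set norm_conj_WC.
Qed.

(** Under the hypothesis w conjugates W_C to W_D. *)
Lemma lab_iff_card C D w :
    (forall x y, (lab D (w x) == lab D (w y)) = (lab C x == lab C y)) ->
  forall g, fixed_cosets D g = fixed_cosets C g.
Proof.
move=> CD g.
have conj t : (t \in WC C) = ((w * (t * w^-1))%g \in WC D).
  apply/WCP/WCP => h x; apply/eqP.
    by rewrite -[X in _ == lab D X](spermEV w) !spermE CD h.
  by have := h (w x); rewrite !spermE spermVE => /eqP; rewrite CD.
have cWC : #|WC D| = #|WC C|.
  rewrite -(card_preimset (WC D) (f := fun t => (w * (t * w^-1))%g)).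
    by apply: eq_card => t; rewrite in_set conj.
  by move=> s t /mulgI/mulIg.
apply/eqP; rewrite -(@eqn_pmul2r #|WC C|) ?cardG_gt0 // -{1}cWC -!sum_conj_WC.
rewrite -(card_preimset _ (@mulIg _ (w^-1)%g)); apply/eqP.
congr #|pred_of_set _|; apply/setP=> u.
rewrite [LHS]in_set in_set [RHS]in_set conj.
apply: (congr1 (fun z => z \in WC D)); rewrite /=.
by rewrite invMg invgK !mulgA.
Qed.

End NormaliserCounting.

(** * Coxeter elements and integral systems *)

Section CoxeterElements.

Variable n : nat.
Implicit Types (C D : scomp n) (g u v w : sperm n) (x y : sidx n) (k : 'I_n).

Definition comp_rep C := block_rep (std_cell C).

Lemma comp_repK C k : comp_rep C (comp_rep C k) = comp_rep C k.
Proof. exact: block_repK. Qed.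

Definition comp_flips C : {set 'I_n} := [set k | (comp_rep C k == k) && ~~ bneg C k].

Lemma comp_flipsP C k : k \in comp_flips C -> comp_rep C k = k.
Proof. by rewrite inE => /andP[/eqP]. Qed.

Lemma comp_rep_eq C k l : (comp_rep C k == comp_rep C l) = (blk C k == blk C l).
Proof.
have repb j : blk C (comp_rep C j) = blk C j.
  have := block_repP (std_cell C) j; rewrite !cle_std_cell => /andP[a b].
  by apply/eqP; rewrite eqn_leq b a.
apply/eqP/eqP => [e|e]; first by rewrite -repb e repb.
by apply: block_rep_eq; rewrite cle_std_cell e.
Qed.

Lemma orbit_rel_lab C x y :
  orbit_rel (comp_rep C) (comp_flips C) x y = (lab C x == lab C y).
Proof.
have repb j : bneg C (comp_rep C j) = bneg C j.
  by rewrite /bneg; congr (_`_ _ < 0); apply/eqP; rewrite -comp_rep_eq comp_repK.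
rewrite /orbit_rel comp_rep_eq inE comp_repK eqxx repb /=.
apply/andP/labP => [[/eqP e s]|[e s]]; split; rewrite ?e //.
  by move=> nx; move: s; rewrite nx orbF => /eqP.
by case: (boolP (bneg C x.2)) => [/s ->|]; rewrite ?eqxx ?orbT.
Qed.

(** A Coxeter element of W_C: its orbits on signed points are the classes of
   equal labels. *)
Definition cox C := gcyc (comp_rep C) (comp_flips C).

Lemma conj_coxP C D w :
  reflect (lab_sub C D (w^-1)%g) ((w^-1 * (cox C * w))%g \in WC D).
Proof.
have cyc := gcycP (@comp_repK C) (@comp_flipsP C) (fun x => lab D ((w^-1)%g x)).
apply: (iffP (conj_WC _ _ _)) => [/cyc h x y xy|h].
  by apply: h; rewrite orbit_rel_lab xy.
by apply/cyc => x y; rewrite orbit_rel_lab => /eqP; apply: h.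
Qed.

(** A coset u W_C is fixed by the Coxeter element only if u maps classes onto
   classes, that is for u in the normaliser. *)
Lemma fixed_cox C : fixed_cosets C (cox C) = #|calW C|.
Proof.
apply: eq_card => u; rewrite in_set calW_incr andbC; congr andb.
apply/conj_coxP/idP => [h|].
  rewrite -groupV; apply/lab_normP; exact: lab_sub_eq h (leqnn _).
by rewrite -groupV => /lab_normP h x y xy; apply/eqP; rewrite h xy.
Qed.

(** A fixed coset of W_D conjugates the cyclic group of cox C, whose orbits are
   the classes of C, into W_D. *)
Lemma fixed_cox_neq0 C D : fixed_cosets D (cox C) != 0%N -> exists w, lab_sub C D w.
Proof.
rewrite -lt0n => /card_gt0P[u]; rewrite in_set => /andP[_ /conj_coxP uC].
by exists (u^-1)%g.
Qed.

End CoxeterElements.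

Section IntegralCharacters.

(** A Smith normal form reduces to a diagonal system, where each relevant
   coordinate of the solution is a rational algebraic integer, hence an
   integer. *)
Lemma int_solution m q (U : 'M[int]_(m, q)) (v : 'cV[int]_m) (z : 'cV[algC]_q) :
    (forall j, z j 0 \in Aint) ->
    map_mx intr v = map_mx intr U *m z ->
  exists c : 'cV[int]_q, v = U *m c.
Proof.
move=> zA vE; have [L Lu [R Ru [d _ UE]]] := int_Smith_normal_form U.
pose y := map_mx intr R *m z : 'cV[algC]_q.
pose v' := invmx L *m v.
have diagE (A : pzRingType) (f : int -> A) (b : 'cV[A]_q) (i : 'I_m) : f 0 = 0 ->
    ((\matrix_(i, j) f (d`_i *+ (i == j :> nat))) *m b) i 0 =
    if insub (i : nat) is Some j then f d`_i * b j 0 else 0.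
  move=> f0; rewrite !mxE; case: insubP => [j _ /= ji|iq].
    rewrite (bigD1 j) //= mxE -ji eqxx mulr1n big1 ?addr0 // => k kj.
    rewrite mxE; case: eqP => [e|_]; last by rewrite f0 mul0r.
    by case/eqP: kj; apply: val_inj; rewrite /= ji.
  rewrite big1 // => j _; rewrite mxE; case: eqP => [e|_]; last by rewrite f0 mul0r.
  by move: iq; rewrite e ltn_ord.
have v'E i : (v' i 0)%:~R =
    if insub (i : nat) is Some j then (d`_i)%:~R * y j 0 else 0 :> algC.
  have v'y : map_mx intr v' =
      (\matrix_(i, j) (d`_i *+ (i == j :> nat))%:~R) *m y :> 'cV[algC]_m.
    rewrite /v' map_mxM vE {1}UE !map_mxM !mulmxA -map_mxM mulVmx // map_mx1 mul1mx.
    by congr (_ *m _ *m _); apply/matrixP=> a b; rewrite !mxE.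
  have <- := diagE _ (fun a : int => a%:~R : algC) y i (mulr0z 1).
  by rewrite -v'y [RHS]mxE.
pose c' : 'cV[int]_q := \col_j (if insub (j : nat) is Some i then
   divz (v' i 0) d`_j else 0).
exists (invmx R *m c'); rewrite UE -!mulmxA mulKVmx //.
rewrite -[LHS](mulKVmx Lu); congr (_ *m _); apply/colP=> i; rewrite -/v'.
rewrite (diagE _ id) //; have := v'E i; case: insubP => [j _ /= ji|_] vi; last first.
  by apply/eqP; move/eqP: vi; rewrite intr_eq0.
rewrite [c' _ _]mxE; have -> : insub (j : nat) = Some i by rewrite ji; apply: valK.
have -> : d`_j = d`_i by rewrite ji.
case: (eqVneq d`_i 0) => [di0|di0].
  by apply/eqP; move: vi; rewrite di0 mul0r mul0r => /eqP; rewrite intr_eq0.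
have dC : (d`_i)%:~R != 0 :> algC by rewrite intr_eq0.
have /intrP[w wE] : y j 0 \in Num.int.
  apply: Cint_rat_Aint.
    have -> : y j 0 = (v' i 0)%:~R / (d`_i)%:~R by rewrite vi mulrAC mulfV ?mul1r.
    by rewrite rpred_div // rpred_int.
  by rewrite mxE rpred_sum // => k _; rewrite rpredM // mxE Aint_int // intr_int.
move: vi; rewrite wE -intrM => /intr_inj ->.
by rewrite /= [X in divz X _]mulrC mulzK.
Qed.

End IntegralCharacters.

(** * The radical of the Mantaci-Reutenauer algebra *)

Lemma sub_lker (K : fieldType) (aT rT : vectType K) (f : 'Hom(aT, rT)) u v :
  f u = f v -> u - v \in lker f.
Proof. by move=> e; rewrite memv_ker linearB /= e subrr. Qed.

Section RadicalOfKSigma.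

Variables (K : fieldType) (n : nat).
Implicit Types (C D : scomp n) (g w : sperm n) (a : galg K (sperm n)).

Definition evalx_fun g a : K^o := \sum_C xcoord a C * (fixed_cosets C g)%:R.

Fact evalx_is_linear g : linear (evalx_fun g).
Proof.
move=> c a b; rewrite /evalx_fun scaler_sumr -big_split; apply: eq_bigr => C _ /=.
by rewrite /xcoord linearP /= mulrDl -mulrA.
Qed.

HB.instance Definition _ g :=
  GRing.isLinear.Build K (galg K (sperm n)) K^o *:%R (evalx_fun g) (@evalx_is_linear g).

(** The value at g of the image under theta, in K; it is defined from the
   coordinates since an element of K (x) Z Irr has no value at g unless character
   values are mapped to K. *)
Definition evalx g : 'Hom(galg K (sperm n), K^o) := linfun (evalx_fun g).

Lemma evalxE g a : evalx g a = \sum_C xcoord a C * (fixed_cosets C g)%:R :> K.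
Proof. by rewrite lfunE. Qed.

Lemma xcoordZ c a C : xcoord (c *: a) C = c * xcoord a C.
Proof. by rewrite /xcoord linearZ. Qed.

Lemma xcoordB a b C : xcoord (a - b) C = xcoord a C - xcoord b C.
Proof. by rewrite /xcoord linearB. Qed.

Lemma xcoord_xC C D : xcoord (xC C K) D = (D == C)%:R.
Proof.
have -> : xC C K = comb_x (fun D => (D == C)%:R).
  rewrite /comb_x (bigD1 C) //= eqxx scale1r big1 ?addr0 // => E /negbTE ->.
  by rewrite scale0r.
exact: xcoord_comb_x.
Qed.

Lemma evalx_xC g C : evalx g (xC C K) = (fixed_cosets C g)%:R :> K.
Proof.
rewrite evalxE (bigD1 C) //= xcoord_xC eqxx mul1r big1 ?addr0 // => D /negbTE DC.
by rewrite xcoord_xC DC mul0r.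
Qed.

Lemma evalx_galg_of (rp : 'I_n -> 'I_n) (F : {set 'I_n}) b :
    (forall k, rp (rp k) = rp k) -> (forall k, k \in F -> rp k = k) -> relabel_inv b ->
  evalx (gcyc rp F) (galg_of b) = cell_char rp F b :> K.
Proof.
move=> rpK rpF ib; have [c bc] := inv_span ib.
rewrite (eq_galg_of bc) galg_of_comb_lift evalxE /cell_char.
under [RHS]eq_bigr => m _ do rewrite bc mulr_suml.
rewrite exchange_big; apply: eq_bigr => C _; rewrite xcoord_comb_x -(cell_char_lift C rpK rpF K).
by rewrite /cell_char mulr_sumr; apply: eq_bigr => m _; rewrite mulrA.
Qed.

Lemma KSigma_radical a : in_jacobson_radical (KSigma K n) a <->
  a \in KSigma K n /\ forall (rp : 'I_n -> 'I_n) (F : {set 'I_n}),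
    (forall k, rp (rp k) = rp k) -> (forall k, k \in F -> rp k = k) ->
    evalx (gcyc rp F) a = 0.
Proof.
pose I := {rF : ('I_n -> 'I_n) * {set 'I_n} |
  (forall k, rF.1 (rF.1 k) = rF.1 k) /\ (forall k, k \in rF.2 -> rF.1 k = k)}.
pose f (i : I) := evalx (gcyc (projT1 i).1 (projT1 i).2).
have fP (i : I) b : relabel_inv b -> f i (galg_of b) = cell_char (projT1 i).1 (projT1 i).2 b :> K.
  by case: i => -[rp F] /= [rpK rpF]; apply: evalx_galg_of.
have crit : in_jacobson_radical (KSigma K n) a <-> a \in KSigma K n /\ forall i, f i a = 0.
  apply: jacobson_common_kernel => [||i|i b c|b].
  - exact: KSigma1.
  - exact: KSigmaM.
  - by rewrite -galg_of_one fP ?cell_char_one //; apply: delta_one_inv.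
  - move=> /KSigmaP[b' ib <-] /KSigmaP[c' ic <-].
    rewrite -galg_of_conv // !fP ?cell_char_conv //; last exact: conv_inv.
    by rewrite mulrC.
  move=> /KSigmaP[b' ib <-] fb0; apply: galg_of_nilpotent => // rp F rpK rpF.
  rewrite -evalx_galg_of //.
  exact: (fb0 (exist _ (rp, F) (conj rpK rpF))).
split=> [/crit[aK a0]|[aK a0]]; last first.
  by apply/crit; split=> // -[[rp F] /= [rpK rpF]]; apply: a0.
split=> // rp F rpK rpF.
exact: (a0 (exist _ (rp, F) (conj rpK rpF))).
Qed.

Definition theta_fun a : KIrr K n :=
  \sum_i coord (xtuple K n) i a *: toKIrr K (Ind1C (enum_val i)).

Fact theta_is_linear : linear theta_fun.
Proof.
move=> c a b; rewrite /theta_fun scaler_sumr -big_split; apply: eq_bigr => i _ /=.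
by rewrite linearP /= scalerDl scalerA.
Qed.

HB.instance Definition _ :=
  GRing.isLinear.Build K (galg K (sperm n)) (KIrr K n) *:%R theta_fun theta_is_linear.

Lemma thetaE a : theta K n a = \sum_C xcoord a C *: toKIrr K (Ind1C C).
Proof.
rewrite -[theta K n]/(linfun theta_fun) lfunE /= /theta_fun.
rewrite [RHS](reindex _ (onW_bij _ (enum_val_bij _))).
by apply: eq_bigr => i _; rewrite /xcoord enum_valK.
Qed.

Lemma Ker_thetaE a :
  (a \in Ker_theta K n) = (a \in KSigma K n) && (theta K n a == 0).
Proof. by rewrite memv_cap memv_ker. Qed.

(** The numbers of fixed cosets are integral combinations of the multiplicities
   of the irreducible characters in the induced ones, so that a linear relation
   over K between the latter holds between the former. *)
Lemma Ker_theta_evalx a g : a \in Ker_theta K n -> evalx g a = 0.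
Proof.
rewrite Ker_thetaE => /andP[_ /eqP a0].
pose U : 'M[int]_(#|{: scomp n}|, Nirr [set: sperm n]) :=
  \matrix_(c, i) Num.floor '[Ind1C (enum_val c), 'chi_i].
pose v : 'cV[int]_#|{: scomp n}| := \col_c (fixed_cosets (enum_val c) g)%:Z.
pose z : 'cV[algC]_(Nirr [set: sperm n]) := \col_i 'chi_i g.
have [||c vE] := @int_solution _ _ U v z.
- by move=> j; rewrite mxE Aint_irr.
- apply/colP=> k; rewrite !mxE -[LHS]Ind1CE.
  rewrite {1}[Ind1C _]cfun_sum_cfdot sum_cfunE; apply: eq_bigr => i _.
  rewrite !mxE cfunE floorK // rpred_nat_num //.
  by apply: Cnat_cfdot_char_irr; apply: cfInd_char; apply: rpred1.
rewrite evalxE (reindex _ (onW_bij _ (enum_val_bij _))) /=.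
have vK k : (fixed_cosets (enum_val k) g)%:R = \sum_i (U k i)%:~R * (c i 0)%:~R :> K.
  have := congr1 (fun m : 'cV[int]_ _ => (m k 0)%:~R : K) vE.
  rewrite !mxE -pmulrn => ->; rewrite rmorph_sum; apply: eq_bigr => i _.
  by rewrite rmorphM.
under eq_bigr => k _ do rewrite vK mulr_sumr.
rewrite exchange_big big1 // => i _.
have := congr1 (fun h : KIrr K n => h i) a0; rewrite thetaE sum_ffunE ffunE => e.
transitivity ((\sum_C xcoord a C * (Num.floor '[Ind1C C, 'chi_i])%:~R) * (c i 0)%:~R : K).
  rewrite mulr_suml [RHS](reindex _ (onW_bij _ (enum_val_bij _))) /=.
  by apply: eq_bigr => k _; rewrite mxE mulrA.
rewrite [X in X * _](_ : _ = 0) ?mul0r // -[RHS]e; apply: eq_bigr => C _.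
by rewrite !ffunE.
Qed.

Lemma xC_sub_Ker C D : (forall g, fixed_cosets C g = fixed_cosets D g) ->
  xC C K - xC D K \in Ker_theta K n.
Proof.
move=> CD; rewrite memv_cap rpredB ?xC_KSigma //=.
have thetax E : theta K n (xC E K) = toKIrr K (Ind1C E).
  rewrite thetaE (bigD1 E) //= xcoord_xC eqxx scale1r big1 ?addr0 // => E' /negbTE EE'.
  by rewrite xcoord_xC EE' scale0r.
have indE : Ind1C C = Ind1C D by apply/cfunP => g; rewrite !Ind1CE CD.
apply: (@sub_lker K _ _ (theta K n) (xC C K) (xC D K)).
apply: (etrans (thetax C)).
rewrite indE.
exact: (esym (thetax D)).
Qed.

End RadicalOfKSigma.

Arguments evalx {K n} g.

Lemma natr_char_eq0 (K : fieldType) (p m : nat) : has_characteristic K p ->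
  (m%:R == 0 :> K) = (p %| m)%N.
Proof.
case: p => [/pcharf0P ->|p hp]; first by rewrite dvd0n.
by rewrite (dvdn_pcharf hp).
Qed.

Section RadicalDescription.

Variables (K : fieldType) (p n : nat).
Hypothesis hp : has_characteristic K p.
Implicit Types (C D : scomp n) (g w : sperm n) (a : galg K (sperm n)).

Let rad_sum := (Ker_theta K n + \sum_(C : scomp n | (p %| #|calW C|)%N) <[xC C K]>)%VS.

Lemma rad_sum_KSigma : (rad_sum <= KSigma K n)%VS.
Proof.
rewrite subv_add capvSl; apply/subv_sumP => C _.
by rewrite -memvE xC_KSigma.
Qed.

Lemma rad_sum_evalx a g : a \in rad_sum -> evalx g a = 0.
Proof.
case/memv_addP=> b bK [c /memv_sumP[d dE ->] ->].
rewrite linearD /= (Ker_theta_evalx g bK) add0r linear_sum big1 // => C pC.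
have /vlineP[e ->] := dE C pC; rewrite linearZ /= evalx_xC.
have /eqP -> : (fixed_cosets C g)%:R == 0 :> K.
  by rewrite (natr_char_eq0 _ hp) (dvdn_trans pC) // calW_dvd_fixed.
by rewrite scaler0.
Qed.

(** Induction on the number of nonzero coordinates. At one C of largest classes
   among them, the value at the Coxeter element of W_C only involves those D for
   which W_D is conjugate to W_C, each with coefficient |W(C)|. If p divides
   |W(C)| the term of x_C is removed; otherwise the coordinates at these D add
   up to 0 and their terms form an element of the kernel of theta. *)
Lemma common_kernel_rad_sum N a : a \in KSigma K n -> (forall C, evalx (cox C) a = 0) ->
  (#|[set C | xcoord a C != 0%R]| <= N)%N -> a \in rad_sum.
Proof.
elim: N a => [|N IHN] a aK a0.
  rewrite leqn0 cards_eq0 => /eqP supp0; rewrite (KSigma_comb_x aK) /comb_x.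
  rewrite big1 ?mem0v // => C _.
  have /setP/(_ C) := supp0; rewrite !inE => /negbFE/eqP ->.
  by rewrite scale0r.
move=> suppN; case: (pickP (fun C => xcoord a C != 0)) => [C0 aC0|no]; last first.
  apply: IHN => //; rewrite (_ : [set C | _] = set0) ?cards0 //.
  by apply/setP=> C; rewrite !inE no.
have reduce b C : b \in rad_sum -> xcoord a C != 0 -> xcoord b C = xcoord a C ->
    (forall D, xcoord a D = 0 -> xcoord b D = 0) -> a \in rad_sum.
  move=> bT aC bC sub; rewrite -[a](subrK b) rpredD //; apply: IHN.
  - by rewrite rpredB // (subvP rad_sum_KSigma).
  - by move=> D; rewrite linearB /= a0 (rad_sum_evalx _ bT) subrr.
  rewrite -ltnS; apply: leq_trans suppN; apply: proper_card; apply/properP; split.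
    apply/subsetP=> D; rewrite !inE xcoordB; apply: contraNneq => aD.
    by rewrite aD (sub D aD) subrr.
  by exists C; rewrite inE // xcoordB bC subrr eqxx.
case: (@arg_maxnP _ C0 (fun C => xcoord a C != 0) (fun C => #|lab_pairs C|) aC0).
move=> C aC Cmax; case: (boolP (p %| #|calW C|)%N) => [pC|pC].
  apply: (reduce (xcoord a C *: xC C K) C) => //.
  - rewrite memvZ //; apply: (subvP (addvSr _ _)).
    by apply: (subvP (sumv_sup C pC (subvv _))); apply: memv_line.
  - by rewrite xcoordZ xcoord_xC eqxx mulr1.
  move=> D aD; rewrite xcoordZ xcoord_xC.
  case: (eqVneq D C) aC => [<-|_ _]; first by rewrite aD eqxx.
  by rewrite mulr0.
pose E D := [forall g, fixed_cosets D g == fixed_cosets C g].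
have sumE : \sum_(D | E D) xcoord a D = 0.
  have := a0 C; rewrite evalxE (bigID E) /= [X in _ + X]big1 ?addr0 => [|D nE].
    rewrite (eq_bigr (fun D => xcoord a D * #|calW C|%:R)) => [|D /forallP/(_ (cox C))/eqP ->].
      rewrite -mulr_suml => /eqP; rewrite mulf_eq0 (natr_char_eq0 _ hp) (negbTE pC) orbF.
      by move/eqP.
    by rewrite fixed_cox.
  apply/eqP; rewrite mulf_eq0; apply: contraR nE; rewrite negb_or => /andP[aD fD].
  have [w CD] : exists w, lab_sub C D w.
    by apply: fixed_cox_neq0; apply: contraNneq fD => ->.
  apply/forallP=> g; apply/eqP; apply: (lab_iff_card (w := w)).
  by apply: lab_sub_eq CD _; apply: Cmax.
pose b := \sum_(D | E D) xcoord a D *: xC D K.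
have xb D : xcoord b D = if E D then xcoord a D else 0.
  have -> : b = comb_x (fun D => if E D then xcoord a D else 0).
    rewrite /b /comb_x [LHS]big_mkcond; apply: eq_bigr => D' _.
    by case: ifP; rewrite ?scale0r.
  by rewrite xcoord_comb_x.
apply: (reduce b C) => //; last first.
- by move=> D aD; rewrite xb aD if_same.
- by rewrite xb (_ : E C) //; apply/forallP.
apply: (subvP (addvSl _ _)).
have -> : b = \sum_(D | E D) xcoord a D *: (xC D K - xC C K).
  transitivity (b - (\sum_(D | E D) xcoord a D) *: xC C K).
    by rewrite sumE scale0r subr0.
  rewrite scaler_suml -sumrB.
  by apply: eq_bigr => D _; rewrite scalerBr.
apply: rpred_sum => D /forallP DC; rewrite rpredZ //; apply: xC_sub_Ker => g.
exact/eqP.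
Qed.

End RadicalDescription.

Theorem theorem6p4 (K : fieldType) (p n : nat)
    (hp : has_characteristic K p) (hn : (1 <= n)%N) :
  forall a : galg K (sperm n),
    in_jacobson_radical (KSigma K n) a <->
    a \in (Ker_theta K n + \sum_(C : scomp n | (p %| #|calW C|)%N) <[xC C K]>)%VS.
Proof.
move=> a; split=> [/KSigma_radical[aK a0]|aT].
  apply: (common_kernel_rad_sum hp aK _ (leqnn _)) => C.
  by apply: a0; [exact: comp_repK | exact: comp_flipsP].
apply/KSigma_radical; split=> [|rp F _ _]; last exact: rad_sum_evalx hp _ _ aT.
exact: (subvP (rad_sum_KSigma K p n)).
Qed.
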